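(* Let $T$ be an o-minimal theory with monster model $\mathfrak U$, and assume that every global invariant type is domination-equivalent to a product $q_0\otimes\cdots\otimes q_n$ of global invariant $1$-types. Then $\otimes$ respects $\geq_{\mathrm D}$ (so $\widetilde{\mathrm{Inv}}(\mathfrak U)$ is a well-defined ordered monoid), and \[(\widetilde{\mathrm{Inv}}(\mathfrak U),\otimes,\geq_{\mathrm D},\perp^{\mathrm w})\cong(\mathscr P_{\mathrm{fin}}(X),\cup,\supseteq,D),\] where $X$ is any maximal set of pairwise weakly orthogonal nonrealised global invariant $1$-types, $\mathscr P_{\mathrm{fin}}(X)$ is the set of finite subsets of $X$, and $D(x,y)$ holds iff $x\cap y=\emptyset$. Moreover, if every global invariant type is equidominant to a product of global invariant $1$-types, then $\equiv_{\mathrm D}$ coincides with $\sim_{\mathrm D}$ on $S^{\mathrm{inv}}(\mathfrak U)$, hence $\overline{\mathrm{Inv}}(\mathfrak U)=\widetilde{\mathrm{Inv}}(\mathfrak U)$.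
   Context: $T$ is a complete first-order theory with infinite models; o-minimal means there is a definable dense-or-not linear order $<$ such that every definable subset of the line is a finite union of points and intervals. $\mathfrak U$ is a monster model: $\kappa$-saturated and $\kappa$-strongly homogeneous for a large strong limit cardinal $\kappa$; ''small'' means of size $<\kappa$. Global types are complete types over $\mathfrak U$ in finitely many variables, realised in a larger elementary extension. A global type $p(x)$ is $A$-invariant ($A$ small) if for every formula $\phi(x,y)$ without parameters and all $a,b\in\mathfrak U$ with $a\equiv_A b$, $p\vdash\phi(x,a)\leftrightarrow\phi(x,b)$; it is invariant if $A$-invariant for some small $A$. $S^{\mathrm{inv}}(\mathfrak U)$ is the set of global invariant types. For $p$ $A$-invariant and $B\supseteq\mathfrak U$, $p\mid B$ denotes the unique $A$-invariant extension of $p$ to $B$. For $p(x)$ invariant and $q(y)$ global, $p(x)\otimes q(y)$ is the global type in $xy$ such that $\phi(x,y)\in p\otimes q$ iff $\phi(x,b)\in p\mid\mathfrak U b$ for some/any $b\models q$; $\otimes$ is associative on invariant types. For global $p(x),q(y)$: $p\geq_{\mathrm D}q$ ($p$ dominates $q$) iff there are a small $A$ and a complete type $r(x,y)$ over $A$ containing $(p\restriction A)\cup(q\restriction A)$ with $p(x)\cup r(x,y)\vdash q(y)$; $p\sim_{\mathrm D}q$ iff $p\geq_{\mathrm D}q$ and $q\geq_{\mathrm D}p$; $p\equiv_{\mathrm D}q$ (equidominance) iff a single such $r$ witnesses both dominations. $p\perp^{\mathrm w}q$ (weakly orthogonal) iff $p(x)\cup q(y)$ implies a complete type over $\mathfrak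 U$. A type is realised if realised in $\mathfrak U$. $\widetilde{\mathrm{Inv}}(\mathfrak U)=S^{\mathrm{inv}}(\mathfrak U)/\sim_{\mathrm D}$ with the partial order induced by $\geq_{\mathrm D}$ and the relation induced by $\perp^{\mathrm w}$; $\overline{\mathrm{Inv}}(\mathfrak U)=S^{\mathrm{inv}}(\mathfrak U)/\equiv_{\mathrm D}$. ''$\otimes$ respects $\geq_{\mathrm D}$'' means: for invariant $p_0,p_1,q$, if $p_0\geq_{\mathrm D}p_1$ then $p_0\otimes q\geq_{\mathrm D}p_1\otimes q$ and $q\otimes p_0\geq_{\mathrm D}q\otimes p_1$; then $\otimes$ induces a monoid operation on $\widetilde{\mathrm{Inv}}(\mathfrak U)$ with neutral element the class of realised types. *)

(* Defs.v *)
From mathcomp Require Import all_boot.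
From mathcomp Require Import boolp classical_sets functions cardinality.

Set Implicit Arguments.
Unset Strict Implicit.
Unset Printing Implicit Defensive.

Local Open Scope classical_set_scope.

Definition either (A B C : Type) (f : A -> C) (g : B -> C) (s : A + B) : C :=
  match s with inl a => f a | inr b => g b end.

Definition sum_map (A B A' B' : Type) (f : A -> A') (g : B -> B') :
  A + B -> A' + B' := either (inl \o f) (inr \o g).

Record language := Language {
  fsym : Type; farity : fsym -> nat;
  rsym : Type; rarity : rsym -> nat }.

(* Terms and formulas with free variables named by [V].  A formula over
   parameters from [B] in the variables x_0, ..., x_(n-1) is an element of
   [formula L ('I_n + B)]: the parameter names are evaluated like variables. *)
Inductive term (L : language) (V : Type) : Type :=
| Var of V
| App (f : fsym L) of ('I_(farity f) -> term L V).

(* In [All p], [None] is the bound variable. *)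
Inductive formula (L : language) (V : Type) : Type :=
| Bot
| Eq of term L V & term L V
| Rel (r : rsym L) of ('I_(rarity r) -> term L V)
| Imp of formula L V & formula L V
| All of formula L (option V).

Arguments Var {L V}.
Arguments Bot {L V}.

Definition Not L V (phi : formula L V) := Imp phi Bot.

Fixpoint trename L V W (s : V -> W) (t : term L V) : term L W :=
  match t with
  | Var v => Var (s v)
  | App f ts => App (fun i => trename s (ts i))
  end.

Fixpoint rename L V W (s : V -> W) (phi : formula L V) : formula L W :=
  match phi with
  | Bot => Bot
  | Eq t u => Eq (trename s t) (trename s u)
  | Rel r ts => Rel (fun i => trename s (ts i))
  | Imp p q => Imp (rename s p) (rename s q)
  | All p => All (rename (omap s) p)
  end.

Record structure (L : language) := Structure {
  dom :> Type;
  dom_inh : inhabited dom;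
  fint : forall f : fsym L, ('I_(farity f) -> dom) -> dom;
  rint : forall r : rsym L, ('I_(rarity r) -> dom) -> Prop }.

Fixpoint teval L (M : structure L) V (v : V -> M) (t : term L V) : M :=
  match t with
  | Var x => v x
  | App f ts => fint (fun i => teval v (ts i))
  end.

Fixpoint sat L (M : structure L) V (v : V -> M) (phi : formula L V) : Prop :=
  match phi with
  | Bot => False
  | Eq t u => teval v t = teval v u
  | Rel r ts => rint (fun i => teval v (ts i))
  | Imp p q => sat v p -> sat v q
  | All p => forall d : M, sat (fun o => oapp v d o) p
  end.

Definition theory (L : language) := set (formula L void).

Definition models L (M : structure L) (T : theory L) :=
  forall phi, T phi -> sat (of_void M) phi.

Definition consequence L (T : theory L) (phi : formula L void) :=
  forall M : structure L, models M T -> sat (of_void M) phi.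

Definition complete_theory L (T : theory L) :=
  (exists M : structure L, models M T) /\
  (forall phi, consequence T phi \/ consequence T (Not phi)).

Definition has_infinite_model L (T : theory L) :=
  exists M : structure L, models M T /\ infinite_set [set: M].

Section OMinimal.
Variables (L : language) (M : structure L).

Definition pair_val (x y : M) : 'I_2 -> M := fun i => if i == ord0 then x else y.

(* The binary relation defined by a parameter-free formula in two variables *)
Definition rel_of (lt : formula L 'I_2) (x y : M) := sat (pair_val x y) lt.

Definition strict_linear_order (R : M -> M -> Prop) :=
  [/\ (forall x, ~ R x x),
      (forall x y z, R x y -> R y z -> R x z) &
      (forall x y, [\/ R x y, x = y | R y x])].

Definition is_point (D : set M) := exists a, D = [set a].

(* Open intervals; the endpoint [None] stands for -oo or +oo. *)
Definition is_interval (R : M -> M -> Prop) (D : set M) :=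
  exists lo hi : option M,
    D = [set x | (if lo is Some a then R a x else True) /\
                 (if hi is Some b then R x b else True)].

Definition definable1 (D : set M) :=
  exists phi : formula L ('I_1 + M), D = [set x | sat (either (fun=> x) id) phi].

Definition o_minimal_structure (R : M -> M -> Prop) :=
  strict_linear_order R /\
  forall D, definable1 D -> exists F : set (set M),
    [/\ finite_set F, (forall I, F I -> is_point I \/ is_interval R I) &
        D = \bigcup_(I in F) I].

End OMinimal.

Definition o_minimal L (T : theory L) :=
  exists lt : formula L 'I_2, forall M : structure L, models M T ->
    o_minimal_structure (@rel_of L M lt).

Definition elementary L (M N : structure L) (e : M -> N) :=
  forall phi : formula L M, sat id phi <-> sat e phi.

Definition automorphism L (M : structure L) (s : M -> M) :=
  [/\ bijective s,
      (forall (f : fsym L) a, s (fint (f := f) a) = fint (f := f) (s \o a)) &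
      (forall (r : rsym L) a, rint (r := r) a <-> rint (r := r) (s \o a))].

(* Types over a parameter set given as the image of j : B -> N; two names in B
   may denote the same element. *)
Section Types.
Variables (L : language) (N : structure L) (B : Type) (j : B -> N).

Definition realises n (p : set (formula L ('I_n + B))) (a : 'I_n -> N) :=
  forall phi, p phi -> sat (either a j) phi.

Definition complete_type n (p : set (formula L ('I_n + B))) :=
  (forall F, finite_set F -> F `<=` p -> exists a, realises F a) /\
  (forall phi, p phi \/ p (Not phi)).

Definition equiv_over m (a b : 'I_m -> N) :=
  forall phi : formula L ('I_m + B), sat (either a j) phi <-> sat (either b j) phi.

End Types.

(* phi(x,b), for phi(x,y) without parameters *)
Definition inst L n m B (phi : formula L ('I_n + 'I_m)) (b : 'I_m -> B) :
  formula L ('I_n + B) := rename (sum_map id b) phi.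

(* A type over j : B -> N is invariant over i : A -> N. *)
Definition invariant_over L (N : structure L) A (i : A -> N) B (j : B -> N)
    n (p : set (formula L ('I_n + B))) :=
  forall m (phi : formula L ('I_n + 'I_m)) (a b : 'I_m -> B),
    equiv_over i (j \o a) (j \o b) -> (p (inst phi a) <-> p (inst phi b)).

Definition card_lt S T (A : set S) (B : set T) := (A #<= B)%card /\ ~ (B #<= A)%card.

(* The cardinal kappa is represented by a type [K] of that cardinality. *)
Definition small (K S : Type) (A : set S) := card_lt A [set: K].

Definition strong_limit (K : Type) :=
  forall A : set K, small K A -> small K [set B : set K | B `<=` A].

Definition saturated (K : Type) L (U : structure L) :=
  forall (A : set U), small K A -> forall n (p : set (formula L ('I_n + A))),
    complete_type (@set_val U A) p -> exists a, realises (@set_val U A) p a.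

Definition strongly_homogeneous (K : Type) L (U : structure L) :=
  forall (A : set U) (f : A -> U), small K A ->
    (forall phi : formula L A, sat set_val phi <-> sat f phi) ->
    exists2 s : U -> U, automorphism s & forall a : A, s (set_val a) = f a.

(* "Large" is read as: uncountable and larger than the language. *)
Definition monster (K : Type) L (T : theory L) (U : structure L) :=
  [/\ [/\ small K [set: nat], small K [set: fsym L] & small K [set: rsym L]],
      strong_limit K, models U T, saturated K U & strongly_homogeneous K U].

Record gtype L (U : structure L) := GType {
  gdim : nat;
  gset :> set (formula L ('I_gdim + U)) }.
Arguments gset {L U} g.

Section Global.
Variables (K : Type) (L : language) (U : structure L).

Implicit Types p q : gtype U.

Definition invariant_base p (A : set U) :=
  small K A /\ invariant_over (@set_val U A) (@id U) p.

Definition Sinv : set (gtype U) :=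
  [set p : gtype U | complete_type (@id U) p /\ exists A, invariant_base p A].

Definition realised p := exists a, realises (@id U) p a.

(* p | B.  Here B is the image of j : B -> N with N an elementary extension of
   U via e, and k : U -> B names the elements of U in B, so that j \o k = e. *)
Definition extension p (N : structure L) (e : U -> N) B (j : B -> N) (k : U -> B) :
    set (formula L ('I_(gdim p) + B)) :=
  [set phi | exists A, invariant_base p A /\
    exists r : set (formula L ('I_(gdim p) + B)),
      [/\ complete_type j r,
          invariant_over (e \o @set_val U A) j r,
          (forall psi, gset p psi -> r (rename (sum_map id k) psi)) &
          r phi]].
Arguments extension p {N} e {B} j k.

(* phi(x,y) seen as a formula in x over U and the names y *)
Definition split_vars n m : 'I_(n + m) + U -> 'I_n + ('I_m + U) :=
  either (fun i => sum_map id inl (fintype.split i)) (inr \o inr).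

(* Membership is required for some realisation b of q (it does not depend on b);
   B = Ub is named by 'I_m + U.  The product is empty if p is not invariant. *)
Definition tensor p q : gtype U :=
  @GType L U (gdim p + gdim q) [set phi |
    exists (N : structure L) (e : U -> N) (b : 'I_(gdim q) -> N),
      [/\ elementary e, realises e q b &
          extension p e (either b e) inr (rename (@split_vars _ _) phi)]].

Definition left_vars n m B : formula L ('I_n + B) -> formula L ('I_(n + m) + B) :=
  rename (sum_map (@lshift n m) id).

Definition right_vars n m B : formula L ('I_m + B) -> formula L ('I_(n + m) + B) :=
  rename (sum_map (@rshift n m) id).

Definition over (A : set U) n : formula L ('I_n + A) -> formula L ('I_n + U) :=
  rename (sum_map id (@set_val U A)).

Definition restrict n (p : set (formula L ('I_n + U))) (A : set U) :
  set (formula L ('I_n + A)) := [set phi | p (over phi)].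
Arguments restrict {n} p A.

(* Consequence modulo the elementary diagram of U *)
Definition entails n (G D : set (formula L ('I_n + U))) :=
  forall (N : structure L) (e : U -> N) (a : 'I_n -> N),
    elementary e -> realises e G a -> realises e D a.

Definition in_x p m : set (formula L ('I_(gdim p + m) + U)) :=
  @left_vars _ m U @` p.
Definition in_y n q : set (formula L ('I_(n + gdim q) + U)) :=
  @right_vars n _ U @` q.
Arguments in_x p m : clear implicits.
Arguments in_y n q : clear implicits.

Definition link p q (A : set U) (r : set (formula L ('I_(gdim p + gdim q) + A))) :=
  [/\ small K A,
      complete_type (@set_val U A) r,
      @left_vars _ _ A @` restrict p A `<=` r &
      @right_vars _ _ A @` restrict q A `<=` r].
Arguments link p q A r : clear implicits.

Definition dominates p q := exists A r, link p q A r /\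
  entails (in_x p (gdim q) `|` @over A _ @` r) (in_y (gdim p) q).

Definition dom_equiv p q := dominates p q /\ dominates q p.

Definition equidominant p q := exists A r, [/\ link p q A r,
  entails (in_x p (gdim q) `|` @over A _ @` r) (in_y (gdim p) q) &
  entails (in_y (gdim p) q `|` @over A _ @` r) (in_x p (gdim q))].

Definition weakly_orthogonal p q :=
  exists r : set (formula L ('I_(gdim p + gdim q) + U)), complete_type (@id U) r /\
    entails (in_x p (gdim q) `|` in_y (gdim p) q) r.

Definition tensor_respects_domination :=
  forall p0 p1 q, Sinv p0 -> Sinv p1 -> Sinv q -> dominates p0 p1 ->
    dominates (tensor p0 q) (tensor p1 q) /\ dominates (tensor q p0) (tensor q p1).

Definition Sinv1 : set (gtype U) := [set p | Sinv p /\ gdim p = 1].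

(* Products q_0 (x) ... (x) q_n with n >= 0, bracketed to the left *)
Inductive product_of_1types : gtype U -> Prop :=
| Product1 q : Sinv1 q -> product_of_1types q
| ProductS p q : product_of_1types p -> Sinv1 q -> product_of_1types (tensor p q).

Definition orthogonal_family (X : set (gtype U)) :=
  (forall p, X p -> Sinv1 p /\ ~ realised p) /\
  (forall p q, X p -> X q -> p <> q -> weakly_orthogonal p q).

Definition maximal_orthogonal_family (X : set (gtype U)) :=
  orthogonal_family X /\
  forall Y, orthogonal_family Y -> X `<=` Y -> Y = X.

Definition quotient_by (E : gtype U -> gtype U -> Prop) : set (set (gtype U)) :=
  [set [set q | Sinv q /\ E p q] | p in Sinv].

Definition dom_class p : set (gtype U) := [set q | Sinv q /\ dom_equiv p q].

Definition Inv_tilde := quotient_by dom_equiv.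
Definition Inv_bar := quotient_by equidominant.

Implicit Types c d : set (gtype U).

Definition Inv_mul c d : set (gtype U) :=
  [set r | Sinv r /\ exists p q, [/\ c p, d q & dom_equiv (tensor p q) r]].
Definition Inv_one : set (gtype U) := [set p | Sinv p /\ realised p].
Definition Inv_ge c d := exists p q, [/\ c p, d q & dominates p q].
Definition Inv_perp c d := exists p q, [/\ c p, d q & weakly_orthogonal p q].

Definition Inv_well_defined :=
  [/\ (forall p q, Sinv p -> Sinv q -> Sinv (tensor p q)),
      (forall p q r, dom_equiv p q -> dom_equiv q r -> Sinv p -> Sinv q -> Sinv r ->
        dom_equiv p r),
      (forall p q, Sinv p -> Sinv q ->
        Inv_mul (dom_class p) (dom_class q) = dom_class (tensor p q)),
      (forall p q, Sinv p -> Sinv q ->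
        Inv_ge (dom_class p) (dom_class q) <-> dominates p q) &
      (forall p q, Sinv p -> Sinv q ->
        Inv_perp (dom_class p) (dom_class q) <-> weakly_orthogonal p q)].

End Global.
Arguments Inv_tilde K {L} U.
Arguments Inv_bar K {L} U.
Arguments Inv_one K {L} U.

(* Ordered monoid on the subset [S] of [C]; [ge a b] reads "a >= b". *)
Definition ordered_monoid C (S : set C) (mul : C -> C -> C) (one : C)
    (ge : C -> C -> Prop) :=
  [/\ S one,
      (forall a b, S a -> S b -> S (mul a b)),
      [/\ (forall a b c, S a -> S b -> S c -> mul a (mul b c) = mul (mul a b) c),
          (forall a, S a -> mul one a = a) &
          (forall a, S a -> mul a one = a)],
      [/\ (forall a, S a -> ge a a),
          (forall a b, S a -> S b -> ge a b -> ge b a -> a = b) &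
          (forall a b c, S a -> S b -> S c -> ge a b -> ge b c -> ge a c)] &
      (forall a b c, S a -> S b -> S c -> ge a b ->
         ge (mul a c) (mul b c) /\ ge (mul c a) (mul c b))].

Definition finite_subsets C (X : set C) : set (set C) :=
  [set Y | Y `<=` X /\ finite_set Y].

Definition domination_iso K L (U : structure L) (X : set (gtype U))
    (f : set (gtype U) -> set (gtype U)) :=
  [/\ set_bij (Inv_tilde K U) (finite_subsets X) f,
      f (Inv_one K U) = set0,
      (forall c d, Inv_tilde K U c -> Inv_tilde K U d ->
         f (Inv_mul K c d) = f c `|` f d),
      (forall c d, Inv_tilde K U c -> Inv_tilde K U d ->
         Inv_ge K c d <-> f d `<=` f c) &
      (forall c d, Inv_tilde K U c -> Inv_tilde K U d ->
         Inv_perp c d <-> f c `&` f d = set0)].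

(* Main.v *)
Require Import Defs.
From mathcomp Require Import all_boot.
From mathcomp Require Import boolp classical_sets functions cardinality filter.
From Stdlib Require List Permutation.

(* Everything is computed inside the monster model with automorphisms.  A global
   type p is replaced by the sets of its realisations over small sets S; then
   p dominates q iff there are a small A and tuples x, y such that, for all
   small S containing A, y realises q over S as soon as x realises p over S.
   For a nonrealised invariant 1-type the realisations over S form a cut: the
   points of a final segment R lying below all points of R definable over S.

   If p is not weakly orthogonal to a 1-type x, witnessed by phi, and b realises
   p, then one of the finitely many boundary points of phi(b, _) realises x over
   every S over which b realises p: p dominates x through a definable function,
   and by exchange p and x are interdefinable if p is a 1-type.  Moreover, if a
   product of a 1-type y and a type r dominates x, so does y or r; orthogonal
   types commute; and a 1-type is equidominant to its square.  Hence a product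
   of 1-types is determined by the set of those x in X which it dominates. *)

Set Implicit Arguments.
Unset Strict Implicit.
Unset Printing Implicit Defensive.

Local Open Scope classical_set_scope.

(** * Formulas, compactness and small sets *)

(** The obstacle is the right factor of a product. Domination of [q] by [p] passes to [tensor p r]
    and [tensor q r] at once, because realising a type over [S] and a further tuple is realising it
    over a larger small set. For [tensor r p] there is no such argument: a realisation of [r] over
    [S] and [x] need not realise [r] over [S] and [y], unless [y] is definable from [x]. So factors
    are first exchanged up to interdefinability, and monotonicity on the right is read off from the
    classification. The hard point is the absorption of a square. Let [a] realise a cut over [S],
    and let [x] realise it over a fixed small [N] and [a]. Then [x] has to lie below every point of
    [R] definable from [a] and parameters in [S], whatever [S] is. This asks for an [N] such that
    the points of [R] definable from [a] over [N] are coinitial among those definable from [a] over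
    larger sets. Further parameters are absorbed one at a time, at the cost of at most a finite set
    for each number of parameters. The order may be discrete, so limits and monotone functions give
    way to points around which a definable set is not constant. *)

Section Renaming.
Variable L : language.

Lemma teval_trename (M : structure L) V W (s : V -> W) (v : W -> M) (t : term L V) :
  teval v (trename s t) = teval (v \o s) t.
Proof.
elim: t => //= f ts IH; congr fint; apply/funext => i; exact: IH.
Qed.

Lemma sat_rename (M : structure L) V W (s : V -> W) (v : W -> M) (phi : formula L V) :
  sat v (rename s phi) <-> sat (v \o s) phi.
Proof.
elim: phi W s v => [V' W s v|V' t u W s v|V' r ts W s v|V' p IHp q IHq W s v|V' p IH W s v] //=.
- by rewrite !teval_trename.
- suff -> : (fun i => teval v (trename s (ts i))) = fun i => teval (v \o s) (ts i) by [].
  by apply/funext => i; rewrite teval_trename.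
- by rewrite IHp IHq.
- split=> H d; have := H d; rewrite IH;
    suff -> : (fun o => oapp v d o) \o omap s = (fun o => oapp (v \o s) d o) by [];
    by apply/funext => -[].
Qed.

Lemma rename_comp V W X (s : V -> W) (u : W -> X) (phi : formula L V) :
  rename u (rename s phi) = rename (u \o s) phi.
Proof.
have Ht V' W' X' (s' : V' -> W') (u' : W' -> X') (t : term L V') :
  trename u' (trename s' t) = trename (u' \o s') t.
  by elim: t => //= f ts IH; congr App; apply/funext => i; exact: IH.
elim: phi W X s u => [V' W X s u|V' t t' W X s u|V' r ts W X s u|
  V' p IHp q IHq W X s u|V' p IH W X s u] //=.
- by rewrite !Ht.
- by congr Rel; apply/funext => i; exact: Ht.
- by rewrite IHp IHq.
- by rewrite IH; congr (All (rename _ _)); apply/funext => -[].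
Qed.

Definition And V (p q : formula L V) := Not (Imp p (Not q)).
Definition Ex V (p : formula L (option V)) := Not (All (Not p)).

Lemma sat_not (M : structure L) V (v : V -> M) p : sat v (Not p) <-> ~ sat v p.
Proof. by []. Qed.

Lemma sat_and (M : structure L) V (v : V -> M) p q :
  sat v (And p q) <-> sat v p /\ sat v q.
Proof. by rewrite /=; split; [move=> H; split; apply: contrapT => ?; apply: H|case=> ? ? ]; tauto. Qed.

Lemma sat_ex (M : structure L) V (v : V -> M) (p : formula L (option V)) :
  sat v (Ex p) <-> exists d, sat (fun o => oapp v d o) p.
Proof.
rewrite /=; split=> [H|[d Hd] H]; last exact: (H d).
by apply: contrapT => H'; apply: H => d Hd; apply: H'; exists d.
Qed.

Fixpoint Conj V (s : seq (formula L V)) : formula L V :=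
  if s is p :: s' then And p (Conj s') else Not Bot.

Lemma sat_conj (M : structure L) V (v : V -> M) (s : seq (formula L V)) :
  sat v (Conj s) <-> forall p, List.In p s -> sat v p.
Proof.
elim: s => [|p s IH]; first by split=> // _ [].
change (Conj (p :: s)) with (And p (Conj s)).
rewrite sat_and IH; split=> [[Hp Hs] q [<-//|]|H]; first exact: Hs.
by split=> [|q Hq]; apply: H; [left|right].
Qed.

End Renaming.

(** * Ultrapowers and the theorem of Los *)

Section Ultrapower.
Variables (L : language) (M : structure L) (I : Type) (F : set (set I)).
Context {FU : UltraFilter F}.

Definition uclass := {c : set (I -> M) | exists f, c = [set g | F [set i | f i = g i]]}.

Definition upi (f : I -> M) : uclass := exist _ _ (ex_intro _ f erefl).
Definition urepr (c : uclass) : I -> M := projT1 (cid (projT2 c)).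

Lemma ureprK c : upi (urepr c) = c.
Proof.
case: c => c Hc; apply: eq_exist => /=; rewrite /urepr /=.
by case: (cid _).
Qed.

Lemma upi_eq f g : upi f = upi g <-> F [set i | f i = g i].
Proof.
split=> [[e]|Fe].
  have : [set g' | F [set i | g i = g' i]] g by rewrite /= ; apply: filterS filterT => i _.
  by rewrite -e.
apply: eq_exist; apply/seteqP; split=> h /= Fh.
  by apply: filterS2 Fe Fh => i /= -> ->.
by apply: filterS2 Fe Fh => i /= -> ->.
Qed.

Lemma ureprP f : F [set i | urepr (upi f) i = f i].
Proof. by apply/upi_eq; rewrite ureprK. Qed.

Definition ultrapower : structure L := {|
  dom := uclass;
  dom_inh := let: inhabits d := dom_inh M in inhabits (upi (fun=> d));
  fint f a := upi (fun i => fint (fun k => urepr (a k) i));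
  rint r a := F [set i | rint (fun k => urepr (a k) i)] |}.

Lemma teval_ultra V (w : V -> I -> M) t :
  teval (fun x => upi (w x) : ultrapower) t = upi (fun i => teval (w^~ i) t).
Proof.
elim: t => [x|f ts IH] //=; apply/upi_eq.
have H k : F [set i | urepr (teval (fun x => upi (w x) : ultrapower) (ts k)) i =
    teval (w^~ i) (ts k)] by rewrite IH; exact: ureprP.
have {}H : F [set i | forall k, urepr (teval (fun x => upi (w x) : ultrapower) (ts k)) i =
    teval (w^~ i) (ts k)] by apply: filter_forall.
by apply: filterS H => i /= /funext H; congr fint.
Qed.

Lemma Los V (w : V -> I -> M) phi :
  sat (fun x => upi (w x) : ultrapower) phi <-> F [set i | sat (w^~ i) phi].
Proof.
elim: phi w => {V} [V w|V t u w|V r ts w|V p IHp q IHq w|V p IH w] /=.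
- split=> //; suff -> : [set _ : I | False] = set0 by move/filter_not_empty.
  by [].
- by rewrite !teval_ultra upi_eq.
- have H k : F [set i | urepr (teval (fun x => upi (w x) : ultrapower) (ts k)) i =
      teval (w^~ i) (ts k)] by rewrite teval_ultra; exact: ureprP.
  have {}H : F [set i | forall k, urepr (teval (fun x => upi (w x) : ultrapower) (ts k)) i =
      teval (w^~ i) (ts k)] by apply: filter_forall.
  by split; apply: filterS2 H => i /= /funext ->.
- rewrite IHp IHq; split=> H.
    case: (in_ultra_setVsetC [set i | sat (w^~ i) p] FU) => Fp.
      by apply: filterS (H Fp) => i /=.
    by apply: filterS Fp => i /=.
  by move=> Fp; apply: filterS2 H Fp => i /=; exact.
- have extE d : (fun o => oapp (fun x => upi (w x) : ultrapower) (upi d) o) =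
    fun o => upi (oapp w d o) by apply/funext => -[].
  have ext i d : (fun o => oapp (w^~ i) (d i) o) = (fun o => oapp w d o i).
    by apply/funext => -[].
  split=> H; last first.
    move=> d; rewrite -(ureprK d) extE IH.
    by apply: filterS H => i /= /(_ (urepr d i)); rewrite ext.
  (* If the universal statement fails on a set of [F], a choice of counterexamples there defines an
     element of the ultrapower that violates the hypothesis. *)
  case: (in_ultra_setVsetC [set i | forall d, sat (fun o => oapp (w^~ i) d o) p] FU) => // Fn.
  have ex i : exists d, (~ forall d, sat (fun o => oapp (w^~ i) d o) p) ->
      ~ sat (fun o => oapp (w^~ i) d o) p.
    case: (pselect (exists d, ~ sat (fun o => oapp (w^~ i) d o) p)) => [[d Hd]|Hn].
      by exists d.
    have [d] := dom_inh M; exists d => Hd; case: Hd => d'.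
    by apply: contrapT => Hd'; apply: Hn; exists d'.
  have [g Hg] := choice ex.
  have := H (upi g); rewrite extE IH => Fp; exfalso.
  apply: (@filter_not_empty _ F).
  by apply: filterS2 Fn Fp => i /= /Hg; rewrite ext.
Qed.

End Ultrapower.

Lemma finite_list T (F : set T) :
  finite_set F -> exists s : seq T, forall x, F x <-> List.In x s.
Proof.
move=> /(@finite_seqP {classic T})[s ->]; exists s => x /=.
elim: s => [|y s IH] //=; rewrite in_cons; split.
  by case/orP=> [/eqP->|/IH]; [left|right].
by case=> [->|/IH H]; apply/orP; [left; rewrite eqxx|right].
Qed.

Lemma list_finite T (s : seq T) : finite_set [set x | List.In x s].
Proof.
elim: s => [|x s IH]; first exact: sub_finite_set (finite_set0 T).
apply: (@sub_finite_set _ _ ([set x] `|` [set y | List.In y s])).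
  by move=> y [->|]; [left|right].
by rewrite finite_setU; split=> //; exact: finite_set1.
Qed.

Section Compactness.
Variables (L : language) (M : structure L) (V : Type).
Variable G : set (formula L (V + M)).
Hypothesis Gfin : forall s : seq (formula L (V + M)),
  (forall p, List.In p s -> G p) ->
  exists a : V -> M, forall p, List.In p s -> sat (either a id) p.

(** The ultrapower is indexed by finite lists of formulas, and the filter is generated by the sets
    of all lists in [G] that contain a given one. The tuple at index [s] satisfies [s], so each
    formula of [G] holds on a set of the filter. *)
Lemma compactness : exists (N : structure L) (e : M -> N) (a : V -> N),
  elementary e /\ forall p, G p -> sat (either a e) p.
Proof.
pose I := seq (formula L (V + M)).
pose B0 : set (set I) := fun S => exists s0 : I, (forall p, List.In p s0 -> G p) /\
  forall s : I, (forall p, List.In p s -> G p) -> (forall p, List.In p s0 -> List.In p s) -> S s.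
have PB : ProperFilter B0.
  split.
    by move=> [s0 [Gs0 /(_ s0 Gs0 (fun p h => h))]].
  split.
  - by exists [::].
  - move=> S S' [s [Gs Hs]] [s' [Gs' Hs']]; exists (s ++ s'); split.
      by move=> p Hp; case: (List.in_app_or _ _ _ Hp); [apply: Gs|apply: Gs'].
    move=> t Gt Ht; split; [apply: Hs|apply: Hs'] => // p Hp; apply: Ht;
      apply: List.in_or_app; by [left|right].
  - by move=> S S' SS' [s [Gs Hs]]; exists s; split=> // t Gt Ht; apply: SS'; exact: Hs.
have [F [FU BF]] := ultraFilterLemma PB.
have ex (s : I) : exists a : V -> M, (forall p, List.In p s -> G p) ->
    forall p, List.In p s -> sat (either a id) p.
  case: (pselect (forall p, List.In p s -> G p)) => [/Gfin[a Ha]|Hn]; first by exists a.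
  by have [d] := dom_inh M; exists (fun=> d).
have [g Hg] := choice ex.
exists (ultrapower M F), (fun m => upi F (fun=> m)), (fun x => upi F (fun s => g s x)); split.
  move=> phi; rewrite Los; split=> H; first by apply: filterS filterT.
  by have [s] := filter_ex H.
move=> p Gp; pose w x s := either (g s) id x : M.
have -> : either (fun x => upi F (fun s => g s x)) (fun m => upi F (fun=> m)) =
  fun x => upi F (w x) by apply/funext => -[].
apply/Los/BF; exists [:: p]; split=> [q [<-|[]]//|s Gs Hs] /=.
suff -> : (fun x => w x s) = either (g s) id by apply: Hg => //; apply: Hs; left.
by apply/funext => -[].
Qed.
End Compactness.

(** * Cardinal comparison and small sets *)

Lemma card_leI S T (A : set S) (B : set T) (f : S -> T) :
  (forall x, A x -> B (f x)) -> (forall x y, A x -> A y -> f x = f y -> x = y) ->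
  (A #<= B)%card.
Proof.
move=> fAB finj.
have finj' : {in A &, injective f} by move=> x y /set_mem Ax /set_mem Ay; exact: finj.
rewrite -(card_le_eql (inj_card_eq finj')); apply: subset_card_le => _ [x Ax <-].
exact: fAB.
Qed.

Lemma card_le_ex S T (A : set S) (B : set T) : (A #<= B)%card ->
  exists f : S -> option T, (forall x, A x -> exists2 y, f x = Some y & B y) /\
    (forall x y, A x -> A y -> f x = f y -> x = y).
Proof.
move=> /card_leP[f].
pose g x := if pselect (A x) is left Ax then Some (set_val (f (SigSub (mem_set Ax)))) else None.
have gE x (Ax : A x) : g x = Some (set_val (f (SigSub (mem_set Ax)))).
  rewrite /g; case: pselect => // Ax'; congr (Some (set_val (f _))).
  exact: val_inj.
exists g; split=> [x Ax|x y Ax Ay].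
  by rewrite gE; eexists => //; exact/set_mem/valP.
rewrite !gE => -[] /val_inj /(@inj _ _ _ f) H.
have := H (mem_set I) (mem_set I).
by move=> /(congr1 val).
Qed.

(** Zorn on partial injections from [A] to [B]: a maximal one that missed a point on either side
    could be extended by that pair. *)
Lemma card_le_total S T (A : set S) (B : set T) : (A #<= B)%card \/ (B #<= A)%card.
Proof.
pose P (R : set (S * T)) := [/\ (forall x y, R (x, y) -> A x /\ B y),
  (forall x y y', R (x, y) -> R (x, y') -> y = y') &
  (forall x x' y, R (x, y) -> R (x', y) -> x = x')].
have [F FP Ft|R [[RAB Rf Ri] Rmax]] := @Zorn_bigcup _ P.
  split=> [x y [R FR Rxy]|x y y' [R FR Rxy] [R' FR' Rxy']|x x' y [R FR Rxy] [R' FR' Rxy']].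
  - by have [+ _ _] := FP _ FR; exact.
  - by case: (Ft _ _ FR FR') => s; [have [_ + _] := FP _ FR'|have [_ + _] := FP _ FR];
      apply; [exact: s Rxy|exact: Rxy'|exact: Rxy|exact: s Rxy'].
  - by case: (Ft _ _ FR FR') => s; [have [_ _ +] := FP _ FR'|have [_ _ +] := FP _ FR];
      apply; [exact: s Rxy|exact: Rxy'|exact: Rxy|exact: s Rxy'].
case: (pselect (forall x, A x -> exists y, R (x, y))) => [H|/existsNP[a /not_implyP[Aa na]]].
  left; case: (pselect (inhabited T)) => [[t0]|nT]; last first.
    suff -> : A = set0 by exact: card_ge0.
    by apply/seteqP; split=> // x /H[y _]; case: nT; exists.
  have ex x : exists y, A x -> R (x, y).
    by case: (pselect (A x)) => [/H[y Hy]|nA]; [exists y|exists t0].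
  have [f Hf] := choice ex.
  apply: (@card_leI _ _ _ _ f) => [x /Hf/RAB[]//|x x' /Hf h /Hf h' e].
  by apply: Ri h _; rewrite e.
case: (pselect (forall y, B y -> exists x, R (x, y))) => [H|/existsNP[b /not_implyP[Bb nb]]].
  right.
  have ex y : exists x, B y -> R (x, y).
    by case: (pselect (B y)) => [/H[x Hx]|nB]; [exists x|exists a].
  have [f Hf] := choice ex.
  apply: (@card_leI _ _ _ _ f) => [x /Hf/RAB[]//|x x' /Hf h /Hf h' e].
  by apply: Rf h _; rewrite e.
exfalso; apply: (Rmax (R `|` [set (a, b)])).
  split; first by move=> ?; left.
  by move=> /(_ (a, b) (or_intror erefl)) H; apply: na; exists b.
split=> [x y [/RAB//|[-> ->]]//|x y y' [h|[e1 e2]] [h'|[e1' e2']]|x x' y [h|[e1 e2]] [h'|[e1' e2']]].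
- exact: Rf h h'.
- by case: na; exists y; rewrite -e1'.
- by case: na; exists y'; rewrite -e1.
- by rewrite e2 e2'.
- exact: Ri h h'.
- by case: nb; exists x; rewrite -e2'.
- by case: nb; exists x'; rewrite -e2.
- by rewrite e1 e1'.
Qed.

Section Small.
Variable K : Type.
Hypothesis nat_small : small K [set: nat].
Hypothesis K_limit : strong_limit K.

Lemma small_le S T (A : set S) (B : set T) : (A #<= B)%card -> small K B -> small K A.
Proof.
move=> AB [BK KB]; split; first exact: card_le_trans AB BK.
by move=> KA; apply: KB; exact: card_le_trans KA AB.
Qed.

Lemma small_sub S (A B : set S) : A `<=` B -> small K B -> small K A.
Proof. by move=> /subset_card_le; exact: small_le. Qed.

Lemma small_image S T (f : S -> T) (A : set S) : small K A -> small K (f @` A).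
Proof. exact/small_le/card_image_le. Qed.

Lemma small_countable S (A : set S) : countable A -> small K A.
Proof. by move=> cA; apply: small_le nat_small. Qed.

Lemma small_finite S (A : set S) : finite_set A -> small K A.
Proof. by move/finite_set_countable/small_countable. Qed.

Lemma small_copy S (A : set S) : small K A ->
  exists2 C : set K, small K C & (A #<= C)%card.
Proof.
move=> [AK KA]; have [f [fA finj]] := card_le_ex AK.
have [k0 _] : exists k : K, True.
  by have [/card_le_ex[g [/(_ 0 I)[k _ _] _]] _] := nat_small; exists k.
pose g x := odflt k0 (f x).
have gE x : A x -> f x = Some (g x) by move=> /fA[y e _]; rewrite /g e.
have ginj x y : A x -> A y -> g x = g y -> x = y.
  by move=> Ax Ay e; apply: finj => //; rewrite !gE // e.
exists (g @` A); first by apply: small_image.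
by apply: (card_leI (f := g)) => // x Ax; exists x.
Qed.

Lemma small_power_le S (A : set S) (C : set K) : small K C ->
  (A #<= [set B : set K | B `<=` C])%card -> small K A.
Proof. by move=> sC leAC; exact: small_le leAC (K_limit sC). Qed.

(** Both sets inject into a small infinite [C], and their union into the subsets of [C]: points of
    [A] go to singletons, the others to complements of singletons in [C]. The two kinds differ
    because [C] is infinite, and the power set is small because the cardinal is a strong limit. *)
Lemma smallU S (A B : set S) : small K A -> small K B -> small K (A `|` B).
Proof.
move=> sA sB.
have [C [sC infC leAC leBC]] : exists C : set K, [/\ small K C, infinite_set C,
    (A #<= C)%card & (B #<= C)%card].
  have [CA sCA ACA] := small_copy sA; have [CB sCB BCB] := small_copy sB.
  have [CN sCN NCN] := small_copy nat_small.
  have infN : infinite_set CN by apply/infiniteP.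
  have [C1 [sC1 AC1 BC1]] : exists C : set K, [/\ small K C, (A #<= C)%card & (B #<= C)%card].
    by case: (card_le_total CA CB) => h; [exists CB|exists CA]; split=> //;
      apply: card_le_trans h.
  case: (card_le_total C1 CN) => h; last first.
    by exists C1; split=> //; apply/infiniteP; apply: card_le_trans NCN h.
  by exists CN; split=> //; apply: card_le_trans h.
have [f [fA finj]] := card_le_ex leAC; have [g [gB ginj]] := card_le_ex leBC.
apply: (small_power_le sC).
pose h x : set K := if pselect (A x) is left _ then [set k | Some k = f x]
  else [set k | C k /\ Some k <> g x].
have diff x y : A x -> B y -> [set k | Some k = f x] <> [set k | C k /\ Some k <> g y].
  move=> /fA[a e Ca] /gB[b e' Cb]; rewrite e e' => H; apply: infC.
  apply: (@sub_finite_set _ _ [set a; b]); last exact: finite_set2.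
  move=> k Ck; case: (pselect (k = b)) => [->|kb]; first by right.
  left; have : [set k | C k /\ Some k <> Some b] k by split=> // -[].
  by rewrite -H => -[].
apply: (card_leI (f := h)) => [x ABx k|x y].
  rewrite /h; case: pselect => Ax; last by case.
  by have [a -> Ca] := fA _ Ax => -[->].
move=> ABx ABy; rewrite /h; case: pselect => Ax; case: pselect => Ay e.
- apply: finj => //; have [a ea Ca] := fA _ Ax.
  have : [set k | Some k = f x] a by rewrite /= ea.
  by rewrite e /= ea.
- by case: (diff x y) => //; case: ABy.
- by case: (diff y x) => //; case: ABx.
- have Bx : B x by case: ABx. have By : B y by case: ABy.
  apply: ginj => //; have [a ea Ca] := gB _ Bx; have [b eb Cb] := gB _ By.
  apply: contrapT => ne.
  have : [set k | C k /\ Some k <> g y] a.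
    by split=> //; rewrite -ea.
  by rewrite -e /= ea => -[_]; apply.
Qed.

Lemma small_list S (s : seq S) : small K [set x | List.In x s].
Proof. exact/small_finite/list_finite. Qed.

Lemma small_ord S n (x : 'I_n -> S) : small K (range x).
Proof. by apply/small_finite/finite_image/finite_finset. Qed.

End Small.

(** * Finite supports and elimination of parameters *)

Section Support.
Variable L : language.

Lemma trename_id V (t : term L V) : trename id t = t.
Proof. by elim: t => //= f ts IH; congr App; apply/funext. Qed.

Lemma rename_id V (phi : formula L V) : rename id phi = phi.
Proof.
elim: phi => {V} [V|V t u|V r ts|V p IHp q IHq|V p IH] //=.
- by rewrite !trename_id.
- by congr Rel; apply/funext => i; exact: trename_id.
- by rewrite IHp IHq.
- by congr All; rewrite -[RHS]IH; congr rename; apply/funext => -[].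
Qed.

Lemma tsupport V (t : term L V) : exists s : seq V, forall W (f g : V -> W),
  (forall v, List.In v s -> f v = g v) -> trename f t = trename g t.
Proof.
elim: t => [v|f ts IH].
  by exists [:: v] => W f g H /=; rewrite H //; left.
have [s Hs] := choice IH.
exists (flatten [seq s i | i <- enum 'I_(farity f)]) => W g h H /=.
congr App; apply/funext => i; apply: Hs => v Hv; apply: H.
have : i \in enum 'I_(farity f) by rewrite mem_enum.
elim: (enum _) => //= j e IHe; rewrite in_cons => /orP[/eqP<-|/IHe Hi];
  apply: List.in_or_app; by [left|right].
Qed.

Lemma support V (phi : formula L V) : exists s : seq V, forall W (f g : V -> W),
  (forall v, List.In v s -> f v = g v) -> rename f phi = rename g phi.
Proof.
elim: phi => {V} [V|V t u|V r ts|V p [s Hs] q [s' Hs']|V p [s Hs]].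
- by exists [::].
- have [s Hs] := tsupport t; have [s' Hs'] := tsupport u.
  exists (s ++ s') => W f g H /=; congr Eq; [apply: Hs|apply: Hs'] => v Hv;
    apply: H; apply: List.in_or_app; by [left|right].
- have [f [s Hs]] : exists f : 'I_(rarity r) -> unit, exists s : seq V, forall W (f g : V -> W),
    (forall v, List.In v s -> f v = g v) ->
    (fun i => trename f (ts i)) = (fun i => trename g (ts i)).
    have [s Hs] := choice (fun i => tsupport (ts i)).
    exists (fun=> tt), (flatten [seq s i | i <- enum 'I_(rarity r)]) => W g h H.
    apply/funext => i; apply: Hs => v Hv; apply: H.
    have : i \in enum 'I_(rarity r) by rewrite mem_enum.
    elim: (enum _) => //= j e IHe; rewrite in_cons => /orP[/eqP<-|/IHe Hi];
      apply: List.in_or_app; by [left|right].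
  by exists s => W g h H /=; rewrite (Hs _ g h).
- exists (s ++ s') => W f g H /=; congr Imp; [apply: Hs|apply: Hs'] => v Hv;
    apply: H; apply: List.in_or_app; by [left|right].
- exists (pmap id s) => W f g H /=; congr All; apply: Hs => -[v|] //= Hv.
  congr Some; apply: H.
  elim: s Hv => //= -[w|] s IH [] //=; by [move=> [->]; left|move=> /IH; right|].
Qed.

(** Invariance of types is stated for instances of formulas without parameters; this brings every
    formula into that form. *)
Lemma instP n B (b0 : B) (phi : formula L ('I_n + B)) :
  exists k (psi : formula L ('I_n + 'I_k)) (t : 'I_k -> B), phi = inst psi t.
Proof.
have [s Hs] := support phi.
pose l := pmap (fun c : 'I_n + B => if c is inr b then Some b else None) s.
have lP b : List.In (inr b) s -> List.In b l.
  rewrite /l; elim: s {Hs l} => //= -[i|b'] s IH [] //=.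
    by move=> [->]; left.
  by move=> /IH; right.
(* The extra slot, filled with [b0], makes [ord0] available as a default index even when no
   parameter occurs. *)
pose t (i : 'I_(size l).+1) := nth b0 l i.
have exg b : exists i, List.In b l -> t i = b.
  case: (pselect (List.In b l)) => Hb; last by exists ord0.
  have [i Hi e] : exists2 i, i < size l & nth b0 l i = b.
    elim: (l) Hb => //= b' l' IH [->|/IH[i Hi e]]; first by exists 0.
    by exists i.+1.
  by exists (inord i) => _; rewrite /t inordK // ltnS ltnW.
have [g Hg] := choice exg.
exists (size l).+1, (rename (sum_map id g) phi), t.
rewrite /inst rename_comp -[LHS]rename_id; apply: Hs => -[i|b] //= /lP Hb.
by rewrite /sum_map /= Hg.
Qed.

Fixpoint ExN V n : formula L ('I_n + V) -> formula L V :=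
  match n with
  | 0 => rename (either (fun i : 'I_0 => False_rect V (notF (ltn_ord i))) id)
  | n'.+1 => fun p => ExN (Ex (rename
      (either (fun i => omap inl (unlift ord0 i)) (Some \o inr)) p) : formula L ('I_n' + V))
  end.

Lemma sat_exN (M : structure L) V n (v : V -> M) (p : formula L ('I_n + V)) :
  sat v (ExN p) <-> exists a : 'I_n -> M, sat (either a v) p.
Proof.
elim: n p => [p|n IH p] /=.
  rewrite sat_rename.
  have h (a : 'I_0 -> M) : v \o either (fun i : 'I_0 => False_rect V (notF (ltn_ord i))) id = either a v.
    by apply/funext => -[[]|].
  have [d] := dom_inh M.
  split=> [H|[a]]; last by rewrite -h.
  by exists (fun=> d); rewrite -h.
rewrite IH; split=> [[a /sat_ex[d]]|[a H]].
  rewrite sat_rename => H.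
  exists (fun i => if unlift ord0 i is Some j then a j else d).
  suff <- : (fun o => oapp (either a v) d o) \o
    either (fun i => omap inl (unlift ord0 i)) (Some \o inr) =
    either (fun i => if unlift ord0 i is Some j then a j else d) v by [].
  by apply/funext => -[i|] //=; case: unlift.
exists (fun i => a (lift ord0 i)); apply/sat_ex; exists (a ord0); rewrite sat_rename.
suff -> : (fun o => oapp (either (fun i => a (lift ord0 i)) v) (a ord0) o) \o
    either (fun i => omap inl (unlift ord0 i)) (Some \o inr) = either a v by [].
by apply/funext => -[i|] //=; case: unliftP => [j|] -> .
Qed.

End Support.

(** * Automorphisms and definable closure *)

Section Automorphisms.
Variables (L : language) (U : structure L).

Lemma sat_aut (s : U -> U) V (v : V -> U) phi :
  automorphism s -> sat (s \o v) phi <-> sat v phi.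
Proof.
move=> [[g sK gK] sf sr].
have sT W (w : W -> U) t : teval (s \o w) t = s (teval w t).
  by elim: t => //= f ts IH; rewrite sf; congr fint; apply/funext.
elim: phi v => {V} [V v|V t u v|V r ts v|V p IHp q IHq v|V p IH v] //=.
- by rewrite !sT; split=> [/(can_inj sK)|->].
- by rewrite [X in _ <-> X]sr; suff -> : (fun i => teval (s \o v) (ts i)) = s \o fun i => teval v (ts i);
    [|apply/funext => i; rewrite sT].
- by rewrite IHp IHq.
- have E d : (fun o => oapp (s \o v) (s d) o) = s \o fun o => oapp v d o.
    by apply/funext => -[].
  split=> H d; first by have := H (s d); rewrite E IH.
  by rewrite -(gK d) E IH.
Qed.

Lemma aut_id : automorphism (@id U).
Proof. by split=> //; exists id. Qed.

Lemma aut_comp s t : automorphism s -> automorphism t -> automorphism (s \o t : U -> U).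
Proof.
move=> [bs sf sr] [bt tf tr]; split; first exact: bij_comp.
- by move=> f a /=; rewrite tf sf.
- by move=> r a /=; rewrite tr sr.
Qed.

Lemma aut_inv s : automorphism s -> exists t : U -> U,
  [/\ automorphism t, cancel s t & cancel t s].
Proof.
move=> [[t sK tK] sf sr]; exists t; split=> //; split; first by exists s.
- move=> f a; apply: (can_inj sK); rewrite tK sf; congr fint.
  by apply/funext => i /=; rewrite tK.
- move=> r a; rewrite [X in _ <-> X]sr.
  by suff -> : s \o (t \o a) = a by []; apply/funext => i /=; rewrite tK.
Qed.

Definition fixes (S : set U) (s : U -> U) := automorphism s /\ forall x, S x -> s x = x.

Lemma fixes_id S : fixes S id. Proof. by split=> //; exact: aut_id. Qed.

Lemma fixes_comp S s t : fixes S s -> fixes S t -> fixes S (s \o t).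
Proof.
by move=> [As fs] [At ft]; split=> [|x Sx /=]; [exact: aut_comp|rewrite ft // fs].
Qed.

Lemma fixes_inv S s : fixes S s -> exists t, [/\ fixes S t, cancel s t & cancel t s].
Proof.
move=> [/aut_inv[t [At sK tK]] fs]; exists t; split=> //; split=> // x Sx.
by rewrite -{1}(fs x Sx) sK.
Qed.

Lemma fixes_sub S S' s : S `<=` S' -> fixes S' s -> fixes S s.
Proof. by move=> SS' [As fs]; split=> // x /SS'/fs. Qed.

(* In a monster model and for small S this is definable closure. *)
Definition dcl (S : set U) : set U := [set x | forall s, fixes S s -> s x = x].

Lemma sub_dcl S : S `<=` dcl S. Proof. by move=> x Sx s [_ /(_ x Sx)]. Qed.

Lemma dcl_sub S S' : S `<=` dcl S' -> dcl S `<=` dcl S'.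
Proof.
move=> SS' x Sx s fs; apply: Sx; split; first by case: fs.
by move=> y /SS'; apply.
Qed.

Lemma dcl_mono S S' : S `<=` S' -> dcl S `<=` dcl S'.
Proof. by move=> SS'; apply: dcl_sub => x /SS'/sub_dcl. Qed.

Lemma dcl_aut S s x : automorphism s -> dcl S x -> dcl (s @` S) (s x).
Proof.
move=> As Sx t [At ft]; have [s' [As' sK s'K]] := aut_inv As.
apply: (can_inj s'K); rewrite sK; apply: (Sx (s' \o t \o s)).
split; first by apply: aut_comp => //; exact: aut_comp.
by move=> y Sy /=; rewrite ft ?sK //; exists y.
Qed.

End Automorphisms.

Section Uses.
Variables (L : language) (U : structure L).

(** The formula stays a formula over [U], so that enlarging [S] does not change it; only the
    existence of a preimage over [S] is recorded. *)
Definition uses (S : set U) n (phi : formula L ('I_n + U)) :=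
  exists psi : formula L ('I_n + S), phi = Defs.over psi.

Lemma sat_over (S : set U) n (x : 'I_n -> U) (psi : formula L ('I_n + S)) :
  sat (either x id) (Defs.over psi) <-> sat (either x (@set_val U S)) psi.
Proof.
rewrite sat_rename; suff -> : either x id \o sum_map id (@set_val U S) = either x (@set_val U S) by [].
by apply/funext => -[].
Qed.

Definition set_incl (S S' : set U) (SS' : S `<=` S') (s : S) : S' :=
  SigSub (mem_set (SS' _ (set_mem (valP s)))).

Lemma uses_sub (S S' : set U) n (phi : formula L ('I_n + U)) :
  S `<=` S' -> uses S phi -> uses S' phi.
Proof.
move=> SS' [psi ->]; exists (rename (sum_map id (set_incl SS')) psi).
rewrite /Defs.over rename_comp; congr (rename _ psi).
by apply/funext => -[].
Qed.

Lemma usesP (S : set U) n k (psi : formula L ('I_n + 'I_k)) (t : 'I_k -> U) :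
  (forall i, S (t i)) -> uses S (inst psi t).
Proof.
move=> St; exists (inst psi (fun i => SigSub (mem_set (St i)))).
rewrite /Defs.over /inst rename_comp; congr (rename _ psi).
by apply/funext => -[].
Qed.

Lemma uses_fin n (phi : formula L ('I_n + U)) :
  exists s : seq U, uses [set u | List.In u s] phi.
Proof.
have [u0] := dom_inh U; have [k [psi [t ->]]] := instP u0 phi.
exists [seq t i | i <- enum 'I_k]; apply: usesP => i /=.
have : i \in enum 'I_k by rewrite mem_enum.
elim: (enum _) => //= j e IHe; rewrite in_cons => /orP[/eqP<-|/IHe Hi]; by [left|right].
Qed.

Lemma uses_not (S : set U) n (phi : formula L ('I_n + U)) : uses S phi -> uses S (Not phi).
Proof. by move=> [psi ->]; exists (Not psi). Qed.

Lemma sat_either_aut (S : set U) s n (x : 'I_n -> U) (phi : formula L ('I_n + U)) :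
  fixes S s -> uses S phi -> sat (either (s \o x) id) phi <-> sat (either x id) phi.
Proof.
move=> [As fs] [psi ->]; rewrite !sat_over -[X in _ <-> X](sat_aut _ _ As).
suff -> : either (s \o x) (@set_val U S) = s \o either x (@set_val U S) by [].
by apply/funext => -[//|u]; rewrite /= fs //; exact/set_mem/(valP u).
Qed.

End Uses.

(** * Cuts and boundaries in ordered structures *)

Notation "S :+ x" := (S `|` [set x]) (at level 50, left associativity).

Lemma in_cat_iff T (x : T) s t : List.In x (s ++ t) <-> List.In x s \/ List.In x t.
Proof. exact: List.in_app_iff. Qed.

Section DclAdd.
Variables (L : language) (U : structure L).
Implicit Types (S C : set U).

Lemma dcl_fixed S x s : dcl S x -> fixes S s -> s x = x. Proof. exact. Qed.

Lemma dcl_add S x : dcl (S :+ x) x. Proof. by apply: sub_dcl; right. Qed.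

Lemma dclU S x y : dcl S y -> dcl (S :+ x) y.
Proof. by apply: dcl_mono => z; left. Qed.

Lemma dcl_cut S S' x y : S `<=` dcl S' -> dcl S' x -> dcl (S :+ x) y -> dcl S' y.
Proof. by move=> SS' S'x; apply: dcl_sub => z [/SS'//|->]. Qed.

Lemma fixes_add S x s : fixes S s -> s x = x -> fixes (S :+ x) s.
Proof. by move=> [As fs] sx; split=> // y [/fs//|->]. Qed.

Lemma fixes_of S x s : fixes (S :+ x) s -> fixes S s /\ s x = x.
Proof. by move=> [As fs]; split; [split=> // y Sy|]; apply: fs; [left|right]. Qed.

Lemma dcl_move S x y s : fixes S s -> dcl (S :+ x) y -> dcl (S :+ s x) (s y).
Proof.
move=> [As fs] xy; have := dcl_aut As xy; apply: dcl_mono => _ [z [Sz|->] <-].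
  by left; rewrite fs.
by right.
Qed.

Lemma dcl_move2 S x x' y s : fixes S s ->
  dcl (S :+ x :+ x') y -> dcl (S :+ s x :+ s x') (s y).
Proof.
move=> [As fs] xy; have := dcl_aut As xy; apply: dcl_mono => _ [z [[Sz|->]|->] <-].
- by left; left; rewrite fs.
- by left; right.
- by right.
Qed.

Lemma dcl_agree2 S x x' y s t : fixes S s -> fixes S t -> s x = t x -> s x' = t x' ->
  dcl (S :+ x :+ x') y -> s y = t y.
Proof.
move=> fs ft e e' xy; have [t' [ft' tK t'K]] := fixes_inv ft.
rewrite -[s y]t'K; congr (t _); apply: (xy (t' \o s)).
apply: fixes_add; last by rewrite /= e' tK.
by apply: fixes_add; [exact: fixes_comp|rewrite /= e tK].
Qed.

End DclAdd.

(** * Cuts below an invariant final segment *)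

Section Cut.
Variables (L : language) (U : structure L) (small : set U -> Prop).
Variable lt : U -> U -> Prop.
Implicit Types (S C M : set U).
Hypothesis lt_order : strict_linear_order lt.
Hypothesis lt_aut : forall s x y, automorphism s -> lt x y -> lt (s x) (s y).
Hypothesis smallS : forall S S', S `<=` S' -> small S' -> small S.
Hypothesis small_add : forall S x, small S -> small (S :+ x).
Hypothesis small_list : forall S (l : seq U), small S -> small (S `|` [set x | List.In x l]).

Definition between x y z := (x = z \/ lt x z) /\ (z = y \/ lt z y).

Hypothesis cut_conj : forall S x y, small S -> lt x y ->
  (forall z, dcl S z -> ~ between x y z) -> exists2 s, fixes S s & s x = y.
Hypothesis exchange : forall S x y, small S ->
  dcl (S :+ x) y -> ~ dcl S y -> dcl (S :+ y) x.

Variables (A R : set U).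
Hypothesis A_small : small A.
Hypothesis R_up : forall x y, R x -> lt x y -> R y.
Hypothesis R_aut : forall s x, fixes A s -> R x -> R (s x).

(* When [R] is a final segment: the realisations over [S] of the cut just below [R]. *)
Definition low S : set U := [set x | R x /\ forall r, dcl S r -> R r -> lt x r].

Hypothesis low_ex : forall S, small S -> A `<=` S -> exists x, low S x.

Let lt_irr x : ~ lt x x. Proof. by case: lt_order. Qed.
Let lt_trans x y z : lt x y -> lt y z -> lt x z. Proof. by case: lt_order => _ h _; exact: h. Qed.
Let lt_tot x y : [\/ lt x y, x = y | lt y x]. Proof. by case: lt_order. Qed.
Let lt_asym x y : lt x y -> lt y x -> False.
Proof. by move=> h h'; exact: lt_irr (lt_trans h h'). Qed.
Let ltNge x y : ~ lt x y -> x = y \/ lt y x. Proof. by case: (lt_tot x y); tauto. Qed.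

Lemma low_sub S S' x : S `<=` dcl S' -> low S' x -> low S x.
Proof. by move=> SS' [Rx H]; split=> // r /(dcl_sub SS'); exact: H. Qed.

Lemma low_lt S x y : R y -> lt y x -> low S x -> low S y.
Proof. by move=> Ry yx [Rx H]; split=> // r Sr Rr; exact: lt_trans yx (H _ Sr Rr). Qed.

Lemma low_notin S x : low S x -> ~ dcl S x.
Proof. by move=> [Rx H] Sx; exact: lt_irr (H _ Sx Rx). Qed.

Lemma low_move S x y s : A `<=` S -> fixes S s -> low (S :+ x) y -> low (S :+ s x) (s y).
Proof.
move=> AS fs [Ry H]; have fA := fixes_sub AS fs; split; first exact: R_aut.
have [t [ft sK tK]] := fixes_inv fs; have ftA := fixes_sub AS ft.
move=> r xr Rr; rewrite -[r]tK; apply: lt_aut; first by case: fs.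
by apply: H; [rewrite -[x]sK; exact: dcl_move|exact: R_aut].
Qed.

Lemma low_move2 S x x' y s : A `<=` S -> fixes S s ->
  low (S :+ x :+ x') y -> low (S :+ s x :+ s x') (s y).
Proof.
move=> AS fs [Ry H]; have fA := fixes_sub AS fs; split; first exact: R_aut.
have [t [ft sK tK]] := fixes_inv fs; have ftA := fixes_sub AS ft.
move=> r xr Rr; rewrite -[r]tK; apply: lt_aut; first by case: fs.
by apply: H; [rewrite -[x]sK -[x']sK; exact: dcl_move2|exact: R_aut].
Qed.

Lemma low_fix S x s : A `<=` S -> fixes S s -> low S x -> low S (s x).
Proof.
move=> AS fs [Rx H]; split; first by apply: R_aut => //; exact: fixes_sub fs.
move=> r Sr Rr; rewrite -(Sr _ fs); apply: lt_aut; first by case: fs.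
exact: H.
Qed.

(** A point of [dcl S] between two realisations would be in [R], as [R] is a final segment, and
    hence above the larger of the two. *)
Lemma low_conj S x y : small S -> low S x -> low S y -> exists2 s, fixes S s & s x = y.
Proof.
move=> sS.
have key a b : lt a b -> low S a -> low S b -> exists2 s, fixes S s & s a = b.
  move=> ab Sa [Rb Sb]; apply: cut_conj => // z Sz [az zb].
  have Rz : R z by case: az => [<-|]; [case: Sa|exact/R_up/(proj1 Sa)].
  have zb' := Sb _ Sz Rz; case: zb => [e|h]; last exact: lt_asym h zb'.
  by apply: (@lt_irr b); rewrite -{2}e.
case: (lt_tot x y) => [xy|<-|yx] Sx Sy; first exact: key.
  by exists id => //; exact: fixes_id.
have [s fs sy] := key _ _ yx Sy Sx; have [t [ft sK tK]] := fixes_inv fs.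
by exists t => //; rewrite -sy.
Qed.

(** First [s] moves [u]; then the image of [a] is corrected with [S] and [s u] fixed, since [s a]
    and [a'] realise the same cut over them. *)
Lemma low_indep S u a a' s : small S -> A `<=` S -> fixes S s ->
  low (S :+ u) a -> low (S :+ s u) a' ->
  exists t, [/\ fixes S t, t u = s u & t a = a'].
Proof.
move=> sS AS fs la la'.
have [|r fr ra] := low_conj _ (low_move AS fs la) la'; first exact: small_add.
have [frS ru] := fixes_of fr.
by exists (r \o s); split=> //; exact: fixes_comp.
Qed.

(** * Absorbing one further parameter *)

Section Step.
Variables C M : set U.
Hypotheses (AC : A `<=` C) (CM : C `<=` M) (M_small : small M).
Hypothesis deep : forall x, low M x -> exists2 z, dcl (M :+ x) z & low (C :+ x) z.

Let C_small : small C. Proof. exact: smallS CM M_small. Qed.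
Let AM : A `<=` M. Proof. by move=> x /AC/CM. Qed.
Let CdM : C `<=` dcl M. Proof. by move=> x /CM/sub_dcl. Qed.

(** The mirror image of [deep]: instead of a point far below [a], a realisation [b] of the cut that
    [a] is far below. *)
Definition above a b := [/\ dcl (M :+ a) b, dcl (M :+ b) a, low M b & low (C :+ b) a].

(** [deep] gives a point [z] far below [a]; the automorphism over [M] that moves [z] to [a] moves
    [a] to [b]. *)
Lemma above_ex a : low M a -> exists b, above a b.
Proof.
move=> Ma; have [z az Caz] := deep Ma.
have Mz : low M z.
  apply: (low_lt _ _ Ma); first by case: Caz.
  by case: Caz => _; apply; [exact: dcl_add|case: Ma].
have [s fs sz] := low_conj M_small Mz Ma.
have ba : dcl (M :+ s a) a by rewrite -{2}sz; exact: dcl_move.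
exists (s a); split=> //; last first.
- by rewrite -{2}sz; apply: low_move => //; exact: fixes_sub fs.
- exact: low_fix.
- by apply: exchange => //; exact: low_notin.
Qed.

(** Suppose [r] is itself in the cut over [M]. Any [y] in the cut over [M] and [r] is below [r].
    Moving [b] to [y] over [M] puts the image of [a] below [y], hence in the cut over [M] and [r],
    so this image can be moved back to [a] with [r] fixed. As [b] is defined from [a], the second
    move takes [y] to [b]. *)
Lemma above_lt a b r : above a b -> R r -> low (M :+ r) a -> lt b r.
Proof.
move=> [ab ba Mb Cba] Rr Mra.
case: (pselect (low M r)) => [Mr|nMr]; last first.
  have [r' [Mr' Rr' r'r]] : exists r', [/\ dcl M r', R r' & ~ lt r r'].
    apply: contrapT => H; apply: nMr; split=> // r' Mr' Rr'.
    by apply: contrapT => H'; apply: H; exists r'.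
  have br' : lt b r' by case: Mb => _; exact.
  by case: (ltNge r'r) => [->//|]; exact: lt_trans.
have [y My] : exists y, low (M :+ r) y.
  by apply: low_ex; [exact: small_add|move=> z /AM; left].
have yr : lt y r by case: My => _; apply=> //; exact: dcl_add.
have My' : low M y by apply: low_sub My => z Mz; apply: sub_dcl; left.
have [s fs sb] := low_conj M_small Mb My'.
have ly : low (C :+ y) (s a) by rewrite -sb; apply: low_move => //; exact: fixes_sub fs.
have sar : low (M :+ r) (s a).
  by apply: (low_lt _ _ My); case: ly => // Rsa; apply; [exact: dcl_add|case: My].
have [t ft tsa] := low_conj (small_add r M_small) sar Mra.
have [ftM tr] := fixes_of ft.
have ts : t y = b.
  rewrite -sb; apply: (dcl_fixed ab (s := t \o s)); apply: fixes_add; last by [].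
  exact: fixes_comp.
by rewrite -ts -tr; apply: lt_aut => //; case: ft.
Qed.

Variables (d w a z : U).
Hypotheses (Md : low M d) (Ma : low (M :+ d :+ w) a).
Hypotheses (waz : dcl (C :+ a :+ w) z) (Rz : R z).

(* Any realisation [eta, om] of the type of [(z, w)] over [C :+ x], where [x] realises the type of
   [a] over [C]. *)
Definition copy x eta om := exists s, [/\ fixes C s, s a = x, s z = eta & s w = om].

(** If [w] did define a point below all those definable from [d] and [a], then [z] and [w] would be
    interdefinable over [C] and [a], with a fixed direction of dependence. The point [d] and the
    points supplied by [deep] then produce a conjugate of [w] that violates this direction. *)
Lemma step : exists z', [/\ dcl (M :+ d :+ a) z', R z' & ~ lt z z'].
Proof.
apply: contrapT => H.
have zlow : low (M :+ d :+ a) z.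
  by split=> // r Mr Rr; apply: contrapT => H'; apply: H; exists r.
have Cda (x : U) : dcl (C :+ a) x -> dcl (M :+ d :+ a) x.
  by apply: dcl_mono => y [/CM ?|->]; [left; left|right].
have za : low (C :+ a) z by apply: low_sub zlow => x /sub_dcl/Cda.
have wz : dcl (C :+ a :+ z) w.
  by apply: exchange => //; [exact: small_add|exact: low_notin].
have wNa : ~ dcl (C :+ a) w.
  move=> wa; apply: (low_notin za); apply: dcl_cut wa waz; exact: sub_dcl.
have aCd : low (C :+ d) a.
  by apply: low_sub Ma => x [/CM ?|->]; apply: sub_dcl; left; [left|right].
have aCw : low (C :+ w) a.
  by apply: low_sub Ma => x [/CM ?|->]; apply: sub_dcl; [left; left|right].
have aC : low C a by apply: low_sub aCd => x Cx; apply: sub_dcl; left.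
have aM : low M a by apply: low_sub Ma => x Mx; apply: sub_dcl; left; left.
have dC : low C d by exact: low_sub CdM Md.
(* sign of the dependence of the second coordinate on the first *)
have [z1 z1P] : exists z1, low (C :+ a :+ z) z1.
  by apply: low_ex; [apply: small_add; exact: small_add|move=> x /AC; left; left].
have z1a : low (C :+ a) z1 by apply: low_sub z1P => x Cx; apply: sub_dcl; left.
have [s1 fs1 s1z] := low_conj (small_add a C_small) za z1a.
have [fs1C s1a] := fixes_of fs1.
have w1w : s1 w <> w.
  move=> e; have : lt z1 z by case: z1P => _; apply=> //; exact: dcl_add.
  rewrite -s1z; have -> : s1 z = z by apply: (dcl_fixed waz); exact: fixes_add.
  exact: lt_irr.
(* [lt'] is [lt] or its reverse, whichever makes [w] increase as [z] moves down to [z1]. *)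
have [lt' [lt'_aut lt'_order lt'_conj lt'w]] : exists lt' : U -> U -> Prop,
    [/\ (forall s x y, automorphism s -> lt' x y -> lt' (s x) (s y)),
        strict_linear_order lt',
        (forall S x y, small S -> lt' x y ->
          (forall e, dcl S e -> ~ ((x = e \/ lt' x e) /\ (e = y \/ lt' e y))) ->
          exists2 s, fixes S s & s x = y) & lt' w (s1 w)].
  case: (lt_tot w (s1 w)) => [h|e|h]; [exists lt; split=> //|by case: w1w|].
  exists (fun x y => lt y x); split=> //.
  - by move=> s x y As; exact: lt_aut.
  - by split=> // [x y t h1 h2|x y]; [exact: lt_trans h2 h1|case: (lt_tot x y) => ?; [constructor 3|constructor 2|constructor 1]].
  - move=> S x y sS yx Hn; have [|s fs sy] := @cut_conj S y x sS yx.
      move=> e Se [ye ex]; apply: (Hn e Se); split.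
        by case: ex; [left|right].
      by case: ye; [left|right].
    by have [t [ft sK tK]] := fixes_inv fs; exists t => //; rewrite -sy.
have lt'_asym x y : lt' x y -> lt' y x -> False.
  by case: lt'_order => irr tr _ h h'; exact: irr (tr _ _ _ h h').
have copy_uniq x eta om om' : copy x eta om -> copy x eta om' -> om = om'.
  move=> [s [fs sa sz <-]] [s' [fs' s'a s'z <-]].
  by apply: (dcl_agree2 fs fs' _ _ wz); rewrite ?sa ?sz.
(* The triples of a copy [(x, eta)] and a [zeta] in the cut over [x] and [eta] are all conjugate
   over [C], and the last coordinate of a copy is determined by the other two. So the direction seen
   at [(a, z, z1)] is seen everywhere. *)
have sign x eta om zeta om' : copy x eta om -> copy x zeta om' ->
    low (C :+ x :+ eta) zeta -> lt' om om'.
  move=> [s [fs sa sz sw]] cp lz.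
  have l1 := low_move2 AC fs z1P; rewrite sa sz in l1.
  have [|t ft tz] := low_conj _ l1 lz; first by apply: small_add; exact: small_add.
  have [ft1 te] := fixes_of ft; have [ftC tx] := fixes_of ft1.
  have tom : t om = om.
    by apply: (_ : dcl (C :+ x :+ eta) om) => //; rewrite -sa -sz -sw; exact: dcl_move2.
  have <- : t (s (s1 w)) = om'.
    apply: copy_uniq cp; exists (t \o s \o s1); split=> //=.
    - by apply: fixes_comp => //; exact: fixes_comp.
    - by rewrite s1a sa.
    - by rewrite s1z.
  rewrite -tom -sw; apply: (lt'_aut _ _ _); first by case: ft.
  by apply: (lt'_aut _ _ _) => //; case: fs.
have copy_az : copy a z w by exists id; split=> //; exact: fixes_id.
(* No conjugate [s0] of [w] beyond [w] is definable from [a]. With [b] above [a], the counterpart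
   [s s0] over [b] leaves [a] in the cut over it, so some copy over [a] has last coordinate [s s0].
   Its middle coordinate is definable over [M] and [a], hence far above [z], and [sign] puts [s s0]
   before [w]. *)
have notA1 s0 : dcl (C :+ a) s0 -> lt' w s0 -> (exists2 r, fixes C r & r w = s0) -> False.
  move=> as0 ws0 [r fr rw].
  have [b ab] := above_ex aM; have [b_a a_b Mb Cba] := ab.
  have lwb : low (C :+ w) b.
    split=> [|r' wr' Rr']; first by case: Mb.
    apply: above_lt ab Rr' _; apply: low_sub Ma => x [Mx|->].
      by apply: sub_dcl; left; left.
    by apply: dcl_cut wr'; [move=> y /CM ?; apply: sub_dcl; left; left|exact: dcl_add].
  have [|s fs sa] := low_conj _ aCw lwb; first exact: small_add.
  have [fsC sw] := fixes_of fs.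
  have s'b : dcl (C :+ b) (s s0) by rewrite -sa; exact: dcl_move.
  have ws' : lt' w (s s0) by rewrite -sw; apply: (lt'_aut _ _ _) => //; case: fs.
  have ls' : low (C :+ s s0) a.
    by apply: low_sub Cba => x [Cx|->//]; apply: sub_dcl; left.
  have [|t [ft tw ta]] := @low_indep C w a a (s \o r) C_small AC (fixes_comp fsC fr) aCw.
    by rewrite /= rw.
  rewrite /= rw in tw.
  have cp : copy a (t z) (s s0) by exists t.
  have eta_dcl : dcl (M :+ d :+ a) (t z).
    have := dcl_move2 ft waz; rewrite ta tw; apply: dcl_sub => x [[Cx|->]|->].
    - by apply: sub_dcl; left; left; exact: CM.
    - exact: dcl_add.
    - apply: dcl_cut s'b; first by move=> y /CM ?; apply: sub_dcl; left; left.
      by apply: dcl_mono b_a => y [?|->]; [left; left|right].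
  apply: lt'_asym ws' _; apply: sign cp copy_az _; apply: low_sub zlow => x [xa|->//].
  exact/Cda/sub_dcl.
(* The same with [M] and [d] as parameters. A point of [dcl (C :+ a)] between [w] and [th] would by
   [notA1] lead to a point of [dcl C] separating these conjugates. So [th] is conjugate to [w] over
   [C] and [a], and [sign] applies again. *)
have A2 th : dcl (M :+ d :+ a) th -> lt' w th -> (exists2 r, fixes C r & r w = th) -> False.
  move=> thM wth [r fr rw].
  have [|t ft tw] := @lt'_conj (C :+ a) w th (small_add a C_small) wth.
    move=> e ae [we eth].
    have {}we : lt' w e by case: we => // we; case: wNa; rewrite we.
    have nconj := notA1 e ae we.
    have [e0 [Ce0 [we0 e0e]]] : exists e0, dcl C e0 /\
        ((w = e0 \/ lt' w e0) /\ (e0 = e \/ lt' e0 e)).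
      apply: contrapT => H0; apply: nconj; apply: lt'_conj => // e0 Ce0 He0.
      by apply: H0; exists e0.
    have {}we0 : lt' w e0.
      by case: we0 => // we0; case: wNa; rewrite we0; exact: dclU.
    have the0 : lt' th e0.
      by rewrite -rw -(Ce0 _ fr); apply: (lt'_aut _ _ _) => //; case: fr.
    have [_ tr _] := lt'_order.
    case: e0e => [e0e|e0e].
      by case: eth => [eth|eth]; [subst e0 e; case: lt'_order => irr _ _; exact: irr the0|
        subst e0; exact: lt'_asym the0 eth].
    case: eth => [eth|eth]; first by subst e; exact: lt'_asym the0 e0e.
    exact: lt'_asym the0 (tr _ _ _ e0e eth).
  have [ftC ta] := fixes_of ft.
  have cp : copy a (t z) th by exists t.
  have eta_dcl : dcl (M :+ d :+ a) (t z).
    have := dcl_move2 ftC waz; rewrite ta tw; apply: dcl_sub => x [[Cx|->]|->//].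
    - by apply: sub_dcl; left; left; exact: CM.
    - exact: dcl_add.
  apply: lt'_asym wth _; apply: sign cp copy_az _; apply: low_sub zlow => x [xa|->//].
  exact/Cda/sub_dcl.
(* If [d] is in the cut over [C] and [w], the copy over [d] with last coordinate [w] has middle
   coordinate [s z], far above [a]. The copy over [d] with middle coordinate [a] then has its last
   coordinate beyond [w] and definable from [d] and [a], against [A2]. *)
case: (pselect (low (C :+ w) d)) => [wd|nwd].
  have [|s fs sa] := low_conj _ aCw wd; first exact: small_add.
  have [fsC sw] := fixes_of fs.
  have cp1 : copy d (s z) w by exists s.
  have dc1 : low (C :+ d) (s z) by rewrite -sa; exact: low_move.
  have la : low (C :+ d :+ s z) a.
    apply: low_sub Ma => x [[/CM Mx|->]|->].
    - by apply: sub_dcl; left; left.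
    - by apply: sub_dcl; left; right.
    - have := dcl_move2 fsC waz; rewrite sa sw; apply: dcl_mono => y [[/CM ?|->]|->].
      + by left; left.
      + by left; right.
      + by right.
  have [|t ft tz] := low_conj _ dc1 aCd; first exact: small_add.
  have [ftC td] := fixes_of ft.
  have cp2 : copy d a (t w).
    by exists (t \o s); split=> //=; [exact: fixes_comp|rewrite sa|rewrite sw].
  apply: (A2 (t w)); [|exact: sign cp1 cp2 la|by exists t].
  have := dcl_move2 fsC wz; rewrite sa sw => /(dcl_move2 ftC); rewrite td tz.
  by apply: dcl_mono => x [[/CM ?|->]|->]; [left; left|left; right|right].
(* Otherwise some [r] at or below [d] is interdefinable with [w] over [C]. By [notA1] the
   counterpart [s w] of [w] over [a] comes before [w]. With [d'] above [d], moving the pair [(r, a)]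
   to [(d', r)] sends [s w] to [w] and [w] to a conjugate beyond [w] definable over [M] and [d],
   against [A2]. *)
have [r [wr Rr rd]] : exists r, [/\ dcl (C :+ w) r, R r & ~ lt d r].
  apply: contrapT => H0; apply: nwd; split=> [|r wr Rr]; first by case: dC.
  by apply: contrapT => H1; apply: H0; exists r.
have {}rd : r = d \/ lt r d by case: (ltNge rd) => ?; [left|right].
have Cr : low C r by case: rd => [->//|rd]; exact: low_lt rd dC.
have rw : dcl (C :+ r) w by apply: exchange => //; exact: low_notin.
have aCr : low (C :+ r) a.
  apply: low_sub Ma => x [/CM ?|->]; first by apply: sub_dcl; left; left.
  by apply: dcl_mono wr => y [/CM ?|->]; [left; left|right].
have [s fs sr] := low_conj C_small Cr aC.
have wa : dcl (C :+ a) (s w) by rewrite -sr; exact: dcl_move.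
have {}wa : lt' (s w) w.
  case: lt'_order => _ _ /(_ w (s w))[h|e|//]; last by case: wNa; rewrite e.
  by case: (notA1 (s w)) => //; exists s.
have [d' [d'd _ Md' Cd'd]] := above_ex Md.
have Cd'r : low (C :+ d') r by case: rd => [->//|rd]; exact: low_lt rd Cd'd.
have Cd' : low C d' by exact: low_sub CdM Md'.
have [s' fs' s'r] := low_conj C_small Cr Cd'.
have [|t [ft tr ta]] := @low_indep C r a r s' C_small AC fs' aCr; first by rewrite s'r.
rewrite s'r in tr.
have tsw : t (s w) = w.
  by apply: (dcl_fixed rw (s := t \o s)); apply: fixes_add; [exact: fixes_comp|rewrite /= sr].
apply: (A2 (t w)); last by exists t.
- have := dcl_move ft rw; rewrite tr; apply: dcl_sub => x [/CM ?|->].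
    by apply: sub_dcl; left; left.
  by apply: dclU.
- by rewrite -{1}tsw; apply: (lt'_aut _ _ _) => //; case: ft.
Qed.

End Step.

(** * Absorbing finitely many parameters *)

Hypothesis small_seq : forall S (f : nat -> seq U), small S ->
  small (S `|` [set x | exists n, List.In x (f n)]).

Let E (l : seq U) := A `|` [set x | List.In x l].

Let E_sub l l' : List.incl l l' -> E l `<=` E l'.
Proof. by move=> ll' x [Ax|/ll']; [left|right]. Qed.

Let E_small l : small (E l). Proof. exact: small_list. Qed.

(* Over [l1], [x] sees elements of [R] below all those definable over [l ++ y] and [x]. *)
Let coinitial n l l1 := forall y, size y = n -> forall x, low (E (l1 ++ y)) x ->
  forall z, dcl (E (l ++ y) :+ x) z -> R z ->
  exists z', [/\ dcl (E l1 :+ x) z', R z' & ~ lt z z'].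

(** Supplies the point [d] that [step] requires. *)
Let based n l l1 := forall y, size y = n ->
  exists2 d, dcl (E (l1 ++ y)) d & low (E (l ++ y)) d.

(** The case in which the hypothesis [deep] is available above every finite set. *)
Let unbounded := forall l, exists m, forall x, low (E (l ++ m)) x ->
  exists2 z, dcl (E (l ++ m) :+ x) z & low (E l :+ x) z.

(** Adding [y] preserves [deep]: by [coinitial], a point below everything in [R] definable from [x]
    over [l1] is also below everything in [R] definable from [x] over [l ++ y]. *)
Lemma deepen l l1 m n y : List.incl l l1 -> coinitial n l l1 -> size y = n ->
  (forall x, low (E (l1 ++ m)) x ->
     exists2 z, dcl (E (l1 ++ m) :+ x) z & low (E l1 :+ x) z) ->
  forall x, low (E ((l1 ++ m) ++ y)) x ->
    exists2 z, dcl (E ((l1 ++ m) ++ y) :+ x) z & low (E (l ++ y) :+ x) z.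
Proof.
move=> ll1 co ny Hm x lx.
have [|z xz lz] := Hm x.
  by apply: low_sub lx => u Eu; apply: sub_dcl; apply: E_sub Eu; exact/List.incl_appl/List.incl_refl.
exists z.
  by apply: dcl_mono xz => u [Eu|->]; [left; apply: E_sub Eu; exact/List.incl_appl/List.incl_refl|right].
split=> [|r xr Rr]; first by case: lz.
have [|z' [xz' Rz' rz']] := co y ny x _ r xr Rr.
  apply: low_sub lx => u Eu; apply: sub_dcl; apply: E_sub Eu => v /in_cat_iff[h|h].
    by apply/in_cat_iff; left; apply/in_cat_iff; left.
  by apply/in_cat_iff; right.
have zz' : lt z z' by case: lz => _; exact.
by case: (ltNge rz') => [->//|]; exact: lt_trans.
Qed.

(** The two claims need each other: absorbing [w] by [step] uses the point of [based], and adding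
    [w] to [based] uses [deepen], hence [coinitial]. *)
Lemma coinitial_based : unbounded -> forall n l,
  (exists2 l1, List.incl l l1 & coinitial n l l1) /\
  (exists2 l1, List.incl l l1 & based n l l1).
Proof.
move=> unb; elim=> [|n IH] l.
  split.
    exists l => [|y /size0nil -> x _ z xz Rz]; first exact: List.incl_refl.
    by exists z; rewrite cats0 in xz; split.
  have [d ld] := low_ex (E_small l) (fun x h => or_introl h).
  exists (d :: l) => [|y /size0nil ->]; first exact/List.incl_tl/List.incl_refl.
  by exists d; rewrite cats0 //; apply: sub_dcl; right; left.
have [[l1 ll1 co1] _] := IH l; have [m Hm] := unb l1.
have [_ [l3 l23 ba3]] := IH (l1 ++ m).
have l13 : List.incl l l3.
  by move=> u /ll1 ?; apply: l23; apply/in_cat_iff; left.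
split.
  (* [step] removes [w] but leaves a point definable from [x] over [l3 ++ y]; a second use of the
     induction hypothesis, from [l3] to [l4], removes [y]. *)
  have [[l4 l34 co4] _] := IH l3; exists l4 => [u /l13/l34//|].
  move=> [//|w y] [ny] x lx z xz Rz.
  have [d d3 ld] := ba3 y ny.
  have in4 u : List.In u (l3 ++ y) -> List.In u (l4 ++ w :: y).
    by move=> /in_cat_iff[/l34 h|h]; apply/in_cat_iff; [left|right; right].
  have E3 : E (l3 ++ y) `<=` E (l4 ++ w :: y) by apply: E_sub => u; exact: in4.
  have [||||||z' [xz' Rz' zz']] := @step (E (l ++ y)) (E ((l1 ++ m) ++ y)) _ _ _ _ d w x z ld _ _ Rz.
  - by move=> u Au; left.
  - apply: E_sub => u /in_cat_iff[/ll1 h|h]; apply/in_cat_iff; last by right.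
    by left; apply/in_cat_iff; left.
  - exact: E_small.
  - exact: deepen ll1 co1 ny Hm.
  - apply: low_sub lx => u [[Eu|->]|->].
    + apply/sub_dcl/E3; apply: E_sub Eu => v /in_cat_iff[/l23 h|h];
        apply/in_cat_iff; by [left|right].
    + exact: dcl_mono d3.
    + by apply: sub_dcl; right; apply/in_cat_iff; right; left.
  - apply: dcl_mono xz => u [[Au|/= /in_cat_iff[h|[<-|h]]]|->].
    + by left; left; left.
    + by left; left; right; apply/in_cat_iff; left.
    + by right.
    + by left; left; right; apply/in_cat_iff; right.
    + by left; right.
  have [||z'' [xz'' Rz'' z'z'']] := co4 y ny x _ z' _ Rz'.
  - apply: low_sub lx => u Eu; apply: sub_dcl; apply: E_sub Eu => v /in_cat_iff[h|h];
      apply/in_cat_iff; [by left|by right; right].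
  - apply: dcl_sub xz' => u [[Eu|->]|->]; last exact: dcl_add.
      apply: sub_dcl; left; apply: E_sub Eu => v /in_cat_iff[/l23 h|h];
        apply/in_cat_iff; by [left|right].
    exact: dclU.
  exists z''; split=> // h; case: (ltNge zz') => [e|h'].
    by apply: z'z''; rewrite -e.
  by apply: z'z''; exact: lt_trans h' h.
exists l3 => //; move=> [//|w y] [ny].
have [d d3 ld] := ba3 y ny.
have E3 : E (l3 ++ y) `<=` E (l3 ++ w :: y).
  by apply: E_sub => u /in_cat_iff[h|h]; apply/in_cat_iff; [left|right; right].
(* If [d] leaves the cut when [w] is added, some [r] in [R] at or below [d] is interdefinable with
   [w] over [l ++ y]; a point deep below [r] is then in the cut over [w] as well. *)
case: (pselect (low (E (l ++ w :: y)) d)) => [h|nlow].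
  by exists d => //; exact: dcl_mono d3.
have [r [yr Rr rd]] : exists r, [/\ dcl (E (l ++ w :: y)) r, R r & ~ lt d r].
  apply: contrapT => H0; apply: nlow; split=> [|r yr Rr]; first by case: ld.
  by apply: contrapT => H1; apply: H0; exists r.
have lr : low (E ((l1 ++ m) ++ y)) r.
  by case: (ltNge rd) => [<-//|h]; exact: low_lt h ld.
have subE : E (l ++ y) `<=` E ((l1 ++ m) ++ y).
  apply: E_sub => u /in_cat_iff[/ll1 h|h]; apply/in_cat_iff; last by right.
  by left; apply/in_cat_iff; left.
have yE u : E (l ++ w :: y) u -> (E (l ++ y) :+ w) u.
  move=> [Au|/= /in_cat_iff[h|[<-|h]]].
  - by left; left.
  - by left; right; apply/in_cat_iff; left.
  - by right.
  - by left; right; apply/in_cat_iff; right.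
have rw : dcl (E (l ++ y) :+ r) w.
  apply: exchange => //; first by apply: dcl_mono yr => u /yE.
  by apply: low_notin; apply: low_sub lr => u /subE/sub_dcl.
have [z rz [Rz lz]] := deepen ll1 co1 ny Hm lr.
exists z.
  apply: dcl_sub rz => u [Eu|->].
    apply/sub_dcl/E3; apply: E_sub Eu => v /in_cat_iff[/l23 h|h];
      apply/in_cat_iff; by [left|right].
  by apply: dcl_mono yr; apply: E_sub => v /in_cat_iff[/l13 h|h];
    apply/in_cat_iff; by [left|right].
split=> // t yt Rt; apply: lz => //.
apply: dcl_sub yt => u /yE[Eu|->//]; by apply: sub_dcl; left.
Qed.

(* Some small [N] suffices to bound from below the points definable from [x] and finitely many
   further parameters [l], as soon as [x] is in the cut over [l]: this makes a 1-type equidominant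
   to its square. *)
Lemma coinitial_small : exists N, [/\ A `<=` N, small N &
  forall (l : seq U) x, low (N `|` [set u | List.In u l]) x ->
  forall z, dcl (E l :+ x) z -> R z ->
  exists z', [/\ dcl (N :+ x) z', R z' & ~ lt z z']].
Proof.
(* If [unbounded] fails at [l], then [E l] already works: the failure at one realisation over
   [l ++ m] holds at all of them, since they are conjugate. *)
case: (pselect unbounded) => [/coinitial_based cb|/existsNP[l /forallNP Hl]]; last first.
  exists (E l); split=> [u|//|m x lx z xz Rz]; first by left.
  have /existsNP[x' H] := Hl m.
  have {H} [lx' nz] : low (E (l ++ m)) x' /\
      forall z, dcl (E (l ++ m) :+ x') z -> ~ low (E l :+ x') z.
    split; first by apply: contrapT => h; apply: H.
    by move=> z' xz' lz'; apply: H => _; exists z'.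
  have {}lx : low (E (l ++ m)) x.
    apply: low_sub lx => u [Au|/in_cat_iff[h|h]]; apply: sub_dcl.
    - by left; left.
    - by left; right.
    - by right.
  have [s fs sx] := low_conj (E_small _) lx lx'.
  have fsl : fixes (E l) s.
    by apply: fixes_sub fs; apply: E_sub; exact/List.incl_appl/List.incl_refl.
  have nlz : ~ low (E l :+ x) z.
    move=> lz; apply: (nz (s z)).
      rewrite -sx; apply: dcl_move fs _; apply: dcl_mono xz => u [Eu|->]; last by right.
      by left; apply: E_sub Eu; exact/List.incl_appr/List.incl_refl.
    by rewrite -sx; apply: low_move => // u; left.
  apply: contrapT => H; apply: nlz; split=> // r xr Rr; apply: contrapT => h.
  by apply: H; exists r.
(* One list for each number of extra parameters; their union is countable, hence harmless for
   smallness. *)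
have ex n : exists l1, coinitial n [::] l1 by have [[l1 _ co] _] := cb n [::]; exists l1.
have [f Hf] := choice ex.
exists (A `|` [set x | exists n, List.In x (f n)]); split=> [u||l x lx z xz Rz].
- by left.
- exact: small_seq.
have [||z' [xz' Rz' zz']] := Hf (size l) l erefl x _ z _ Rz.
- apply: low_sub lx => u [Au|/in_cat_iff[h|h]]; apply: sub_dcl.
  + by left; left.
  + by left; right; exists (size l).
  + by right.
- by [].
exists z'; split=> //; apply: dcl_mono xz' => u [[Au|h]|->].
- by left; left.
- by left; right; exists (size l).
- by right.
Qed.

End Cut.

(** * Subsets of a linear order that are constant off a finite list *)

Section LinearOrder.
Variables (L : language) (U : structure L) (lt : U -> U -> Prop).
Hypothesis lt_order : strict_linear_order lt.

Let lt_irr x : ~ lt x x. Proof. by case: lt_order. Qed.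
Let lt_trans x y z : lt x y -> lt y z -> lt x z. Proof. by case: lt_order => _ h _; exact: h. Qed.
Let lt_tot x y : [\/ lt x y, x = y | lt y x]. Proof. by case: lt_order. Qed.
Let ltNge x y : ~ lt x y -> x = y \/ lt y x. Proof. by case: (lt_tot x y); tauto. Qed.

Lemma flip_order : strict_linear_order (fun x y => lt y x).
Proof.
split=> // [x y z h h'|x y]; first exact: lt_trans h' h.
by case: (lt_tot x y) => ?; [constructor 3|constructor 2|constructor 1].
Qed.

Definition le x y := x = y \/ lt x y.

Lemma le_lt_trans x y z : le x y -> lt y z -> lt x z.
Proof. by case=> [->//|]; exact: lt_trans. Qed.

Lemma lt_le_trans x y z : lt x y -> le y z -> lt x z.
Proof. by move=> h [<-//|]; exact: lt_trans. Qed.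

Lemma le_trans x y z : le x y -> le y z -> le x z.
Proof. by case=> [->//|h h']; right; exact: lt_le_trans h h'. Qed.

Lemma le_or_lt x y : le x y \/ lt y x.
Proof. by case: (lt_tot x y) => ?; [left; right|left; left|right]. Qed.

Lemma lt_not_le x y : lt x y -> ~ le y x.
Proof. by move=> h h'; exact: lt_irr (lt_le_trans h h'). Qed.

Lemma list_max (P : U -> Prop) (l : seq U) x : List.In x l -> P x ->
  exists m, [/\ List.In m l, P m & forall y, List.In y l -> P y -> le y m].
Proof.
elim: l x => [//|y l IH] x xl Px.
case: (pselect (exists2 x', List.In x' l & P x')) => [[x' x'l Px']|H]; last first.
  have [e] : y = x by case: xl => // xl; case: H; exists x.
  exists x; split=> // y' [<-|y'l] Py'; first by rewrite e; left.
  by case: H; exists y'.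
have [m [ml Pm Hm]] := IH _ x'l Px'.
case: (pselect (P y)) => [Py|nPy]; last first.
  by exists m; split=> // [|y' [<-//|y'l]]; [right|exact: Hm].
case: (le_or_lt y m) => ym.
  by exists m; split=> // [|y' [<-//|y'l]]; [right|exact: Hm].
exists y; split=> // [|y' [<-|y'l] Py']; [by left|by left|].
by apply: le_trans (Hm _ y'l Py') _; right.
Qed.

Lemma no_increasing_seq (l : seq U) (f : nat -> U) :
  (forall n, lt (f n) (f n.+1)) -> ~ (forall n, List.In (f n) l).
Proof.
move=> inc fl; have [|m [_ [n ->] Hm]] := @list_max (fun x => exists n, x = f n) l (f 0) (fl 0).
  by exists 0.
apply: lt_not_le (inc n) _; apply: Hm => //; by exists n.+1.
Qed.

(** The form in which o-minimality is used. It treats dense and discrete orders alike, as it speaks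
    of closed segments that avoid [E]. *)
Definition const_on (E : seq U) (D : U -> Prop) :=
  forall x y, lt x y -> (forall e, List.In e E -> ~ (le x e /\ le e y)) -> (D x <-> D y).

Lemma room_below (E : seq U) t : (exists u, lt u t) ->
  (forall e, List.In e E -> lt e t -> exists u, lt e u /\ lt u t) ->
  exists u, lt u t /\ forall e, List.In e E -> lt e t -> lt e u.
Proof.
move=> nmin; elim: E => [|e E IH] H; first by have [u ut] := nmin; exists u.
have [|u [ut Hu]] := IH; first by move=> e' e'E; apply: H; right.
case: (pselect (lt e t)) => et; last by exists u; split=> // e' [<-//|]; exact: Hu.
have [u' [eu' u't]] := H e (or_introl erefl) et.
case: (le_or_lt u u') => uu'.
  exists u'; split=> // e' [<-//|e'E] e't; exact: lt_le_trans (Hu _ e'E e't) uu'.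
exists u; split=> // e' [<-|]; [by move=> _; exact: lt_trans uu'|exact: Hu].
Qed.

(* Endpoints of [D]; the first and last elements of the order always count. *)
Definition bd (D : U -> Prop) t := ~ exists u v,
  [/\ lt u t, lt t v & forall s, le u s -> le s v -> (D s <-> D t)].

(** Let [m] be the largest listed point in [X] and [M] the smallest listed point outside. Strictly
    between them [X] is constant, so the supremum is [M] if [X] contains such a point and [m]
    otherwise. *)
Lemma sup_cut (E : seq U) (X : U -> Prop) x y : const_on E X ->
  (forall t t', lt t' t -> X t -> X t') -> X x -> ~ X y ->
  exists s, (forall t, lt t s -> X t) /\ (forall t, lt s t -> ~ X t).
Proof.
move=> cE down Xx nXy.
have [|m [_ Xm Hm]] := @list_max X (x :: E) x _ Xx; first by left.
have [M [_ XM HM]] : exists M, [/\ List.In M (y :: E), ~ X M &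
    forall e, List.In e (y :: E) -> ~ X e -> le M e].
  elim: E {cE m Xm Hm} => [|e E [M [MyE XM HM]]].
    by exists y; split=> // [|e [<-|[]] _]; left.
  case: (pselect (X e)) => Xe.
    exists M; split=> // [|e' [e'y|[<-//|e'E]] Xe'].
    - by case: MyE => [->|h]; [left|right; right].
    - by apply: HM => //; left.
    - by apply: HM => //; right.
  case: (le_or_lt M e) => Me.
    exists M; split=> // [|e' [e'y|[<-//|e'E]] Xe'].
    - by case: MyE => [->|h]; [left|right; right].
    - by apply: HM => //; left.
    - by apply: HM => //; right.
  exists e; split=> // [|e' [e'y|[<-//|e'E]] Xe']; first by right; left.
  - by right; apply: lt_le_trans Me _; apply: HM => //; left.
  - by left.
  - by right; apply: lt_le_trans Me _; apply: HM => //; right.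
have mM : lt m M.
  case: (le_or_lt M m) => // -[e|Mm]; first by case: XM; rewrite e.
  by case: XM; exact: down Mm Xm.
have noE t : lt m t -> lt t M -> ~ List.In t E.
  move=> mt tM tE; case: (pselect (X t)) => Xt.
    by apply: lt_not_le mt _; apply: Hm => //; right.
  by apply: lt_not_le tM _; apply: HM => //; right.
have same t t' : lt m t -> lt t t' -> lt t' M -> (X t <-> X t').
  move=> mt tt' t'M; apply: cE => // e eE [te et'].
  by apply: (noE e) => //; [exact: lt_le_trans te|exact: le_lt_trans t'M].
case: (pselect (exists t, [/\ lt m t, lt t M & X t])) => [[t [mt tM Xt]]|H].
  exists M; split=> [t' t'M|t' Mt' Xt']; last by apply: XM; exact: down Mt' Xt'.
  case: (lt_tot t t') => [tt'|<-//|t't]; last exact: down t't Xt.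
  by apply/(same t t').
exists m; split=> [t tm|t mt Xt]; first exact: down tm Xm.
case: (le_or_lt M t) => [[e|Mt]|tM]; first by apply: XM; rewrite e.
  by apply: XM; exact: down Mt Xt.
by apply: H; exists t.
Qed.

Lemma const_on_seg (E : seq U) (D : U -> Prop) x : const_on E D ->
  const_on (x :: E) (fun t => le t x \/ forall u, le x u -> le u t -> D u).
Proof.
move=> cE t t' tt' H.
have {}H e : List.In e (x :: E) -> lt e t \/ lt t' e.
  move=> /H h; case: (le_or_lt t e) => te; last by left.
  by case: (le_or_lt e t') => et'; [case: h|right].
have [xt|t'x] := H x (or_introl erefl); last first.
  by split=> _; left; right=> //; exact: lt_trans t'x.
have nl : ~ le t x by exact: lt_not_le.
have nl' : ~ le t' x by apply: lt_not_le; exact: lt_trans tt'.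
split=> -[//|Hu]; right=> u xu ut; last by apply: Hu => //; right; exact: le_lt_trans tt'.
case: (le_or_lt u t) => [ut'|tu]; first exact: Hu.
have Dt : D t by apply: Hu; [right|left].
apply/(cE t u) => // e eE [te eu].
case: (H e (or_intror eE)) => h; first exact: lt_not_le te.
by apply: lt_not_le h _; exact: le_trans ut.
Qed.

(** The boundary point is the supremum of the initial segment of points that can be reached from [x]
    inside [D]; if [D] were constant around it, the segment would go further or would have ended
    earlier. *)
Lemma bd_between (E : seq U) (D : U -> Prop) x y : const_on E D -> lt x y ->
  D x -> ~ D y -> exists t, [/\ bd D t, le x t & le t y].
Proof.
move=> cE xy Dx nDy.
pose X t := le t x \/ forall u, le x u -> le u t -> D u.
have Xx : X x by left; left.
have Xy : ~ X y.
  by case=> [|/(_ y)h]; [exact: lt_not_le|apply/nDy/h; [right|left]].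
have down t t' : lt t' t -> X t -> X t'.
  move=> t't [tx|H]; first by left; right; exact: lt_le_trans tx.
  by right=> u xu ut'; apply: H => //; right; exact: le_lt_trans t't.
have [s [sX nX]] := sup_cut (const_on_seg (x := x) cE) down Xx Xy.
have xs : le x s by case: (le_or_lt x s) => // h; case: (nX _ h).
have sy : le s y by case: (le_or_lt s y) => // h; case: (Xy (sX _ h)).
exists s; split=> // -[u [v [us sv H]]].
have below t : lt t s -> le x t -> D t.
  move=> ts xt; case: (sX t ts) => [[->//|h]|]; last by apply=> //; left.
  by case: (lt_not_le h).
case: (pselect (D s)) => Ds.
  apply: (nX v sv); right=> t xt tv.
  case: (lt_tot t s) => [ts|->//|st]; first exact: below.
  by apply/H => //; right; exact: lt_trans st.
case: (le_or_lt x u) => xu.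
  by apply: Ds; apply/(H u); [left|right; exact: lt_trans sv|exact: below].
by apply: Ds; apply/(H x) => //; [right|right; exact: le_lt_trans sv].
Qed.

End LinearOrder.

Section Boundary.
Variables (L : language) (U : structure L) (lt : U -> U -> Prop).
Hypothesis lt_order : strict_linear_order lt.

Let gt x y := lt y x.
Let gt_order : strict_linear_order gt. Proof. exact: flip_order. Qed.

(** Candidates are the ends of the order, the points of [E] and, since the order may be discrete,
    the immediate neighbours of points of [E]. Around any other point there is a segment that avoids
    [E]. *)
Lemma bd_finite (E : seq U) (D : U -> Prop) : const_on lt E D ->
  exists B : seq U, forall t, bd lt D t -> List.In t B.
Proof.
move=> cE; have [lt_irr lt_trans lt_tot] := lt_order.
have uniq_list (P : U -> Prop) : (forall x y, P x -> P y -> x = y) ->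
    exists l : seq U, forall x, P x -> List.In x l.
  move=> uP; case: (pselect (exists x, P x)) => [[x Px]|H].
    by exists [:: x] => y Py; left; exact: uP.
  by exists [::] => x Px; case: H; exists x.
have [lmin Hmin] := @uniq_list (fun t => ~ exists u, lt u t) ltac:(
  by move=> x y nx ny; case: (lt_tot x y) => // h; [case: ny; exists x|case: nx; exists y]).
have [lmax Hmax] := @uniq_list (fun t => ~ exists u, lt t u) ltac:(
  by move=> x y nx ny; case: (lt_tot x y) => // h; [case: nx; exists y|case: ny; exists x]).
have [p Hp] := choice (fun e => @uniq_list (fun t => lt t e /\ ~ exists u, lt t u /\ lt u e) ltac:(
  by move=> x y [xe nx] [ye ny]; case: (lt_tot x y) => // h; [case: nx; exists y|case: ny; exists x])).
have [q Hq] := choice (fun e => @uniq_list (fun t => lt e t /\ ~ exists u, lt e u /\ lt u t) ltac:(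
  by move=> x y [xe nx] [ye ny]; case: (lt_tot x y) => // h; [case: ny; exists x|case: nx; exists y])).
have in_flat (f : U -> seq U) (l : seq U) e t : List.In e l -> List.In t (f e) ->
    List.In t (flatten [seq f e | e <- l]).
  elim: l => //= e' l IH [->|el] te; apply: List.in_or_app; [by left|right; exact: IH].
exists (lmin ++ lmax ++ E ++ flatten [seq p e | e <- E] ++ flatten [seq q e | e <- E]).
move=> t bt; apply: contrapT => H; apply: bt.
have {H} [nmin [nmax [nE [np nq]]]] : ~ List.In t lmin /\ ~ List.In t lmax /\ ~ List.In t E /\
    ~ List.In t (flatten [seq p e | e <- E]) /\ ~ List.In t (flatten [seq q e | e <- E]).
  by move: H; rewrite !in_cat_iff; tauto.
have [||u [ut Hu]] := room_below lt_order (E := E) (t := t).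
- by apply: contrapT => h; apply: nmin; exact: Hmin.
- move=> e eE et; apply: contrapT => h; apply: nq; apply: in_flat eE _; apply: Hq.
  by split.
have [||v [tv Hv]] := room_below gt_order (E := E) (t := t).
- by apply: contrapT => h; apply: nmax; exact: Hmax.
- move=> e eE et; apply: contrapT => h; apply: np; apply: in_flat eE _; apply: Hp.
  by split=> // -[u' [h1 h2]]; apply: h; exists u'.
have noE e : List.In e E -> ~ (le lt u e /\ le lt e v).
  move=> eE [ue ev]; case: (lt_tot e t) => [et|e_t|te].
  - exact: (lt_not_le lt_order (Hu _ eE et)).
  - by apply: nE; rewrite -e_t.
  - exact: (lt_not_le lt_order (Hv _ eE te)).
exists u, v; split=> // s us sv.
case: (lt_tot s t) => [st|->//|ts].
  apply: cE => // e eE [se et]; apply: (noE e eE); split; first exact: (le_trans lt_order us).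
  by right; exact: (le_lt_trans lt_order et tv).
apply: iff_sym; apply: cE => // e eE [te es]; apply: (noE e eE); split.
  by right; exact: (lt_le_trans lt_order ut te).
exact: (le_trans lt_order es).
Qed.

End Boundary.

(** * Definable predicates on environments *)

Section Definable.
Variables (L : language) (U : structure L).

Definition scons (d : U) (e : nat -> U) n := if n is n'.+1 then e n' else d.

(** Variables are de Bruijn indices into an environment, so definability is proved by following the
    shape of a predicate and no formula has to be written out. *)
Definition definable (P : (nat -> U) -> Prop) :=
  exists phi : formula L (nat + U), forall e, P e <-> sat (either e id) phi.

Lemma definable_imp P Q : definable P -> definable Q -> definable (fun e => P e -> Q e).
Proof. by move=> [p Hp] [q Hq]; exists (Imp p q) => e /=; rewrite Hp Hq. Qed.

Lemma definable_false : definable (fun=> False).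
Proof. by exists Bot. Qed.

Lemma definable_eq i j : definable (fun e => e i = e j).
Proof. by exists (Eq (Var (inl i)) (Var (inl j))). Qed.

Lemma definable_ext P Q : (forall e, P e <-> Q e) -> definable P -> definable Q.
Proof. by move=> PQ [p Hp]; exists p => e; rewrite -PQ. Qed.

Lemma definable_and P Q : definable P -> definable Q -> definable (fun e => P e /\ Q e).
Proof.
move=> dP dQ; apply: (@definable_ext (fun e => (P e -> Q e -> False) -> False)).
  by move=> e; split=> [H|[p q]]; [apply: contrapT => h; apply: H => p q; exact: h|exact].
by repeat apply: definable_imp => //; exact: definable_false.
Qed.

Lemma definable_or P Q : definable P -> definable Q -> definable (fun e => P e \/ Q e).
Proof.
move=> dP dQ; apply: (@definable_ext (fun e => (P e -> False) -> Q e)).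
  move=> e; split=> [H|[p|q]//].
  by case: (pselect (P e)) => [|/H]; [left|right].
by repeat apply: definable_imp => //; exact: definable_false.
Qed.

Lemma definable_all P : definable P -> definable (fun e => forall d, P (scons d e)).
Proof.
move=> [p Hp].
exists (All (rename (either (fun n => if n is n'.+1 then Some (inl n') else None) (Some \o inr)) p)).
move=> e; have E d : P (scons d e) <-> sat (fun o => oapp (either e id) d o) (rename
    (either (fun n => if n is n'.+1 then Some (inl n') else None) (Some \o inr)) p).
  rewrite sat_rename Hp; suff -> : (fun o => oapp (either e id) d o) \o
    either (fun n => if n is n'.+1 then Some (inl n') else None) (Some \o inr) =
    either (scons d e) id by [].
  by apply/funext => -[[]|].
by split=> H d; apply/E.
Qed.

Lemma definable_ex P : definable P -> definable (fun e => exists d, P (scons d e)).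
Proof.
move=> dP; apply: (@definable_ext (fun e => (forall d, P (scons d e) -> False) -> False)).
  move=> e; split=> [H|[d Hd] h]; last exact: h Hd.
  by apply: contrapT => h; apply: H => d Hd; apply: h; exists d.
apply: definable_imp; last exact: definable_false.
apply: (@definable_all (fun e => P e -> False)).
by apply: definable_imp => //; exact: definable_false.
Qed.

Lemma definable_sat V (f : V -> nat + U) (phi : formula L V) :
  definable (fun e => sat (either e id \o f) phi).
Proof. by exists (rename f phi) => e; rewrite sat_rename. Qed.

Lemma definable_unary (P : U -> Prop) : definable (fun e => P (e 0)) -> definable1 P.
Proof.
move=> [p Hp]; exists (rename (sum_map (fun=> ord0 : 'I_1) id) p).
apply/predeqP => x /=; rewrite sat_rename (Hp (fun=> x)).
suff -> : either (fun=> x) id \o sum_map (fun=> ord0 : 'I_1) id = either (fun _ : nat => x) (@id U) by [].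
by apply/funext => -[].
Qed.

End Definable.

(** * Boundary points in o-minimal structures *)

Section OMin.
Variables (L : language) (U : structure L) (ltf : formula L 'I_2).
Local Notation lt := (@rel_of L U ltf).
Hypothesis omin : o_minimal_structure lt.

Let lt_order : strict_linear_order lt. Proof. by case: omin. Qed.

Lemma lt_aut s x y : automorphism s -> lt x y -> lt (s x) (s y).
Proof.
move=> As; rewrite /rel_of; suff -> : pair_val (s x) (s y) = s \o pair_val x y.
  by rewrite sat_aut.
by apply/funext => i; rewrite /pair_val /=; case: ifP.
Qed.

Lemma const_onU E E' (D D' : U -> Prop) : const_on lt E D -> const_on lt E' D' ->
  const_on lt (E ++ E') (fun x => D x \/ D' x).
Proof.
move=> cE cE' x y xy H.
have h : D x <-> D y by apply: cE => // e eE; apply: H; apply/in_cat_iff; left.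
have h' : D' x <-> D' y by apply: cE' => // e eE; apply: H; apply/in_cat_iff; right.
by rewrite h h'.
Qed.

Lemma definable_const (D : U -> Prop) : definable1 D -> exists E, const_on lt E D.
Proof.
have [irr tr tot] := lt_order.
move=> dD; have [F [/finite_list[s Fs] FI DF]] := omin.2 _ dD.
have {}FI I : List.In I s -> is_point I \/ is_interval lt I by move=> /Fs/FI.
have [E cE] : exists E, const_on lt E (fun x => exists I, List.In I s /\ I x).
  elim: s FI {Fs} => [|I s IH] FI; first by exists [::] => x y _ _; split=> -[? []].
  have [E cE] := IH (fun J Js => FI J (or_intror Js)).
  have [E' cE'] : exists E', const_on lt E' I.
    case: (FI I (or_introl erefl)) => [[a ->]|[lo [hi ->]]].
      exists [:: a] => x y xy H; split=> /= e; case: (H a); try by left.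
        by rewrite -e; split; [left|right].
      by rewrite -e; split; [right|left].
    exists ((if lo is Some a then [:: a] else [::]) ++ (if hi is Some a then [:: a] else [::])).
    move=> x y xy H /=; split=> -[h1 h2]; split.
    - by case: lo {H} h1 => // a; move/tr; exact.
    - case: hi H h2 => // b H xb; case: (le_or_lt lt_order b y) => // yb.
      by case: (H b); [apply/in_cat_iff; right; left|split=> //; right].
    - case: lo H h1 => // a H ay; case: (le_or_lt lt_order x a) => // xa.
      by case: (H a); [apply/in_cat_iff; left; left|split=> //; right].
    - by case: hi {H} h2 => // b; exact: tr xy.
  exists (E' ++ E) => x y xy H; have := const_onU cE' cE xy H.
  have eq z : (exists J, List.In J (I :: s) /\ J z) <-> (I z \/ exists J, List.In J s /\ J z).
    split=> [[J [[<-|Js] Jz]]|[Iz|[J [Js Jz]]]]; [by left|by right; exists J| |].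
      by exists I; split=> //; left.
    by exists J; split=> //; right.
  by rewrite !eq.
exists E; suff -> : (D : U -> Prop) = (fun x => exists I, List.In I s /\ I x) by [].
rewrite DF; apply/predeqP => x; split=> [[I /= /Fs Is Ix]|[I [Is Ix]]]; first by exists I.
by exists I => //; apply/Fs.
Qed.

(** A moved point would have a strictly monotone orbit inside a finite set. In this way algebraic
    points become definable. *)
Lemma fixed_of_finite (P : U -> Prop) l s x : (forall x, P x -> List.In x l) ->
  automorphism s -> (forall x, P x -> P (s x)) -> P x -> s x = x.
Proof.
move=> Pl As Ps Px; have [_ _ tot] := lt_order.
have Pn n : List.In (iter n s x) l by apply: Pl; elim: n => //= n; exact: Ps.
case: (tot x (s x)) => [h|//|h].
  case: (@no_increasing_seq L U lt lt_order l (fun n => iter n s x)) => // n.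
  by elim: n => //= n; exact: lt_aut.
case: (@no_increasing_seq L U (fun x y => lt y x) (flip_order lt_order) l (fun n => iter n s x)) => // n.
by elim: n => //= n; exact: lt_aut.
Qed.

Lemma bd_definable (D : U -> Prop) : definable1 D ->
  exists B : seq U, forall t, bd lt D t -> List.In t B.
Proof. by move=> /definable_const[E] /(bd_finite lt_order). Qed.

Lemma bd_aut (D : U -> Prop) s t : automorphism s -> (forall x, D x <-> D (s x)) ->
  bd lt D t -> bd lt D (s t).
Proof.
move=> As Ds; have [s' [As' sK s'K]] := aut_inv As.
move=> bt [u [v [us sv H]]]; apply: bt; exists (s' u), (s' v); split.
- by rewrite -[t]sK; exact: lt_aut.
- by rewrite -[t]sK; exact: lt_aut.
have mono x y : le lt x y -> le lt (s x) (s y).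
  by case=> [->|h]; [left|right; exact: lt_aut].
by move=> r /mono + /mono; rewrite !s'K => h h'; rewrite Ds H // -Ds.
Qed.

Lemma bd_dcl (D : U -> Prop) S t : definable1 D -> (forall s x, fixes S s -> D x -> D (s x)) ->
  bd lt D t -> dcl S t.
Proof.
move=> /bd_definable[B HB] Ds bt s fs; apply: fixed_of_finite HB fs.1 _ bt => x.
apply: (bd_aut fs.1) => y; split; first exact: Ds.
by have [t' [ft sK _]] := fixes_inv fs; move=> /(Ds _ _ ft); rewrite sK.
Qed.

Lemma bd_between_dcl (D : U -> Prop) S x y : definable1 D ->
  (forall s x, fixes S s -> D x -> D (s x)) -> lt x y -> D x -> ~ D y ->
  exists t, [/\ dcl S t, le lt x t & le lt t y].
Proof.
move=> dD Ds xy Dx Dy; have [E cE] := definable_const dD.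
by have [t [bt ? ?]] := bd_between lt_order cE xy Dx Dy; exists t; split=> //; exact: bd_dcl bt.
Qed.

End OMin.

(** * Types and automorphisms of the monster model *)

Notation "S :++ x" := (S `|` range x) (at level 50, left associativity).

Section Tuples.
Variable U : Type.

Definition lpart n m (z : 'I_(n + m) -> U) := z \o @lshift n m.
Definition rpart n m (z : 'I_(n + m) -> U) := z \o @rshift n m.
Definition join n m (x : 'I_n -> U) (y : 'I_m -> U) (i : 'I_(n + m)) :=
  either x y (fintype.split i).

Lemma lpart_join n m (x : 'I_n -> U) (y : 'I_m -> U) : lpart (join x y) = x.
Proof. by apply/funext => i; rewrite /lpart /join /= (unsplitK (inl i)). Qed.

Lemma rpart_join n m (x : 'I_n -> U) (y : 'I_m -> U) : rpart (join x y) = y.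
Proof. by apply/funext => i; rewrite /rpart /join /= (unsplitK (inr i)). Qed.

Lemma join_parts n m (z : 'I_(n + m) -> U) : join (lpart z) (rpart z) = z.
Proof. by apply/funext => i; rewrite /join /lpart /rpart -[in RHS](splitK i); case: fintype.split. Qed.

Lemma parts_inj n m (z z' : 'I_(n + m) -> U) : lpart z = lpart z' -> rpart z = rpart z' -> z = z'.
Proof. by move=> h h'; rewrite -(join_parts z) h h' join_parts. Qed.

Lemma range_join n m (x : 'I_n -> U) (y : 'I_m -> U) : range (join x y) = range x `|` range y.
Proof.
apply/predeqP => u; split=> [[i _ <-]|[[i _ <-]|[i _ <-]]].
- by rewrite /join; case: fintype.split => j; [left|right]; exists j.
- by exists (lshift m i) => //; rewrite /join (unsplitK (inl i)).
- by exists (rshift n i) => //; rewrite /join (unsplitK (inr i)).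
Qed.

End Tuples.

Lemma comp_join (W V : Type) (s : W -> V) n m (x : 'I_n -> W) (y : 'I_m -> W) :
  s \o join x y = join (s \o x) (s \o y).
Proof. by apply/funext => i; rewrite /join /=; case: (fintype.split i). Qed.

Section Complete.
Variables (L : language) (U : structure L).

Lemma elementary_sat (N : structure L) (e : U -> N) V (v : V -> U) (phi : formula L V) :
  elementary e -> sat (e \o v) phi <-> sat v phi.
Proof. by move=> ee; have := ee (rename v phi); rewrite !sat_rename; case; split. Qed.

Lemma complete_not (N : structure L) B (j : B -> N) n (p : set (formula L ('I_n + B))) phi :
  complete_type j p -> p phi -> p (Not phi) -> False.
Proof.
move=> [pf _] p1 p2; have [||a Ha] := pf [set phi; Not phi].
- exact: finite_set2.
- by move=> _ [->|->].
- by have /sat_not := Ha _ (or_intror erefl); apply; apply: Ha; left.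
Qed.

End Complete.

Section Vars.
Variables (L : language) (U : structure L).

Definition vars B n k (f : 'I_n -> 'I_k) (p : set (formula L ('I_n + B))) :
  set (formula L ('I_k + B)) := rename (sum_map f id) @` p.

Lemma sat_vars (N : structure L) B (j : B -> N) n k (f : 'I_n -> 'I_k) c phi :
  sat (either c j) (rename (sum_map f id) phi) <-> sat (either (c \o f) j) phi.
Proof.
rewrite sat_rename; suff -> : either c j \o sum_map f id = either (c \o f) j by [].
by apply/funext => -[].
Qed.

Lemma realises_vars (N : structure L) B (j : B -> N) n k (f : 'I_n -> 'I_k)
    (p : set (formula L ('I_n + B))) c :
  realises j (vars f p) c <-> realises j p (c \o f).
Proof.
split=> [H phi pphi|H _ [phi pphi <-]]; last exact/sat_vars/H.
by apply/sat_vars/H; exists phi.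
Qed.

Lemma uses_vars (S : set U) n k (f : 'I_n -> 'I_k) (phi : formula L ('I_n + U)) :
  uses S phi -> uses S (rename (sum_map f id) phi).
Proof.
move=> [psi ->]; exists (rename (sum_map f id) psi); rewrite /Defs.over !rename_comp.
by congr rename; apply/funext => -[].
Qed.

Lemma realises_setU (N : structure L) B (j : B -> N) n (p q : set (formula L ('I_n + B))) c :
  realises j (p `|` q) c <-> realises j p c /\ realises j q c.
Proof.
split=> [H|[H H'] phi [/H|/H']//].
by split=> phi h; apply: H; [left|right].
Qed.

Lemma realises_over (S : set U) (N : structure L) (e : U -> N) n (r : set (formula L ('I_n + S))) c :
  realises e (@Defs.over L U S n @` r) c <-> realises (e \o @set_val U S) r c.
Proof.
have E (psi : formula L ('I_n + S)) : sat (either c e) (Defs.over psi) <-> sat (either c (e \o @set_val U S)) psi.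
  rewrite /Defs.over sat_rename.
  suff -> : either c e \o sum_map id (@set_val U S) = either c (e \o @set_val U S) by [].
  by apply/funext => -[].
split=> [H psi rpsi|H _ [psi rpsi <-]]; last exact/E/H.
by apply/E/H; exists psi.
Qed.

End Vars.

Section Monster.
Variables (K : Type) (L : language) (T : theory L) (U : structure L).
Hypothesis U_monster : monster K T U.

Let nat_small : small K [set: nat]. Proof. by case: U_monster => -[]. Qed.
Let K_limit : strong_limit K. Proof. by case: U_monster. Qed.
Let U_sat : saturated K U. Proof. by case: U_monster. Qed.
Let U_hom : strongly_homogeneous K U. Proof. by case: U_monster. Qed.
Implicit Types (S A : set U) (p q : gtype U).

(** The tuple may have repetitions or meet [S], so each element of [S :++ x] gets a chosen name;
    [eqv] shows that the choice does not matter. *)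
Lemma homogeneity (S : set U) n (x y : 'I_n -> U) : small K S ->
  (forall phi, uses S phi -> sat (either x id) phi <-> sat (either y id) phi) ->
  exists2 s, fixes S s & s \o x = y.
Proof.
move=> sS xy.
have {}xy (psi : formula L ('I_n + S)) :
    sat (either x (@set_val U S)) psi <-> sat (either y (@set_val U S)) psi.
  by rewrite -!sat_over; apply: xy; exists psi.
pose A := S `|` range x.
have sA : small K A by apply: smallU => //; exact: small_ord.
have ex (a : A) : exists c : 'I_n + S, either x (@set_val U S) c = set_val a.
  have [Sa|[i _ xi]] := set_mem (valP a); last by exists (inl i).
  by exists (inr (SigSub (mem_set Sa))).
have [g Hg] := choice ex.
have eqv (c c' : 'I_n + S) : either x (@set_val U S) c = either x (@set_val U S) c' ->
    either y (@set_val U S) c = either y (@set_val U S) c'.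
  by move=> H; have := xy (Eq (Var c) (Var c')) => /= -[+ _]; exact.
have [|s As Hs] := @U_hom A (fun a => either y (@set_val U S) (g a)) sA.
  move=> phi; have := xy (rename g phi); rewrite !sat_rename.
  by have -> : either x (@set_val U S) \o g = set_val; [apply/funext|].
have Hs' (c : 'I_n + S) : A (either x (@set_val U S) c) ->
    s (either x (@set_val U S) c) = either y (@set_val U S) c.
  move=> Ac; have := Hs (SigSub (mem_set Ac)) => /= ->; apply: eqv; exact: Hg.
exists s; last by apply/funext => i /=; apply: (Hs' (inl i)); right; exists i.
split=> // u Su; apply: (Hs' (inr (SigSub (mem_set Su)))); by left.
Qed.

(** Reflects tuples of elementary extensions into [U], so that later arguments can stay there. *)
Lemma type_realised_below (S : set U) (N : structure L) (e : U -> N) n (a : 'I_n -> N) :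
  small K S -> elementary e ->
  exists x : 'I_n -> U, forall phi, uses S phi ->
    sat (either a e) phi <-> sat (either x id) phi.
Proof.
move=> sS elem_e.
pose p : set (formula L ('I_n + S)) := [set psi | sat (either a e) (Defs.over psi)].
have [|x Hx] := @U_sat S sS n p.
  split=> [F /finite_list[s Fs] Fp|psi]; last exact: lem.
  have : sat id (ExN (Conj [seq Defs.over psi | psi <- s]) : formula L U).
    apply/elem_e/sat_exN; exists a; apply/sat_conj => phi /List.in_map_iff[psi [<- /Fs/Fp]].
    by [].
  move=> /sat_exN[x /sat_conj Hx]; exists x => psi /Fs Hpsi.
  by rewrite -sat_over; apply: Hx; apply: List.in_map.
exists x => _ [psi ->]; rewrite (sat_over x); split; first exact: Hx.
move=> Hpsi; apply: contrapT => nH; exact: (Hx (Not psi)).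
Qed.

Lemma saturation (S : set U) n (q : set (formula L ('I_n + U))) : small K S ->
  (forall s, (forall phi, List.In phi s -> q phi) ->
     exists x : 'I_n -> U, forall phi, List.In phi s -> sat (either x id) phi) ->
  exists x : 'I_n -> U, forall phi, uses S phi -> q phi -> sat (either x id) phi.
Proof.
move=> sS /compactness[N [e [a [elem_e Ha]]]].
have [x Hx] := type_realised_below a sS elem_e.
by exists x => phi uphi /Ha/Hx; exact.
Qed.

(** * Realisations of global types over small sets *)

Section Types.
Variables (n : nat) (p : set (formula L ('I_n + U))).
Hypothesis pc : complete_type (@id U) p.

Definition real_on (S : set U) (x : 'I_n -> U) :=
  forall phi, uses S phi -> p phi -> sat (either x id) phi.

Lemma type_list (s : seq (formula L ('I_n + U))) : (forall phi, List.In phi s -> p phi) ->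
  exists x : 'I_n -> U, forall phi, List.In phi s -> sat (either x id) phi.
Proof.
case: pc => pf _ sp; have [||x Hx] := pf [set phi | List.In phi s].
- elim: (s) => [|phi s' IH]; first exact: sub_finite_set (finite_set0 _).
  apply: (@sub_finite_set _ _ ([set phi] `|` [set psi | List.In psi s'])).
    by move=> psi [->|]; [left|right].
  by rewrite finite_setU; split=> //; exact: finite_set1.
- by move=> phi /sp.
- by exists x.
Qed.

Lemma real_ex S : small K S -> exists x, real_on S x.
Proof. by move=> sS; exact: saturation type_list. Qed.

Lemma real_onE S x phi : real_on S x -> uses S phi -> p phi <-> sat (either x id) phi.
Proof.
move=> Sx uphi; split; first exact: Sx.
move=> Hphi; case: (pc.2 phi) => // np.
by case: (Sx _ (uses_not uphi) np Hphi).
Qed.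

Lemma real_sub S S' x : S `<=` S' -> real_on S' x -> real_on S x.
Proof. by move=> SS' Sx phi /(uses_sub SS') /Sx. Qed.

Lemma real_conj S x y : small K S -> real_on S x -> real_on S y ->
  exists2 s, fixes S s & s \o x = y.
Proof.
move=> sS Sx Sy; apply: homogeneity => // phi uphi.
by rewrite -(real_onE Sx) // (real_onE Sy).
Qed.

Section Invariant.
Variable A : set U.
Hypothesis Ainv : invariant_over (@set_val U A) (@id U) p.

Lemma inv_rename s phi : fixes A s -> p phi <-> p (rename (sum_map id s) phi).
Proof.
move=> fs; have [u0] := dom_inh U; have [k [psi [t ->]]] := instP u0 phi.
have -> : rename (sum_map id s) (inst psi t) = inst psi (s \o t).
  by rewrite /inst rename_comp; congr rename; apply/funext => -[].
apply: Ainv => chi; rewrite -!sat_over.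
exact: iff_sym (sat_either_aut t fs (ex_intro _ chi erefl)).
Qed.

Lemma real_aut S x s : A `<=` S -> fixes A s -> real_on S x -> real_on (s @` S) (s \o x).
Proof.
move=> AS fs Sx phi [psi ->] pphi.
have [t [ft sK tK]] := fixes_inv fs.
have tS (u : s @` S : set U) : S (t (set_val u)).
  have : (s @` S) (set_val u) by exact: set_mem (valP u).
  by case=> v Sv <-; rewrite sK.
pose psi' := rename (sum_map id (fun u : s @` S : set U => SigSub (mem_set (tS u)) : S)) psi.
have e : Defs.over psi' = rename (sum_map id t) (Defs.over psi).
  by rewrite /Defs.over /psi' !rename_comp; congr rename; apply/funext => -[].
have := Sx (Defs.over psi'); rewrite e => /(_ (ex_intro _ psi' (esym e))).
rewrite -(inv_rename _ ft) => /(_ pphi); rewrite sat_rename.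
rewrite -(sat_aut _ _ fs.1); suff -> : s \o (either x id \o sum_map id t) = either (s \o x) id by [].
by apply/funext => -[//|u]; exact: tK.
Qed.

End Invariant.
End Types.

Section Complete.
Variables (n : nat) (q : set (formula L ('I_n + U))).
Hypothesis qc : complete_type (@id U) q.

Lemma type_transfer S (N : structure L) (e : U -> N) b y phi :
  realises e q b -> real_on q S y -> uses S phi ->
  sat (either b e) phi <-> sat (either y id) phi.
Proof.
move=> qb Sy uphi; rewrite -(real_onE qc Sy uphi); split; last exact: qb.
by move=> h; case: (qc.2 phi) => // /qb /sat_not.
Qed.

Lemma type_sat (N : structure L) (e : U -> N) b phi :
  realises e q b -> q phi <-> sat (either b e) phi.
Proof.
move=> qb; split; first exact: qb.
by move=> h; case: (qc.2 phi) => // /qb /sat_not.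
Qed.

Lemma type_elementary : exists (N : structure L) (e : U -> N) (b : 'I_n -> N),
  elementary e /\ realises e q b.
Proof. by have [N [e [b Hb]]] := compactness (type_list qc); exists N, e, b. Qed.

End Complete.

Lemma small_add S x : small K S -> small K (S :+ x).
Proof. by move=> sS; apply: smallU => //; apply: small_finite => //; exact: finite_set1. Qed.

Lemma smallU_list S l : small K S -> small K (S `|` [set x | List.In x l]).
Proof. by move=> sS; apply: smallU => //; exact: small_list. Qed.

Lemma def_of_uses S (phi : formula L ('I_1 + U)) : uses S phi ->
  definable1 (fun x => sat (either (fun=> x) id) phi) /\
  forall s x, fixes S s -> sat (either (fun=> x) id) phi -> sat (either (fun=> s x) id) phi.
Proof.
move=> uphi; split; first by exists phi.
by move=> s x fs; have [_] := sat_either_aut (fun=> x) fs uphi.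
Qed.

(** Otherwise the type of [x] over [S] is consistent with being different from [x], and by
    saturation and homogeneity some automorphism fixing [S] moves [x]. *)
Lemma dcl_isolated S x : small K S -> dcl S x -> exists phi : formula L ('I_1 + U),
  uses S phi /\ forall y : 'I_1 -> U, sat (either y id) phi <-> y ord0 = x.
Proof.
move=> sS Sx; apply: contrapT => H.
pose q phi := (uses S phi /\ sat (either (fun _ : 'I_1 => x) id) phi) \/
  phi = Not (Eq (Var (inl ord0)) (Var (inr x))).
have [|s sq|y Hy] := saturation (S := S :+ x) (q := q); first exact: small_add.
  have [phi [uphi phix Hphi]] : exists phi, [/\ uses S phi, sat (either (fun _ : 'I_1 => x) id) phi &
      forall y : 'I_1 -> U, y ord0 <> x -> sat (either y id) phi ->
      forall psi, List.In psi s -> sat (either y id) psi].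
    elim: s sq => [|psi s IH] sq.
      exists (Not Bot); split=> //; first by exists (Not Bot).
    have [|phi [[phi' ->] phix Hphi]] := IH; first by move=> ? ?; apply: sq; right.
    case: (sq psi (or_introl erefl)) => [[[psi' ->] psix]|->].
      exists (And (Defs.over psi') (Defs.over phi')); split.
      - by exists (And psi' phi').
      - by apply/sat_and.
      - by move=> y yx /sat_and[h h'] chi [<-//|]; exact: Hphi.
    exists (Defs.over phi'); split=> //; first by exists phi'.
    move=> y yx h chi [<-|]; last exact: Hphi.
    by apply/sat_not.
  apply: contrapT => H'; apply: H; exists phi; split=> // y; split=> [h|yx].
    by apply: contrapT => yx; apply: H'; exists y; exact: Hphi.
  by suff -> : y = fun=> x by []; apply/funext => i; rewrite ord1.
have [|s fs /(congr1 (fun f => f ord0)) /= e] :=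
    homogeneity (x := fun _ : 'I_1 => x) (y := y) sS.
  have uS phi : uses S phi -> uses (S :+ x) phi by apply: uses_sub => z; left.
  move=> phi uphi; split=> [h|h]; first by apply: Hy; [exact: uS|left].
  apply: contrapT => nh; suff /sat_not : sat (either y id) (Not phi) by [].
  by apply: Hy; [exact/uS/uses_not|left; split; [exact: uses_not|apply/sat_not]].
have Hq := Hy _ _ (or_intror erefl); suff /Hq /sat_not : uses (S :+ x) (Not (Eq (Var (inl ord0)) (Var (inr x))) : formula L ('I_1 + U)).
  by apply; rewrite /= -e; exact: Sx.
by exists (Not (Eq (Var (inl ord0)) (Var (inr (SigSub (mem_set (or_intror erefl : (S :+ x) x))))))).
Qed.

Lemma small_tuple S n (x : 'I_n -> U) : small K S -> small K (S :++ x).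
Proof. by move=> sS; apply: smallU => //; exact: small_ord. Qed.

Lemma uses_small n (phi : formula L ('I_n + U)) : exists2 S, small K S & uses S phi.
Proof. by have [s us] := uses_fin phi; exists [set u | List.In u s] => //; exact: small_list. Qed.

Lemma uses_small_list n (s : seq (formula L ('I_n + U))) :
  exists2 S, small K S & forall phi, List.In phi s -> uses S phi.
Proof.
elim: s => [|phi s [S sS HS]]; first by exists set0 => //; exact: small_finite.
have [S' sS' uphi] := uses_small phi; exists (S `|` S'); first exact: smallU.
move=> psi [<-|/HS h]; [apply: (uses_sub _ uphi)|apply: (uses_sub _ h)] => x; by [left|right].
Qed.

Lemma real_fix n (p : set (formula L ('I_n + U))) S x s :
  fixes S s -> real_on p S x -> real_on p S (s \o x).
Proof. move=> fs Sx phi uphi pphi; apply/(sat_either_aut x fs uphi); exact: Sx. Qed.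

(** A realisation over [S] and [S'] can be moved to [x] by an automorphism that fixes [S], and hence
    everything in [dcl S]. *)
Lemma real_dcl n (p : set (formula L ('I_n + U))) S S' x : complete_type (@id U) p ->
  small K S -> small K S' -> S' `<=` dcl S -> real_on p S x -> real_on p (S `|` S') x.
Proof.
move=> pc sS sS' SS' Sx; have sSS : small K (S `|` S') by exact: smallU.
have [x' Sx'] := real_ex pc sSS.
have [s fs <-] := real_conj pc sS (real_sub (@subsetUl _ S S') Sx') Sx.
apply: real_fix Sx'; split; first by case: fs.
by move=> z [Sz|/SS'/dcl_fixed]; [case: fs => _; exact|exact].
Qed.

Lemma real_move p A S Y x s : invariant_base K p A -> A `<=` S -> fixes S s ->
  real_on p (S `|` Y) x -> real_on p (S `|` s @` Y) (s \o x).
Proof.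
move=> [_ iA] AS fs Sx; have := real_aut iA (S := S `|` Y) (x := x) _ (fixes_sub AS fs) Sx.
move=> /(_ (fun z Az => or_introl (AS z Az))); apply: real_sub => z [Sz|[y Yy <-]].
  by exists z; [left|case: fs => _; exact].
by exists y => //; right.
Qed.

Lemma real_move_tuple p A S m (y : 'I_m -> U) x s : invariant_base K p A -> A `<=` S ->
  fixes S s -> real_on p (S :++ y) x -> real_on p (S :++ (s \o y)) (s \o x).
Proof.
move=> bA AS fs Sx; apply: real_sub (real_move bA AS fs Sx) => z [Sz|[i _ <-]]; first by left.
by right; exists (y i) => //; exists i.
Qed.

Lemma base_sub p A A' : A `<=` A' -> small K A' -> invariant_base K p A -> invariant_base K p A'.
Proof.
move=> AA' sA' [_ iA]; split=> // m phi a b eq; apply: iA => chi.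
have := eq (rename (sum_map id (set_incl AA')) chi); rewrite !sat_rename.
have E (c : 'I_m -> U) : either (id \o c) (@set_val U A') \o sum_map id (set_incl AA') =
    either (id \o c) (@set_val U A).
  by apply/funext => -[].
by rewrite !E.
Qed.

Lemma joint_base p q : Sinv K p -> Sinv K q -> exists A,
  [/\ small K A, invariant_base K p A & invariant_base K q A].
Proof.
move=> [_ [A bA]] [_ [B bB]]; have sAB : small K (A `|` B) by apply: smallU => //; [case: bA|case: bB].
exists (A `|` B); split; first exact: sAB.
  exact: base_sub (@subsetUl _ A B) sAB bA.
exact: base_sub (@subsetUr _ A B) sAB bB.
Qed.

(* A global type is given by its sets [G S] of realisations over small sets [S]. *)
Lemma type_of_generic p A (G : set U -> ('I_(gdim p) -> U) -> Prop) : small K A ->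
  (forall S, small K S -> A `<=` S -> exists z, G S z) ->
  (forall S s z, A `<=` S -> fixes A s -> G S z -> G (s @` S) (s \o z)) ->
  (forall S phi z, small K S -> A `<=` S -> G S z -> uses S phi ->
     gset p phi <-> sat (either z id) phi) ->
  [/\ complete_type (@id U) p, invariant_base K p A &
      forall S z, small K S -> A `<=` S -> real_on p S z <-> G S z].
Proof.
move=> sA Gex Gaut GP.
have pc : complete_type (@id U) p.
  split=> [F /finite_list[s Fs] Fp|phi].
    have [S sS us] := uses_small_list s.
    have sSA : small K (S `|` A) by exact: smallU.
    have [z Gz] := Gex _ sSA (@subsetUr _ S A).
    exists z => phi Fphi.
    have u1 : uses (S `|` A) phi by apply: uses_sub (us _ (proj1 (Fs _) Fphi)); exact: subsetUl.
    exact/(GP _ _ _ sSA (@subsetUr _ S A) Gz u1)/Fp.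
  have [S sS us] := uses_small phi.
  have sSA : small K (S `|` A) by exact: smallU.
  have [z Gz] := Gex _ sSA (@subsetUr _ S A).
  have u1 : uses (S `|` A) phi by apply: uses_sub us; exact: subsetUl.
  have AS := @subsetUr _ S A.
  rewrite (GP _ _ _ sSA AS Gz u1) (GP _ _ _ sSA AS Gz (uses_not u1)) sat_not.
  exact: lem.
have GR S z : small K S -> A `<=` S -> G S z -> real_on p S z.
  by move=> sS AS Gz phi uphi; have [] := GP S phi z sS AS Gz uphi.
split=> // [|S z sS AS].
  split=> // m phi a b eq.
  have [|s fs <-] := homogeneity (x := a) (y := b) sA.
    by move=> _ [psi ->]; rewrite !sat_over.
  have sS : small K (A :++ a) by exact: small_tuple.
  have AS := @subsetUl _ A (range a).
  have [z Gz] := Gex _ sS AS.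
  have u1 : uses (A :++ a) (inst phi a) by apply: usesP => i; right; exists i.
  have u2 : uses (s @` (A :++ a)) (inst phi (s \o a)).
    by apply: usesP => i; exists (a i) => //; right; exists i.
  have AsS : A `<=` s @` (A :++ a) by move=> y Ay; exists y; [left|case: fs => _; exact].
  rewrite (GP _ _ _ sS AS Gz u1) (GP _ _ _ (small_image _ sS) AsS (Gaut _ _ _ AS fs Gz) u2).
  have -> : inst phi (s \o a) = rename (sum_map id s) (inst phi a).
    by rewrite /inst rename_comp; congr rename; apply/funext => -[].
  rewrite [X in _ <-> X]sat_rename -(sat_aut (either z id) (inst phi a) fs.1).
  suff -> : s \o either z id = either (s \o z) id \o sum_map id s by [].
  by apply/funext => -[].
split=> [Sz|]; last exact: GR.
have [z' Gz'] := Gex _ sS AS.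
have [s fs <-] := real_conj pc sS (GR _ _ sS AS Gz') Sz.
have := Gaut _ _ _ AS (fixes_sub AS fs) Gz'.
suff -> : s @` S = S by [].
apply/predeqP => x; split=> [[y Sy <-]|Sx]; first by case: fs => _ ->.
by exists x => //; case: fs => _ ->.
Qed.

(** * Products of types *)

(** The expected realisations of the product; [tensor_type] shows that over small sets containing a
    common base they are the actual ones. *)
Definition generic p q S (z : 'I_(gdim p + gdim q) -> U) :=
  real_on (gset q) S (rpart z) /\ real_on (gset p) (S :++ rpart z) (lpart z).

Lemma gen_sub p q S S' z : S `<=` S' -> @generic p q S' z -> @generic p q S z.
Proof.
move=> SS' [zr zl]; split; first exact: real_sub zr.
by apply: real_sub zl => x [/SS'|]; [left|right].
Qed.

Lemma gen_ex p q S : complete_type (@id U) (gset p) -> complete_type (@id U) (gset q) ->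
  small K S -> exists z, @generic p q S z.
Proof.
move=> pc qc sS; have [y Sy] := real_ex qc sS.
have [x Sx] := real_ex pc (small_tuple y sS).
by exists (join x y); split; rewrite rpart_join ?lpart_join.
Qed.

Lemma gen_conj p q A S z z' : complete_type (@id U) (gset p) -> complete_type (@id U) (gset q) ->
  small K S -> invariant_base K p A -> A `<=` S -> @generic p q S z -> @generic p q S z' ->
  exists2 s, fixes S s & s \o z = z'.
Proof.
move=> pc qc sS bA AS [zr zl] [z'r z'l].
have [s fs sz] := real_conj qc sS zr z'r.
have := real_move_tuple bA AS fs zl; rewrite sz => Sx.
have [t [At ft] tz] := real_conj pc (small_tuple _ sS) Sx z'l.
exists (t \o s).
  by apply: fixes_comp => //; split=> // x Sx'; apply: ft; left.
apply: parts_inj; first exact: tz.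
rewrite -[RHS](_ : t \o rpart z' = rpart z'); first by rewrite -sz.
by apply/funext => i /=; apply: ft; right; exists i.
Qed.

Lemma gen_aut p q A S s z : invariant_base K p A -> invariant_base K q A -> A `<=` S ->
  fixes A s -> @generic p q S z -> @generic p q (s @` S) (s \o z).
Proof.
move=> [_ ip] [_ iq] AS fs [zr zl]; split; first by have := real_aut iq AS fs zr.
have := real_aut ip (S := S :++ rpart z) (fun x Ax => or_introl (AS x Ax)) fs zl.
by apply: real_sub => x [[y Sy <-]|[i _ <-]]; [exists y => //; left|exists (rpart z i) => //; right; exists i].
Qed.

Definition subst_right n m (y : 'I_m -> U) (phi : formula L ('I_n + ('I_m + U))) :=
  rename (sum_map id (either y id)) phi.

Lemma sat_subst_split n m (z : 'I_(n + m) -> U) (phi : formula L ('I_(n + m) + U)) :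
  sat (either (lpart z) id) (subst_right (rpart z) (rename (@split_vars L U n m) phi)) <->
  sat (either z id) phi.
Proof.
rewrite !sat_rename; suff -> : (either (lpart z) id \o sum_map id (either (rpart z) id)) \o
    @split_vars L U n m = either z id by [].
apply/funext => -[i|//]; rewrite -[in RHS](join_parts z) /= /join.
by case: fintype.split.
Qed.

(** * The invariant extension to a realisation of the second factor *)

Section Extension.
Variables (p q : gtype U).
Hypotheses (pc : complete_type (@id U) (gset p)) (qc : complete_type (@id U) (gset q)).
Variables (N : structure L) (e : U -> N) (b : 'I_(gdim q) -> N).
Hypotheses (eN : elementary e) (qb : realises e (gset q) b).
Variable A : set U.
Hypothesis bA : invariant_base K p A.

(** Names for [b] may be evaluated at a tuple [y] of [U] realising [q] over the other parameters,
    without changing the type over [A]. *)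
Let transfer S k (a : 'I_k -> 'I_(gdim q) + U) y : real_on (gset q) S y ->
  A `<=` S -> (forall i u, a i = inr u -> S u) -> forall chi : formula L ('I_k + A),
  sat (either (either b e \o a) (e \o @set_val U A)) chi <->
  sat (either (either y id \o a) (@set_val U A)) chi.
Proof.
move=> Sy AS aS chi.
pose th : formula L ('I_(gdim q) + U) := rename (either a (inr \o @set_val U A)) chi.
have uth : uses S th.
  have H c : exists d : 'I_(gdim q) + S, sum_map id (@set_val U S) d = either a (inr \o @set_val U A) c.
    case: c => [i|x] /=; last first.
      have Sx : S (set_val x) by apply: AS; exact: set_mem (valP x).
      by exists (inr (SigSub (mem_set Sx))).
    case ai : (a i) => [j|u]; first by exists (inl j).
    by exists (inr (SigSub (mem_set (aS i u ai)))).
  have [f Hf] := choice H; exists (rename f chi).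
  by rewrite /Defs.over rename_comp; congr rename; apply/funext => c /=; rewrite -Hf.
have := type_transfer qc qb Sy uth; rewrite !sat_rename.
have -> : either b e \o either a (inr \o @set_val U A) =
  either (either b e \o a) (e \o @set_val U A) by apply/funext => -[].
by have -> : either y id \o either a (inr \o @set_val U A) =
  either (either y id \o a) (@set_val U A) by apply/funext => -[].
Qed.

(** A formula mentions finitely many parameters, so by invariance over [A] the tuple [b] can be
    replaced by one of [U] that realises [q] over them; on formulas over [U] the extension [r]
    agrees with [p]. *)
Lemma extension_sat (r : set (formula L ('I_(gdim p) + ('I_(gdim q) + U)))) S phi z :
  complete_type (either b e) r -> invariant_over (e \o @set_val U A) (either b e) r ->
  (forall psi, gset p psi -> r (rename (sum_map id inr) psi)) ->
  small K S -> uses S phi -> A `<=` S -> @generic p q S z ->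
  r (rename (@split_vars L U _ _) phi) <-> sat (either z id) phi.
Proof.
move=> rc ri rp sS uphi AS Gz; have [u0] := dom_inh U.
have [k [psi [t et]]] := instP (inr u0) (rename (@split_vars L U _ _) phi).
(* The elements of [U] among the parameters; slots that name [b] receive the dummy value [u0]. *)
pose ut := either (fun=> u0) id \o t.
have sS' := small_tuple ut sS.
have [z' Gz'] := gen_ex pc qc sS'.
have [s fs <-] := gen_conj pc qc sS bA AS (gen_sub (@subsetUl _ _ _) Gz') Gz.
rewrite (sat_either_aut _ fs uphi) -sat_subst_split et; move: Gz' => [z'r z'l].
have AS' : A `<=` S :++ ut by move=> x /AS; left.
have tS' i u : t i = inr u -> (S :++ ut) u by move=> ti; right; exists i; rewrite // /ut /= ti.
have E : subst_right (rpart z') (inst psi t) = inst psi (either (rpart z') id \o t).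
  by rewrite /inst /subst_right rename_comp; congr rename; apply/funext => -[].
have u1 : uses (S :++ ut :++ rpart z') (subst_right (rpart z') (inst psi t)).
  rewrite E; apply: usesP => i /=; case ti : (t i) => [j|u] /=; first by right; exists j.
  by left; exact: tS' ti.
rewrite -(real_onE pc z'l u1) E.
have -> : r (inst psi t) <-> r (inst psi (inr \o (either (rpart z') id \o t))).
  apply: ri => chi; rewrite (transfer z'r AS' tS').
  have -> : either (either b e \o (inr \o (either (rpart z') id \o t))) (e \o @set_val U A) =
    e \o either (either (rpart z') id \o t) (@set_val U A) by apply/funext => -[].
  by rewrite elementary_sat.
have {}E c : rename (sum_map id inr) (inst psi c) = inst psi (inr \o c) :> formula L (_ + ('I_(gdim q) + U)).
  by rewrite /inst rename_comp; congr rename; apply/funext => -[].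
split=> [h|/rp]; last by rewrite E.
case: (pc.2 (inst psi (either (rpart z') id \o t))) => // /rp np.
by case: (complete_not rc h); rewrite -E.
Qed.

(** A formula is put into the extension if [p] contains it with [y] in place of [b], for all [y]
    realising [q] over some small set. Invariance of [p] makes the answer independent of [y]. *)
Lemma extension_ex : exists r : set (formula L ('I_(gdim p) + ('I_(gdim q) + U))),
  [/\ complete_type (either b e) r, invariant_over (e \o @set_val U A) (either b e) r &
   forall psi, gset p psi -> r (rename (sum_map id inr) psi)].
Proof.
have sA := bA.1.
pose r : set (formula L ('I_(gdim p) + ('I_(gdim q) + U))) := [set psi | exists S,
  small K S /\ forall y, real_on (gset q) S y -> gset p (subst_right y psi)].
exists r; split; first split.
- move=> F /finite_list[l Fl] Fr.
  have [S [sS HS]] : exists S, small K S /\ forall y, real_on (gset q) S y ->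
      forall psi, List.In psi l -> gset p (subst_right y psi).
    have {Fl Fr} : forall psi, List.In psi l -> r psi by move=> psi /Fl/Fr.
    elim: l => [|psi l IH] lr; first by exists set0; split=> //; exact: small_finite.
    have [|S [sS HS]] := IH; first by move=> ? ?; apply: lr; right.
    have [S' [sS' HS']] := lr psi (or_introl erefl).
    exists (S `|` S'); split=> [|y Sy chi [<-|]]; first exact: smallU.
      by apply: HS'; apply: real_sub Sy; exact: subsetUr.
    by apply: HS; apply: real_sub Sy; exact: subsetUl.
  pose th := ExN (Conj l).
  have [S' sS' uth] := uses_small th.
  have [y Sy] := real_ex qc (smallU nat_small K_limit sS sS').
  have : sat (either y id) th.
    apply/sat_exN; have [|x Hx] := type_list pc (s := [seq subst_right y psi | psi <- l]).
      move=> phi /List.in_map_iff[psi [<- psil]]; apply: HS => //.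
      by apply: real_sub Sy; exact: subsetUl.
    exists x; apply/sat_conj => psi psil; have := Hx _ (List.in_map _ _ _ psil).
    rewrite sat_rename; suff -> : either x id \o sum_map id (either y id) = either x (either y id) by [].
    by apply/funext => -[].
  have Sy' : real_on (gset q) S' y by apply: real_sub Sy; exact: subsetUr.
  rewrite -(type_transfer qc qb Sy' uth) => /sat_exN[a /sat_conj Ha].
  by exists a => psi /Fl/Ha.
- move=> psi; have [u0] := dom_inh U; have [l Hl] := support psi.
  pose S := A `|` [set u | List.In (inr (inr u)) l].
  have sS : small K S.
    apply: smallU => //.
    apply: (@small_sub _ _ _ ((fun c => if c is inr (inr u) then u else u0) @` [set c | List.In c l])).
      by move=> u ul; exists (inr (inr u)).
    by apply: small_image; exact: small_list.
  have key chi y y' : (chi = psi \/ chi = Not psi) -> real_on (gset q) S y -> real_on (gset q) S y' ->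
      gset p (subst_right y chi) -> gset p (subst_right y' chi).
    move=> echi Sy Sy'; have [s fs <-] := real_conj qc sS Sy Sy'.
    rewrite (inv_rename bA.2 _ (fixes_sub (@subsetUl _ _ _) fs)).
    suff -> : rename (sum_map id s) (subst_right y chi) = subst_right (s \o y) chi by [].
    have H : rename (sum_map id s) (subst_right y psi) = subst_right (s \o y) psi.
      rewrite /subst_right rename_comp; apply: Hl => -[i|[j|u]] //= ul; congr inr.
      by case: fs => _; apply; right.
    by case: echi => -> //; rewrite /subst_right /= in H *; rewrite H.
  have [y Sy] := real_ex qc sS.
  case: (pc.2 (subst_right y psi)) => py; [left|right]; exists S; split=> // y' Sy'.
    by apply: key Sy Sy' py; left.
  by apply: (key (Not psi) y) => //; right.
- move=> k psi a a' eq.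
  suff {a a' eq} key a a' : equiv_over (e \o @set_val U A) (either b e \o a) (either b e \o a') ->
      r (inst psi a) -> r (inst psi a').
    by split; apply: key => // chi; rewrite eq.
  move=> eq [S [sS HS]]; have [u0] := dom_inh U.
  pose ua := either (fun=> u0) id \o a; pose ua' := either (fun=> u0) id \o a'.
  have sS' : small K ((S `|` A) :++ ua :++ ua').
    by do 2!apply: small_tuple; exact: smallU.
  exists ((S `|` A) :++ ua :++ ua'); split=> // y Sy.
  have aS i u : a i = inr u -> ((S `|` A) :++ ua :++ ua') u.
    by move=> ai; left; right; exists i; rewrite // /ua /= ai.
  have aS' i u : a' i = inr u -> ((S `|` A) :++ ua :++ ua') u.
    by move=> ai; right; exists i; rewrite // /ua' /= ai.
  have AS : A `<=` ((S `|` A) :++ ua :++ ua') by move=> x Ax; left; left; right.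
  have E c : subst_right y (inst psi c) = inst psi (either y id \o c).
    by rewrite /inst /subst_right rename_comp; congr rename; apply/funext => -[].
  rewrite E; apply/(bA.2 _ psi (either y id \o a)).
    by move=> chi; rewrite -(transfer Sy AS aS) -(transfer Sy AS aS').
  by rewrite -E; apply: HS; apply: real_sub Sy => x Sx; do 3!left.
- move=> psi ppsi; exists set0; split=> [|y _]; first exact: small_finite.
  rewrite /subst_right rename_comp.
  suff -> : sum_map id (either y id) \o sum_map id inr = @id ('I_(gdim p) + U) by rewrite rename_id.
  by apply/funext => -[].
Qed.

End Extension.

(** [tensor] allows any realisation of [q], any base and any extension; all of these choices yield
    the formulas true at generic tuples. *)
Lemma tensor_sat p q A S phi z : Sinv K p -> complete_type (@id U) (gset q) ->
  invariant_base K p A -> small K S -> A `<=` S -> uses S phi -> @generic p q S z ->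
  gset (tensor K p q) phi <-> sat (either z id) phi.
Proof.
move=> [pc _] qc bA sS AS uphi Gz; split=> [[N [e [b [eN qb [A' [bA' [r [rc ri rp rphi]]]]]]]]|sphi].
  have sS' : small K (S `|` A') by apply: smallU => //; case: bA'.
  have [z' Gz'] := gen_ex pc qc sS'.
  have := extension_sat pc qc eN qb bA' rc ri rp sS' (uses_sub (@subsetUl _ _ _) uphi)
    (@subsetUr _ _ _) Gz'.
  have [s fs <-] := gen_conj pc qc sS bA AS (gen_sub (@subsetUl _ _ _) Gz') Gz.
  by rewrite (sat_either_aut _ fs uphi) => -[+ _]; exact.
have [N [e [b [eN qb]]]] := type_elementary qc.
exists N, e, b; split=> //; exists A; split=> //.
have [r [rc ri rp]] := extension_ex pc qc qb bA; exists r; split=> //.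
exact/(extension_sat pc qc eN qb bA rc ri rp sS uphi AS Gz).
Qed.

Lemma tensor_type p q A : Sinv K p -> Sinv K q ->
  invariant_base K p A -> invariant_base K q A ->
  [/\ complete_type (@id U) (gset (tensor K p q)), invariant_base K (tensor K p q) A &
   forall S z, small K S -> A `<=` S -> real_on (gset (tensor K p q)) S z <-> @generic p q S z].
Proof.
move=> ip iq bp bq; have [pc _] := ip; have [qc _] := iq.
apply: (type_of_generic (p := tensor K p q) (G := @generic p q) bp.1).
- by move=> S sS AS; exact: (gen_ex pc qc).
- by move=> S s z AS fs; exact: (gen_aut bp bq).
- by move=> S phi z sS AS Gz uphi; exact: (tensor_sat ip qc bp sS AS uphi Gz).
Qed.

Lemma Sinv_tensor p q : Sinv K p -> Sinv K q -> Sinv K (tensor K p q).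
Proof.
move=> ip iq; have [A [sA bp bq]] := joint_base ip iq.
by have [c b _] := tensor_type ip iq bp bq; split=> //; exists A.
Qed.

Lemma real_below S (N : structure L) (e : U -> N) k (c : 'I_k -> N) :
  small K S -> elementary e -> exists z : 'I_k -> U,
    (forall phi, uses S phi -> sat (either c e) phi <-> sat (either z id) phi) /\
    forall n (f : 'I_n -> 'I_k) (p : set (formula L ('I_n + U))), realises e p (c \o f) -> real_on p S (z \o f).
Proof.
move=> sS eN; have [z Hz] := type_realised_below c sS eN; exists z; split=> // n f p pc phi uphi pphi.
by rewrite -sat_vars -Hz ?sat_vars; [exact: pc|exact: uses_vars].
Qed.

(* Finitely many formulas of [p] only see a small parameter set. *)
Lemma finite_real n k (f : 'I_n -> 'I_k) (p : set (formula L ('I_n + U)))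
    (Q : set (formula L ('I_k + U))) s :
  (forall psi, List.In psi s -> vars f p psi \/ Q psi) ->
  exists2 S, small K S & forall c : 'I_k -> U, real_on p S (c \o f) ->
    (forall psi, List.In psi s -> Q psi -> sat (either c id) psi) ->
    forall psi, List.In psi s -> sat (either c id) psi.
Proof.
elim: s => [|psi s IH] H; first by exists set0 => //; exact: small_finite.
have [|S sS HS] := IH; first by move=> ? ?; apply: H; right.
case: (H psi (or_introl erefl)) => [[phi pphi <-]|Qpsi]; last first.
  exists S => // c Sc Hc chi [<-|]; first by apply: Hc => //; left.
  by apply: HS => // ? ?; apply: Hc; right.
have [S' sS' u] := uses_small phi.
exists (S `|` S'); first exact: smallU.
move=> c Sc Hc chi [<-|]; last first.
  apply: HS => [|? ?]; last by apply: Hc; right.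
  by apply: real_sub Sc; exact: subsetUl.
by apply/sat_vars; apply: Sc => //; apply: uses_sub u; exact: subsetUr.
Qed.

(** * Domination in terms of realisations *)

Section Entails.
Variables (n m k : nat) (f : 'I_n -> 'I_k) (g : 'I_m -> 'I_k).

(** Otherwise compactness yields a tuple in an extension that satisfies [p] and [r] but not [phi]: a
    finite part of [p] sees a small set only, and [z] can be moved over [S] so as to realise [p]
    over that set too. *)
Lemma entails_real (p : set (formula L ('I_n + U))) (q' : set (formula L ('I_m + U)))
    A0 (r : set (formula L ('I_k + A0))) A z :
  complete_type (@id U) p -> A0 `<=` A ->
  realises (@set_val U A0) r z ->
  entails (vars f p `|` @Defs.over L U A0 k @` r) (vars g q') ->
  forall S, small K S -> A `<=` S -> real_on p S (z \o f) -> real_on q' S (z \o g).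
Proof.
move=> pc AA rz ent S sS AS Sz phi uphi qphi; apply: contrapT => nphi.
have [s Hs|N [e [c [eN Hc]]]] := @compactness L U 'I_k
    (vars f p `|` @Defs.over L U A0 k @` r `|` [set Not (rename (sum_map g id) phi)]).
  have [|S' sS' HS'] := @finite_real n k f p
    (@Defs.over L U A0 k @` r `|` [set Not (rename (sum_map g id) phi)]) s.
    by move=> psi /Hs [[]|]; [left|right; left|right; right].
  have [x' Sx'] := real_ex pc (smallU nat_small K_limit sS sS').
  have [t ft tz] := real_conj pc sS Sz (real_sub (@subsetUl _ _ _) Sx').
  exists (t \o z); apply: HS'.
    by rewrite -compA tz; apply: real_sub Sx'; exact: subsetUr.
  move=> psi _ [[chi rchi <-]|->].
    have [_] := sat_either_aut (S := S) z ft (uses_sub (subset_trans AA AS) (ex_intro _ chi erefl)).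
    by apply; apply/sat_over/rz.
  apply/sat_not => /sat_vars; rewrite -compA.
  by rewrite (sat_either_aut _ ft uphi).
have : realises e (vars g q') c by apply: ent => // psi h; apply: Hc; left.
move=> /realises_vars/(_ _ qphi) h; have /sat_not := Hc _ (or_intror erefl).
by rewrite sat_vars.
Qed.

(** A tuple of an elementary extension is reflected into [U] over the parameters of [phi]; its
    reflection is conjugate to [z] over [A], where the hypothesis applies. *)
Lemma realises_entails (p : set (formula L ('I_n + U))) (q : set (formula L ('I_m + U))) A
    (r : set (formula L ('I_k + A))) z :
  small K A -> invariant_over (@set_val U A) (@id U) p -> invariant_over (@set_val U A) (@id U) q ->
  (forall psi, r psi <-> sat (either z (@set_val U A)) psi) ->
  (forall S, small K S -> A `<=` S -> real_on p S (z \o f) -> real_on q S (z \o g)) ->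
  entails (vars f p `|` @Defs.over L U A k @` r) (vars g q).
Proof.
move=> sA ip iq rz H N e c eN /realises_setU[/realises_vars cp /realises_over cr].
apply/realises_vars => phi qphi; have [S0 sS0 u] := uses_small phi.
have sS := smallU nat_small K_limit sA sS0.
have {}u : uses (A `|` S0) phi by apply: uses_sub u; exact: subsetUr.
have [z' [Hz' Hr]] := real_below c sS eN.
rewrite -sat_vars Hz' ?sat_vars; last exact: uses_vars.
have [|s fs zz'] := homogeneity (x := z) (y := z') sA.
  move=> _ [psi ->]; rewrite -Hz'; last by apply: (uses_sub (@subsetUl _ _ _)); exists psi.
  have E : sat (either c e) (Defs.over psi) <-> sat (either c (e \o @set_val U A)) psi.
    rewrite /Defs.over sat_rename.
    suff -> : either c e \o sum_map id (@set_val U A) = either c (e \o @set_val U A) by [].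
    by apply/funext => -[].
  rewrite E sat_over; split=> [/rz/cr//|h].
  by apply: contrapT => nh; have /sat_not := cr (Not psi) (proj2 (rz (Not psi)) nh).
have [t [ft sK tK]] := fixes_inv fs.
have tz' : t \o z' = z by rewrite -zz'; apply/funext => i /=; rewrite sK.
have At : A `<=` t @` (A `|` S0) by move=> x Ax; exists x; [left|case: ft => _; exact].
have St := small_image t sS.
have := real_aut ip (@subsetUl _ A S0) ft (Hr _ f _ cp).
rewrite [t \o _](_ : _ = z \o f); last by rewrite -tz'.
move=> /(H _ St At) /(real_aut iq At fs).
rewrite [s \o _](_ : _ = z' \o g); last by rewrite -zz'.
apply=> //; apply: uses_sub u => x Sx; exists (t x); [by exists x|exact: tK].
Qed.

End Entails.

(** Invariance of both types over [A] is part of the definition, so that witnesses can be moved by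
    automorphisms and [A] can be enlarged. *)
Definition dom_at p q A x y := [/\ invariant_base K p A, invariant_base K q A,
  real_on (gset p) A x & forall S, small K S -> A `<=` S ->
    real_on (gset p) S x -> real_on (gset q) S y].

Arguments dom_at p q A x y : clear implicits.

Definition equi_at p q A x y := dom_at p q A x y /\ dom_at q p A y x.

Arguments equi_at p q A x y : clear implicits.

Lemma dom_real p q A x y : dom_at p q A x y -> real_on (gset q) A y.
Proof. by move=> [[sA _] _ Ax]; exact. Qed.

Lemma dom_move p q A x y s : dom_at p q A x y -> fixes A s -> dom_at p q A (s \o x) (s \o y).
Proof.
move=> [bp bq Ax H] fs; split=> // [|S sS AS Sx]; first exact: real_fix.
have [t [ft sK tK]] := fixes_inv fs.
have AtS : A `<=` t @` S by move=> z Az; exists z; [exact: AS|case: ft => _; exact].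
have := real_aut bp.2 AS ft Sx; rewrite [t \o _](_ : _ = x); last first.
  by apply/funext => i /=; rewrite sK.
move=> /(H _ (small_image _ sS) AtS)/(real_aut bq.2 AtS fs); apply: real_sub => z Sz.
by exists (t z); [exists z|exact: tK].
Qed.

Lemma dom_up p q A A' x y : A `<=` A' -> small K A' -> real_on (gset p) A' x ->
  dom_at p q A x y -> dom_at p q A' x y.
Proof.
move=> AA' sA' A'x [bp bq Ax H]; split=> //; [exact: base_sub bp|exact: base_sub bq|].
by move=> S sS AS; apply: H => //; exact: subset_trans AS.
Qed.

Lemma dom_enlarge p q A A' x y x' : complete_type (@id U) (gset p) -> A `<=` A' -> small K A' ->
  real_on (gset p) A' x' -> dom_at p q A x y ->
  exists s, [/\ fixes A s, s \o x = x' & dom_at p q A' x' (s \o y)].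
Proof.
move=> pc AA' sA' A'x' d; have [[sA _] _ Ax _] := d.
have [s fs sx] := real_conj pc sA Ax (real_sub AA' A'x').
exists s; split=> //; rewrite -sx; apply: dom_up (dom_move d fs) => //.
by rewrite sx.
Qed.

Lemma equi_enlarge p q A A' x y x' : complete_type (@id U) (gset p) -> A `<=` A' -> small K A' ->
  real_on (gset p) A' x' -> equi_at p q A x y ->
  exists s, [/\ fixes A s, s \o x = x' & equi_at p q A' x' (s \o y)].
Proof.
move=> pc AA' sA' A'x' [d d']; have [s [fs sx ds]] := dom_enlarge pc AA' sA' A'x' d.
exists s; split=> //; split=> //; rewrite -sx; apply: dom_up (dom_move d' fs) => //.
exact: dom_real ds.
Qed.

Lemma dom_at_trans p q r A B x y y' z : complete_type (@id U) (gset p) ->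
  complete_type (@id U) (gset q) -> dom_at p q A x y -> dom_at q r B y' z ->
  exists x' z', dom_at p r (A `|` B) x' z'.
Proof.
move=> pc qc d d'; have sAB : small K (A `|` B).
  by apply: smallU => //; [case: d => -[]|case: d' => -[]].
have [x' Ax'] := real_ex pc sAB.
have [s [fs _ ds]] := dom_enlarge pc (@subsetUl _ A B) sAB Ax' d.
have [t [ft _ dt]] := dom_enlarge qc (@subsetUr _ A B) sAB (dom_real ds) d'.
exists x', (t \o z); case: ds dt => [? ? ? H] [? ? ? H']; split=> // S sS AS Sx.
by apply: H' => //; exact: H.
Qed.

Lemma equi_at_trans p q r A B x y y' z : complete_type (@id U) (gset p) ->
  complete_type (@id U) (gset q) -> equi_at p q A x y -> equi_at q r B y' z ->
  exists x' z', equi_at p r (A `|` B) x' z'.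
Proof.
move=> pc qc d d'; have sAB : small K (A `|` B).
  by apply: smallU => //; [case: d => -[[]]|case: d' => -[[]]].
have [x' Ax'] := real_ex pc sAB.
have [s [fs _ ds]] := equi_enlarge pc (@subsetUl _ A B) sAB Ax' d.
have [t [ft _ dt]] := equi_enlarge qc (@subsetUr _ A B) sAB (dom_real ds.1) d'.
exists x', (t \o z); case: ds dt => [[? ? ? H1] [? ? ? H2]] [[? ? ? H3] [? ? ? H4]].
by split; split=> // S sS AS; [move/H1 => h; apply: H3; auto|move/H4 => h; apply: H2; auto].
Qed.

Section Pair.
Variables p q : gtype U.
Hypotheses (ip : Sinv K p) (iq : Sinv K q).

Let link_real A r : @link K L U p q A r -> exists B z,
  [/\ small K B, A `<=` B, invariant_base K p B, invariant_base K q B &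
   realises (@set_val U A) r z /\ real_on (gset p) B (lpart z)].
Proof.
move=> [sA rc pr _]; have [pc _] := ip; have [B [sB bp bq]] := joint_base ip iq.
have sAB := smallU nat_small K_limit sA sB.
have [z0 rz0] : exists z0, realises (@set_val U A) r z0 by case: U_monster => _ _ _ /(_ A sA _ r rc).
have [x Bx] := real_ex pc sAB.
have Az0 : real_on (gset p) A (lpart z0).
  move=> _ [psi ->] ppsi; apply/sat_over/sat_vars/rz0/pr.
  by exists psi.
have [s fs sz] := real_conj pc sA Az0 (real_sub (@subsetUl _ A B) Bx).
exists (A `|` B), (s \o z0); split=> //.
- exact: base_sub bp.
- exact: base_sub bq.
split=> [psi rpsi|]; last by rewrite [lpart _](_ : _ = x) // -sz.
apply/sat_over; apply/(sat_either_aut z0 fs (ex_intro _ psi erefl)).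
exact/sat_over/rz0.
Qed.

Let type_link A x y : invariant_base K p A -> real_on (gset p) A x -> real_on (gset q) A y ->
  @link K L U p q A [set psi | sat (either (join x y) (@set_val U A)) psi].
Proof.
move=> [sA _] Ax Ay; split=> //.
- split=> [F _ HF|phi]; last exact: lem.
  by exists (join x y) => phi /HF.
- move=> _ [psi ppsi <-]; apply/sat_vars/sat_over.
  by have := lpart_join x y; rewrite /lpart => ->; apply: Ax => //; exists psi.
- move=> _ [psi ppsi <-]; apply/sat_vars/sat_over.
  by have := rpart_join x y; rewrite /rpart => ->; apply: Ay => //; exists psi.
Qed.

Lemma dominatesP : dominates K p q <-> exists A x y, dom_at p q A x y.
Proof.
have [pc _] := ip; split=> [[A [r [lk ent]]]|[A [x [y d]]]].
  have [B [z [sB AB bp bq [rz Bz]]]] := link_real lk.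
  exists B, (lpart z), (rpart z); split=> //.
  exact: (entails_real (f := @lshift _ _) (g := @rshift _ _) pc AB rz ent).
have [bp bq Ax H] := d; exists A; eexists; split; first exact: type_link bp Ax (dom_real d).
apply: (realises_entails (f := @lshift _ _) (g := @rshift _ _) bp.1 bp.2 bq.2 (z := join x y)) => // S sS AS.
by have := lpart_join x y; have := rpart_join x y; rewrite /lpart /rpart => -> ->; exact: H.
Qed.

Lemma equidominantP : equidominant K p q <-> exists A x y, equi_at p q A x y.
Proof.
have [pc _] := ip; have [qc _] := iq; split=> [[A [r [lk ent ent']]]|[A [x [y [d d']]]]].
  have [B [z [sB AB bp bq [rz Bz]]]] := link_real lk.
  have d : dom_at p q B (lpart z) (rpart z).
    by split=> //; exact: (entails_real (f := @lshift _ _) (g := @rshift _ _) pc AB rz ent).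
  exists B, (lpart z), (rpart z); split=> //; split=> //; first exact: dom_real d.
  exact: (entails_real (f := @rshift _ _) (g := @lshift _ _) qc AB rz ent').
have [bp bq Ax H] := d; have [_ _ Ay H'] := d'.
have [L1 L2] := (lpart_join x y, rpart_join x y).
exists A; eexists; split; first exact: type_link bp Ax Ay.
  apply: (realises_entails (f := @lshift _ _) (g := @rshift _ _) bp.1 bp.2 bq.2 (z := join x y)) => // S sS AS.
  by move: L1 L2; rewrite /lpart /rpart => -> ->; exact: H.
apply: (realises_entails (f := @rshift _ _) (g := @lshift _ _) bp.1 bq.2 bp.2 (z := join x y)) => // S sS AS.
by move: L1 L2; rewrite /lpart /rpart => -> ->; exact: H'.
Qed.

End Pair.
Lemma dominates_trans p q r : Sinv K p -> Sinv K q -> Sinv K r ->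
  dominates K p q -> dominates K q r -> dominates K p r.
Proof.
move=> ip iq ir /(dominatesP ip iq)[A [x [y d]]] /(dominatesP iq ir)[B [y' [z d']]].
apply/(dominatesP ip ir).
by have [x' [z' d'']] := dom_at_trans ip.1 iq.1 d d'; exists (A `|` B), x', z'.
Qed.

Lemma equidominant_trans p q r : Sinv K p -> Sinv K q -> Sinv K r ->
  equidominant K p q -> equidominant K q r -> equidominant K p r.
Proof.
move=> ip iq ir /(equidominantP ip iq)[A [x [y d]]] /(equidominantP iq ir)[B [y' [z d']]].
apply/(equidominantP ip ir).
by have [x' [z' d'']] := equi_at_trans ip.1 iq.1 d d'; exists (A `|` B), x', z'.
Qed.

Lemma equidominant_sym p q : Sinv K p -> Sinv K q -> equidominant K p q -> equidominant K q p.
Proof.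
move=> ip iq /(equidominantP ip iq)[A [x [y [d d']]]].
by apply/(equidominantP iq ip); exists A, y, x.
Qed.

Lemma equidominant_dominates p q : equidominant K p q -> dominates K p q.
Proof. by move=> [A [r [lk ent _]]]; exists A, r. Qed.

Lemma equidominant_dom_equiv p q : Sinv K p -> Sinv K q -> equidominant K p q -> dom_equiv K p q.
Proof.
move=> ip iq e; split; first exact: equidominant_dominates.
exact/equidominant_dominates/equidominant_sym.
Qed.

Lemma equidominant_refl p : Sinv K p -> equidominant K p p.
Proof.
move=> ip; have [pc [A bA]] := ip; have [x Ax] := real_ex pc bA.1.
by apply/(equidominantP ip ip); exists A, x, x; do 2!split.
Qed.

Lemma realises_tensor p q (N : structure L) (e : U -> N) c : Sinv K p -> Sinv K q ->
  realises e (gset (tensor K p q)) c ->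
  realises e (gset p) (c \o @lshift _ _) /\ realises e (gset q) (c \o @rshift _ _).
Proof.
move=> ip iq H; have [A [sA bp bq]] := joint_base ip iq.
have key n (f : 'I_n -> 'I_(gdim p + gdim q)) (s : set (formula L ('I_n + U))) phi :
    (forall S z, @generic p q S z -> real_on s S (z \o f)) -> s phi ->
    sat (either (c \o f) e) phi.
  move=> gs sphi; rewrite -sat_vars; apply: H.
  have [S sS u] := uses_small phi.
  have sAS := smallU nat_small K_limit sA sS.
  have [z Gz] := gen_ex ip.1 iq.1 sAS.
  have {}u : uses (A `|` S) phi by apply: uses_sub u; exact: subsetUr.
  apply/(tensor_sat ip iq.1 bp sAS (@subsetUl _ A S) (uses_vars f u) Gz).
  by apply/sat_vars; exact: (gs _ _ Gz _ u sphi).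
split=> phi; first by apply: key => S z [_]; apply: real_sub; exact: subsetUl.
by apply: key => S z [].
Qed.

Lemma realises_in_x p m (N : structure L) (e : U -> N) c :
  realises e (@in_x L U p m) c <-> realises e (gset p) (c \o @lshift _ _).
Proof. exact: realises_vars. Qed.

Lemma realises_in_y n q (N : structure L) (e : U -> N) c :
  realises e (@in_y L U n q) c <-> realises e (gset q) (c \o @rshift _ _).
Proof. exact: realises_vars. Qed.

(** * Weak orthogonality *)

Section Orth.
Variables p q : gtype U.
Hypotheses (ip : Sinv K p) (iq : Sinv K q).

(** The product is one completion of the two types, so a complete type that they imply agrees with
    it. *)
Lemma orth_entails : weakly_orthogonal p q <->
  (forall (N : structure L) (e : U -> N) c, elementary e ->
    realises e (gset p) (c \o @lshift _ _) -> realises e (gset q) (c \o @rshift _ _) ->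
    realises e (gset (tensor K p q)) c).
Proof.
have ipq := Sinv_tensor ip iq.
split=> [[r [rc ent]] N e c eN cp cq phi tphi|H].
  have entr (N' : structure L) (e' : U -> N') c' : elementary e' ->
      realises e' (gset p) (c' \o @lshift _ _) -> realises e' (gset q) (c' \o @rshift _ _) ->
      realises e' r c'.
    move=> eN' cp' cq'; apply: ent => //; apply/realises_setU.
    by split; [exact/realises_in_x|exact/realises_in_y].
  case: (rc.2 phi) => rphi; first exact: (entr _ _ _ eN cp cq).
  have [N' [e' [c' [eN' Hc']]]] := type_elementary ipq.1.
  have [cp' cq'] := realises_tensor ip iq Hc'.
  by have /sat_not := entr _ _ _ eN' cp' cq' _ rphi; case; exact: Hc'.
exists (gset (tensor K p q)); split; first by case: ipq.
by move=> N e c eN /realises_setU[/realises_in_x cp /realises_in_y cq]; exact: H.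
Qed.

Lemma orth_join (N : structure L) (e : U -> N) x y : weakly_orthogonal p q -> elementary e ->
  realises e (gset p) x -> realises e (gset q) y -> realises e (gset (tensor K p q)) (join x y).
Proof.
move=> /orth_entails H eN px qy; apply: H => //.
  by have := lpart_join x y; rewrite /lpart => ->.
by have := rpart_join x y; rewrite /rpart => ->.
Qed.

Lemma orthP : weakly_orthogonal p q <-> forall phi, gset (tensor K p q) phi ->
  exists S, small K S /\ forall z, real_on (gset p) S (lpart z) -> real_on (gset q) S (rpart z) ->
    sat (either z id) phi.
Proof.
rewrite orth_entails; split=> [H phi tphi|H N e c eN cp cq phi tphi].
  apply: contrapT => /forallNP HS.
  have [s Hs|N [e [c [eN Hc]]]] := @compactness L U _
      (vars (@lshift _ _) (gset p) `|` vars (@rshift _ _) (gset q) `|` [set Not phi]).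
    have [|S1 sS1 H1] := @finite_real _ _ (@lshift _ _) (gset p)
        (vars (@rshift _ _) (gset q) `|` [set Not phi]) s.
      by move=> psi /Hs [[]|]; [left|right; left|right; right].
    (* [finite_real] treats one type at a time; this second round concerns the formulas not covered
       by [p]. *)
    have [|S2 sS2 H2] := @finite_real _ _ (@rshift _ _) (gset q)
        [set Not phi] [seq psi <- s | `[< (vars (@rshift _ _) (gset q) `|` [set Not phi]) psi >]].
      by move=> psi /List.filter_In[_ /asboolP].
    have := HS (S1 `|` S2) => /not_andP[]; first by case; exact: smallU.
    move=> /existsNP[z /not_implyP[zp /not_implyP[zq nz]]]; exists z.
    apply: H1; first by apply: real_sub zp; exact: subsetUl.
    move=> psi psis Qpsi; apply: H2; first by apply: real_sub zq; exact: subsetUr.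
      by move=> _ _ ->; apply/sat_not.
    by apply/List.filter_In; split=> //; apply/asboolP.
  have /sat_not := Hc _ (or_intror erefl); apply; apply: (H N e c) => //.
    by apply/(@realises_in_x p (gdim q) N e c) => psi h; apply: Hc; left; left.
  by apply/(@realises_in_y (gdim p) q N e c) => psi h; apply: Hc; left; right.
have [S [sS HS]] := H phi tphi; have [S' sS' u] := uses_small phi.
have [z [Hz Hr]] := real_below c (smallU nat_small K_limit sS sS') eN.
rewrite Hz; last by apply: uses_sub u; exact: subsetUr.
by apply: HS; [apply: real_sub (Hr _ _ _ cp)|apply: real_sub (Hr _ _ _ cq)]; exact: subsetUl.
Qed.

Lemma orth_swap phi : weakly_orthogonal p q -> gset (tensor K q p) phi <->
  gset (tensor K p q) (rename (sum_map (join (@rshift _ _) (@lshift _ _)) id) phi).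
Proof.
move=> o; have [N [e [c [eN Hc]]]] := type_elementary (Sinv_tensor iq ip).1.
have [cq cp] := realises_tensor iq ip Hc.
rewrite (type_sat (Sinv_tensor iq ip).1 _ Hc).
rewrite (type_sat (Sinv_tensor ip iq).1 _ (orth_join o eN cp cq)) sat_vars.
suff -> : join (c \o @rshift _ _) (c \o @lshift _ _) \o join (@rshift _ _) (@lshift _ _) = c by [].
apply/funext => i /=; rewrite -[in RHS](splitK i) {1}/join /join /=.
by case: (fintype.split i) => j /=; rewrite ?(unsplitK (inl j)) ?(unsplitK (inr j)).
Qed.

End Orth.

Lemma orth_sym p q : Sinv K p -> Sinv K q -> weakly_orthogonal p q -> weakly_orthogonal q p.
Proof.
move=> ip iq o; apply/(orth_entails iq ip) => N e c eN cq cp phi.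
rewrite orth_swap // => /(orth_join ip iq o eN cp cq); rewrite sat_vars.
suff -> : join (c \o @rshift _ _) (c \o @lshift _ _) \o join (@rshift _ _) (@lshift _ _) = c by [].
apply/funext => i /=; rewrite -[in RHS](splitK i) {1}/join /join /=.
by case: (fintype.split i) => j /=; rewrite ?(unsplitK (inl j)) ?(unsplitK (inr j)).
Qed.

(** Orthogonality applied twice makes realisations of [p] and of [tensor q r] realise
    [tensor (tensor p q) r], and this differs from [tensor p (tensor q r)] only in the
    bracketing. *)
Lemma orth_tensor p q r : Sinv K p -> Sinv K q -> Sinv K r -> weakly_orthogonal p q ->
  weakly_orthogonal (tensor K p q) r -> weakly_orthogonal p (tensor K q r).
Proof.
move=> ip iq ir opq opqr; have ipq := Sinv_tensor ip iq.
have iqr := Sinv_tensor iq ir.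
apply/(orth_entails ip iqr) => N e c eN cp cqr phi tphi.
have [cq cr] := realises_tensor iq ir cqr.
have H := orth_join ipq ir opqr eN (orth_join ip iq opq eN cp cq) cr.
have [A [sA bp bq]] := joint_base ip iq; have [_ [B bB]] := ir.
have sAB := smallU nat_small K_limit sA bB.1; have [S sS u] := uses_small phi.
have sABS := smallU nat_small K_limit sAB sS.
have AS : A `<=` A `|` B `|` S by move=> x Ax; left; left.
have BS : B `<=` A `|` B `|` S by move=> x Bx; left; right.
have {}bp := base_sub AS sABS bp; have {}bq := base_sub AS sABS bq.
have {bB AS BS} br := base_sub BS sABS bB.
have {}u : uses (A `|` B `|` S) phi by apply: uses_sub u; exact: subsetUr.
have sub n (x : 'I_n -> U) : A `|` B `|` S `<=` (A `|` B `|` S) :++ x by exact: subsetUl.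
have [_ bpq Epq] := tensor_type ip iq bp bq.
have [_ bqr Eqr] := tensor_type iq ir bq br.
have [_ _ Epqr] := tensor_type ipq ir bpq br.
have [z [Hz Hr]] := real_below c sABS eN; rewrite Hz //.
pose h : 'I_((gdim p + gdim q) + gdim r) -> 'I_(gdim p + (gdim q + gdim r)) :=
  join (join (@lshift _ _) (@rshift _ _ \o @lshift _ _)) (@rshift _ _ \o @rshift _ _).
have ch : join (join (c \o @lshift _ _) (c \o @rshift _ _ \o @lshift _ _))
    (c \o @rshift _ _ \o @rshift _ _) = c \o h.
  by apply/funext => i; rewrite /h /join /=; case: (fintype.split i) => //= j; case: (fintype.split j).
have := Hr _ h (gset (tensor K (tensor K p q) r)); rewrite -ch => /(_ H).
have zh : z \o h = join (join (lpart z) (lpart (rpart z))) (rpart (rpart z)).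
  by apply/funext => i; rewrite /h /join /=; case: (fintype.split i) => //= j; case: (fintype.split j).
rewrite zh => /(Epqr _ _ sABS (@subset_refl _ _))[]; rewrite rpart_join lpart_join => zr.
move=> /(Epq _ _ (small_tuple _ sABS) (sub _ _))[]; rewrite rpart_join lpart_join => zq zp.
apply/(tensor_sat ip iqr.1 bp sABS (@subset_refl _ _) u) => //; split; first exact/Eqr.
have R : range (rpart z) = range (lpart (rpart z)) `|` range (rpart (rpart z)).
  by rewrite -range_join join_parts.
by apply: real_sub zp => x [?|]; [left; left|rewrite R => -[?|?]; [right|left; right]].
Qed.

(** Given realisations of [p1] and [q] at which [phi] fails, compactness adds a realisation of [p0]
    linked to that of [p1]. Orthogonality makes it generic over the realisation of [q], domination
    passes this on to [p1], and [phi] holds after all. *)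
Lemma orth_dominates p0 p1 q : Sinv K p0 -> Sinv K p1 -> Sinv K q ->
  dominates K p0 p1 -> weakly_orthogonal p0 q -> weakly_orthogonal p1 q.
Proof.
move=> ip0 ip1 iq /(dominatesP ip0 ip1)[A0 [x0 [y0 d0]]] o.
have [A [x [y [bq d]]]] : exists A x y, invariant_base K q A /\ dom_at p0 p1 A x y.
  have [_ [B bB]] := iq; have [[sA0 _] _ _ _] := d0; have sAB := smallU nat_small K_limit sA0 bB.1.
  have [x Ax] := real_ex ip0.1 sAB.
  have [s [_ _ d]] := dom_enlarge ip0.1 (@subsetUl _ A0 B) sAB Ax d0.
  by exists (A0 `|` B), x, (s \o y0); split=> //; apply: base_sub bB => //; exact: subsetUr.
have [bp0 bp1 Ax Hxy] := d; have sA := bp0.1.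
apply/(orthP ip1 iq) => phi tphi; apply: contrapT => /forallNP HS.
(* [fx], [fy] and [fw] select the variables of [p0], [p1] and [q]; [rho] will be the type over [A]
   of the dominating pair. *)
pose fx := @lshift (gdim p0) (gdim p1 + gdim q).
pose fy := @rshift (gdim p0) (gdim p1 + gdim q) \o @lshift (gdim p1) (gdim q).
pose fw := @rshift (gdim p0) (gdim p1 + gdim q) \o @rshift (gdim p1) (gdim q).
pose rho := [set psi | uses A psi /\ sat (either (join x y) id) psi].
pose nphi : formula L ('I_(gdim p0 + (gdim p1 + gdim q)) + U) :=
  rename (sum_map (@rshift _ _) id) (Not phi).
pose Q := vars (join fx fy) rho `|` [set nphi].
have [s Hs|N [e [c [eN Hc]]]] := @compactness L U _ (vars fx (gset p0) `|` (vars fw (gset q) `|` Q)).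
  have [S1 sS1 H1] := finite_real Hs.
  have [|S2 sS2 H2] := @finite_real _ _ fw (gset q) Q
      [seq psi <- s | `[< (vars fw (gset q) `|` Q) psi >]].
    by move=> psi /List.filter_In[_ /asboolP].
  have sS : small K (A `|` (S1 `|` S2)) by do 2!apply: smallU => //.
  have := HS (A `|` (S1 `|` S2)) => /not_andP[]; first by case.
  move=> /existsNP[z /not_implyP[zp /not_implyP[zq nz]]].
  have [x' Sx'] := real_ex ip0.1 sS.
  have [t [ft tx d']] := dom_enlarge ip0.1 (@subsetUl _ A _) sS Sx' d.
  have [t' ft' tz] := real_conj ip1.1 sS (dom_real d') zp.
  have ft'A := fixes_sub (@subsetUl _ A _) ft'.
  pose c := join (t' \o x') z; have cx : c \o fx = t' \o x' by exact: (lpart_join _ z).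
  have cz : c \o @rshift _ _ = z by exact: (rpart_join (t' \o x') z).
  exists c; apply: H1.
    by rewrite cx; apply: real_sub (real_fix ft' Sx') => u Su; right; left.
  move=> psi psis Qpsi; apply: H2.
  - rewrite /fw compA cz; apply: real_sub zq => u Su; right; by right.
  - move=> _ _ [[chi [uchi schi] <-]|->]; last by rewrite sat_vars cz; apply/sat_not.
    rewrite sat_vars.
    have -> : c \o join fx fy = (t' \o t) \o join x y.
      have cy : c \o fy = t' \o (t \o y) by rewrite /fy compA cz tz.
      apply/funext => i; rewrite /= /join; case: (fintype.split i) => j /=.
        by have := congr1 (fun f => f j) cx => /= ->; rewrite -tx.
      by have := congr1 (fun f => f j) cy => /= ->.
    by rewrite (sat_either_aut _ (fixes_comp ft'A ft) uchi).
  - by apply/List.filter_In; split=> //; apply/asboolP.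
have cp0 : realises e (gset p0) (c \o fx) by apply/realises_vars => psi h; apply: Hc; left.
have cq : realises e (gset q) (c \o fw) by apply/realises_vars => psi h; apply: Hc; right; left.
have H := orth_join ip0 iq o eN cp0 cq; have [S sS u] := uses_small phi.
have sAS := smallU nat_small K_limit sA sS; have AAS := @subsetUl _ A S.
have {}u : uses (A `|` S) phi by apply: uses_sub u; exact: subsetUr.
have {}bp0 := base_sub AAS sAS bp0; have {}bp1 := base_sub AAS sAS bp1.
have {}bq := base_sub AAS sAS bq.
have [z [Hz Hr]] := real_below c sAS eN.
have E : join (c \o fx) (c \o fw) = c \o join fx fw.
  by apply/funext => i; rewrite /join /=; case: (fintype.split i).
rewrite E in H; have {Hr H} := Hr _ _ _ H.
have -> : z \o join fx fw = join (z \o fx) (z \o fw).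
  by apply/funext => i; rewrite /join /=; case: (fintype.split i).
have [_ _ Epq] := tensor_type ip0 iq bp0 bq.
move=> /(Epq _ _ sAS (@subset_refl _ _))[]; rewrite rpart_join lpart_join => zq zp.
have [|s fs xyz] := homogeneity (x := join x y) (y := z \o join fx fy) sA.
  have key psi : uses A psi -> sat (either (join x y) id) psi ->
      sat (either (z \o join fx fy) id) psi.
    move=> upsi spsi; rewrite -sat_vars -Hz; last by apply/uses_vars/(uses_sub AAS).
    by apply: Hc; right; right; left; exists psi.
  move=> psi upsi; split; first exact: key.
  by move=> h; apply: contrapT => /sat_not/(key _ (uses_not upsi))/sat_not.
have sx : s \o x = z \o fx.
  apply/funext => i; have := congr1 (fun f => f (lshift _ i)) xyz.
  by rewrite /= /join (unsplitK (inl i)).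
have sy : s \o y = z \o fy.
  apply/funext => i; have := congr1 (fun f => f (rshift _ i)) xyz.
  by rewrite /= /join (unsplitK (inr i)).
have [_ _ _] := dom_move d fs; rewrite sx sy => Hd.
have zp1 : real_on (gset p1) ((A `|` S) :++ (z \o fw)) (z \o fy).
  apply: Hd => //; first exact: small_tuple.
  by move=> v Av; left; left.
have sphi : sat (either (z \o @rshift _ _) id) phi.
  exact/(tensor_sat ip1 iq.1 bp1 sAS (@subset_refl _ _) u).
have := Hc nphi (or_intror (or_intror (or_intror erefl))).
by rewrite Hz ?sat_vars; [move/sat_not; apply|apply/uses_vars/uses_not].
Qed.

(** * Interdefinability *)

Lemma range_dcl_move A n m (x : 'I_n -> U) (y : 'I_m -> U) s : fixes A s ->
  range x `<=` dcl (A :++ y) -> range (s \o x) `<=` dcl (A :++ (s \o y)).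
Proof.
move=> fs H _ [i _ <-]; have := dcl_aut fs.1 (H (x i) (ex_intro2 _ _ i Logic.I erefl)).
apply: dcl_mono => _ [z [Az|[j _ <-]] <-]; first by left; case: fs => _ ->.
by right; exists j.
Qed.

Definition interdef_at p q A x y :=
  [/\ equi_at p q A x y, range x `<=` dcl (A :++ y) & range y `<=` dcl (A :++ x)].

Arguments interdef_at p q A x y : clear implicits.

Definition interdef p q := exists A x y, interdef_at p q A x y.

Lemma interdef_equidominant p q : Sinv K p -> Sinv K q -> interdef p q -> equidominant K p q.
Proof.
by move=> ip iq [A [x [y [d _ _]]]]; apply/(equidominantP ip iq); exists A, x, y.
Qed.

Lemma interdef_enlarge p q A A' x y x' : complete_type (@id U) (gset p) -> A `<=` A' ->
  small K A' -> real_on (gset p) A' x' -> interdef_at p q A x y ->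
  exists y', interdef_at p q A' x' y'.
Proof.
move=> pc AA' sA' A'x' [d xy yx].
have [s [fs sx ds]] := equi_enlarge pc AA' sA' A'x' d.
exists (s \o y); split=> //; rewrite -sx.
  by apply: subset_trans (range_dcl_move fs xy) _; apply: dcl_mono => z [/AA'|]; [left|right].
by apply: subset_trans (range_dcl_move fs yx) _; apply: dcl_mono => z [/AA'|]; [left|right].
Qed.

Lemma interdef_sym p q : interdef p q -> interdef q p.
Proof. by move=> [A [x [y [[d d'] xy yx]]]]; exists A, y, x. Qed.

Lemma interdef_refl p : Sinv K p -> interdef p p.
Proof.
move=> [pc [A bA]]; have [x Ax] := real_ex pc bA.1.
have d : dom_at p p A x x by [].
by exists A, x, x; split=> //; apply: subset_trans (@sub_dcl _ _ _); exact: subsetUr.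
Qed.

Lemma dcl_trans_tuple A n m k (x : 'I_n -> U) (y : 'I_m -> U) (z : 'I_k -> U) :
  range x `<=` dcl (A :++ y) -> range y `<=` dcl (A :++ z) -> range x `<=` dcl (A :++ z).
Proof.
move=> xy yz; apply: (subset_trans xy); apply: dcl_sub => u [Au|/yz//].
by apply: sub_dcl; left.
Qed.

Lemma interdef_trans p q r : Sinv K p -> Sinv K q -> interdef p q -> interdef q r -> interdef p r.
Proof.
move=> ip iq [A [x [y d]]] [B [y' [z d']]].
have sAB : small K (A `|` B) by apply: smallU => //; [case: d => -[[[]]]|case: d' => -[[[]]]].
have [x1 Ax1] := real_ex ip.1 sAB.
have [y1 [[dxy dyx] xy yx]] := interdef_enlarge ip.1 (@subsetUl _ A B) sAB Ax1 d.
have [z1 [[dyz dzy] yz zy]] := interdef_enlarge iq.1 (@subsetUr _ A B) sAB (dom_real dxy) d'.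
exists (A `|` B), x1, z1; case: dxy dyx dyz dzy => [? ? ? H1] [? ? ? H2] [? ? ? H3] [? ? ? H4].
split; [split; split=> // S sS AS| |].
- by move=> h; apply: H3 => //; exact: H1.
- by move=> h; apply: H2 => //; exact: H4.
- exact: dcl_trans_tuple yz.
- exact: dcl_trans_tuple yx.
Qed.

(** * Products of dominated and of interdefinable types *)

Section Tensor.
Variables p q r : gtype U.
Hypotheses (ip : Sinv K p) (iq : Sinv K q) (ir : Sinv K r).

Lemma dom_tensor_l A x y w : dom_at p q A x y -> invariant_base K r A ->
  @generic p r A (join x w) -> dom_at (tensor K p r) (tensor K q r) A (join x w) (join y w).
Proof.
move=> [bp bq Ax H] br Gxw; have sA := br.1.
have [_ bpr Epr] := tensor_type ip ir bp br.
have [_ bqr Eqr] := tensor_type iq ir bq br.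
split=> // [|S sS AS]; first by apply/Epr => //; exact: subset_refl.
move=> /(Epr _ _ sS AS)[]; rewrite rpart_join lpart_join => Sw Sx.
apply/(Eqr _ _ sS AS); split; rewrite rpart_join ?lpart_join //.
by apply: H => //; [exact: small_tuple|move=> z /AS; left].
Qed.

Lemma gen_with A x : invariant_base K p A -> real_on (gset p) A x ->
  exists w, @generic p r A (join x w).
Proof.
move=> [sA iA] Ax; have [z Gz] := gen_ex ip.1 ir.1 sA.
have [s fs sz] := real_conj ip.1 sA (real_sub (@subsetUl _ _ _) Gz.2) Ax.
exists (s \o rpart z); split; rewrite rpart_join ?lpart_join; first exact: (real_fix fs Gz.1).
rewrite -sz; exact: (real_move_tuple (conj sA iA) (@subset_refl _ _) fs Gz.2).
Qed.

Lemma equi_gen A x y w : equi_at p q A x y -> invariant_base K r A ->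
  @generic p r A (join x w) -> @generic q r A (join y w).
Proof.
move=> [d _] br Gxw; have := dom_real (dom_tensor_l d br Gxw).
have [_ bq _ _] := d; have [_ _ E] := tensor_type iq ir bq br.
by move/E; apply; [exact: br.1|exact: subset_refl].
Qed.

End Tensor.

Lemma dominates_tensor_l p q r : Sinv K p -> Sinv K q -> Sinv K r ->
  dominates K p q -> dominates K (tensor K p r) (tensor K q r).
Proof.
move=> ip iq ir /(dominatesP ip iq)[A [x [y d]]].
have [_ [B bB]] := ir; have [[sA _] _ _ _] := d; have sAB := smallU nat_small K_limit sA bB.1.
have [x' Ax'] := real_ex ip.1 sAB.
have [s [_ _ d']] := dom_enlarge ip.1 (@subsetUl _ A B) sAB Ax' d.
have br := base_sub (@subsetUr _ A B) sAB bB.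
have [bp _ Ax _] := d'; have [w Gw] := gen_with ip ir bp Ax.
apply/(dominatesP (Sinv_tensor ip ir) (Sinv_tensor iq ir)).
by exists (A `|` B), (join x' w), (join (s \o y) w); exact: dom_tensor_l.
Qed.

Lemma equidominant_tensor_l p q r : Sinv K p -> Sinv K q -> Sinv K r ->
  equidominant K p q -> equidominant K (tensor K p r) (tensor K q r).
Proof.
move=> ip iq ir /(equidominantP ip iq)[A [x [y d]]].
have [_ [B bB]] := ir; have [[[sA _] _ _ _] _] := d; have sAB := smallU nat_small K_limit sA bB.1.
have [x' Ax'] := real_ex ip.1 sAB.
have [s [_ _ d']] := equi_enlarge ip.1 (@subsetUl _ A B) sAB Ax' d.
have br := base_sub (@subsetUr _ A B) sAB bB.
have [[bp _ Ax _] _] := d'; have [w Gw] := gen_with ip ir bp Ax.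
apply/(equidominantP (Sinv_tensor ip ir) (Sinv_tensor iq ir)).
exists (A `|` B), (join x' w), (join (s \o y) w); split; first exact: dom_tensor_l d'.1 br Gw.
exact: dom_tensor_l d'.2 br (equi_gen ip iq ir d' br Gw).
Qed.

Lemma interdef_tensor_l p q r : Sinv K p -> Sinv K q -> Sinv K r ->
  interdef p q -> interdef (tensor K p r) (tensor K q r).
Proof.
move=> ip iq ir [A [x [y d]]].
have [_ [B bB]] := ir; have [[[[sA _] _ _ _] _] _ _] := d; have sAB := smallU nat_small K_limit sA bB.1.
have [x' Ax'] := real_ex ip.1 sAB.
have [y' [d' xy yx]] := interdef_enlarge ip.1 (@subsetUl _ A B) sAB Ax' d.
have br := base_sub (@subsetUr _ A B) sAB bB.
have [[bp _ Ax _] _] := d'; have [w Gw] := gen_with ip ir bp Ax.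
exists (A `|` B), (join x' w), (join y' w); split.
- split; first exact: dom_tensor_l d'.1 br Gw.
  exact: dom_tensor_l d'.2 br (equi_gen ip iq ir d' br Gw).
- rewrite !range_join => z [/xy|zw]; last by apply: sub_dcl; right; right.
  by apply: dcl_mono => u [|]; [left|right; left].
- rewrite !range_join => z [/yx|zw]; last by apply: sub_dcl; right; right.
  by apply: dcl_mono => u [|]; [left|right; left].
Qed.

(** [w] realises [r] over [S] and [x], hence over all that is definable from them, in particular
    over [S] and [y]. *)
Lemma dom_tensor_r p q r A x y w : Sinv K p -> Sinv K q -> Sinv K r ->
  dom_at p q A x y -> invariant_base K r A -> real_on (gset r) (A :++ x) w ->
  range y `<=` dcl (A :++ x) ->
  dom_at (tensor K r p) (tensor K r q) A (join w x) (join w y).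
Proof.
move=> ip iq ir [bp bq Ax H] br Aw yx; have sA := br.1.
have [_ bpr Epr] := tensor_type ir ip br bp.
have [_ bqr Eqr] := tensor_type ir iq br bq.
split=> // [|S sS AS]; first by apply/Epr => //; split; rewrite rpart_join ?lpart_join.
move=> /(Epr _ _ sS AS)[]; rewrite rpart_join lpart_join => Sx Sw.
apply/(Eqr _ _ sS AS); split; rewrite rpart_join ?lpart_join; first exact: H.
have yx' : range y `<=` dcl (S :++ x).
  by apply: subset_trans yx _; apply: dcl_mono => z [/AS|]; [left|right].
have := real_dcl ir.1 (small_tuple x sS) (small_ord nat_small y) yx' Sw.
by apply: real_sub => z [|]; [left; left|right].
Qed.

Lemma interdef_tensor_r p q r : Sinv K p -> Sinv K q -> Sinv K r ->
  interdef p q -> interdef (tensor K r p) (tensor K r q).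
Proof.
move=> ip iq ir [A [x [y d]]].
have [_ [B bB]] := ir; have [[[[sA _] _ _ _] _] _ _] := d; have sAB := smallU nat_small K_limit sA bB.1.
have [x' Ax'] := real_ex ip.1 sAB.
have [y' [d' xy yx]] := interdef_enlarge ip.1 (@subsetUl _ A B) sAB Ax' d.
have br := base_sub (@subsetUr _ A B) sAB bB.
have [w Aw] := real_ex ir.1 (small_tuple x' sAB).
have Aw' : real_on (gset r) ((A `|` B) :++ y') w.
  have := real_dcl ir.1 (small_tuple x' sAB) (small_ord nat_small y') yx Aw.
  by apply: real_sub => z [|]; [left; left|right].
exists (A `|` B), (join w x'), (join w y'); split.
- by split; [exact: dom_tensor_r d'.1 br Aw yx|exact: dom_tensor_r d'.2 br Aw' xy].
- rewrite !range_join => z [zw|/xy]; first by apply: sub_dcl; right; left.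
  by apply: dcl_mono => u [|]; [left|right; right].
- rewrite !range_join => z [zw|/yx]; first by apply: sub_dcl; right; left.
  by apply: dcl_mono => u [|]; [left|right; right].
Qed.

(** For types whose realisations are the same elements in another arrangement, as after
    rebracketing, exchanging orthogonal factors or dropping an empty factor. *)
Lemma interdef_range p q A x y : complete_type (@id U) (gset p) -> invariant_base K p A ->
  invariant_base K q A -> range x = range y -> real_on (gset p) A x ->
  (forall S, small K S -> A `<=` S -> real_on (gset p) S x <-> real_on (gset q) S y) ->
  interdef p q.
Proof.
move=> pc bp bq xy Ax H; have Ay : real_on (gset q) A y by apply/H => //; exact: bp.1.
exists A, x, y; split; last 1 first.
- by rewrite xy; apply: subset_trans (@sub_dcl _ _ _); exact: subsetUr.
- by split; split=> // S sS AS; have [] := H S sS AS.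
- by rewrite xy; apply: subset_trans (@sub_dcl _ _ _); exact: subsetUr.
Qed.

Lemma interdef_assoc p q r : Sinv K p -> Sinv K q -> Sinv K r ->
  interdef (tensor K p (tensor K q r)) (tensor K (tensor K p q) r).
Proof.
move=> ip iq ir; have ipq := Sinv_tensor ip iq; have iqr := Sinv_tensor iq ir.
have [A0 [sA0 bp0 bq0]] := joint_base ip iq; have [_ [B bB]] := ir.
have sA := smallU nat_small K_limit sA0 bB.1; pose A := A0 `|` B.
have bp := base_sub (@subsetUl _ A0 B) sA bp0; have bq := base_sub (@subsetUl _ A0 B) sA bq0.
have br := base_sub (@subsetUr _ A0 B) sA bB.
have [_ bpq Epq] := tensor_type ip iq bp bq.
have [_ bqr Eqr] := tensor_type iq ir bq br.
have [tuple1 b1 E1] := tensor_type ip iqr bp bqr.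
have [_ b2 E2] := tensor_type ipq ir bpq br.
have [x Ax] := real_ex tuple1 sA.
pose u := lpart x; pose v := lpart (rpart x); pose w := rpart (rpart x).
have xE : x = join u (join v w) by rewrite !join_parts.
apply: (@interdef_range (tensor K p (tensor K q r)) (tensor K (tensor K p q) r) A x (join (join u v) w)) => // [|S sS AS].
  by rewrite xE !range_join setUA.
rewrite (E1 _ _ sS AS) (E2 _ _ sS AS) /generic !rpart_join !lpart_join.
rewrite (Eqr _ _ sS AS) /generic -/v -/w -/u.
have sSw := small_tuple w sS.
have ASw : A `<=` S :++ w by move=> z /AS; left.
rewrite (Epq _ _ sSw ASw) /generic !rpart_join !lpart_join.
have -> : S :++ rpart x = S :++ w :++ v.
  by rewrite -[rpart x]join_parts range_join -/v -/w [range v `|` _]setUC setUA.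
by tauto.
Qed.

Lemma orth_real_swap p q S x : Sinv K p -> Sinv K q -> weakly_orthogonal p q ->
  real_on (gset (tensor K q p)) S x <-> real_on (gset (tensor K p q)) S (join (rpart x) (lpart x)).
Proof.
move=> ip iq o; set y := join (rpart x) (lpart x).
have yx : y \o join (@rshift _ _) (@lshift _ _) = x.
  by rewrite comp_join -[RHS]join_parts; congr join; [exact: rpart_join|exact: lpart_join].
have xy : x \o join (@rshift _ _) (@lshift _ _) = y by rewrite comp_join.
split=> Sx phi uphi tphi.
  have := Sx (rename (sum_map (join (@rshift _ _) (@lshift _ _)) id) phi) (uses_vars _ uphi).
  rewrite sat_vars xy; apply; rewrite (orth_swap ip iq _ o) rename_comp.
  rewrite [X in rename X](_ : _ = id) ?rename_id //.
  apply/funext => -[i|//] /=; congr inl; rewrite -[in RHS](splitK i) {1 2}/join.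
  by case: (fintype.split i) => j /=; rewrite /join ?(unsplitK (inl j)) ?(unsplitK (inr j)).
rewrite -yx -sat_vars; apply: Sx; [exact: uses_vars|exact/(orth_swap ip iq phi o)].
Qed.

Lemma interdef_swap p q : Sinv K p -> Sinv K q -> weakly_orthogonal p q ->
  interdef (tensor K q p) (tensor K p q).
Proof.
move=> ip iq o; have [A [sA bp bq]] := joint_base ip iq.
have [cqp bqp _] := tensor_type iq ip bq bp.
have [cpq bpq _] := tensor_type ip iq bp bq.
have [x Ax] := real_ex cqp sA.
apply: (@interdef_range (tensor K q p) (tensor K p q) A x (join (rpart x) (lpart x))) => //.
  by rewrite -{1}[x]join_parts !range_join setUC.
by move=> S _ _; exact: orth_real_swap.
Qed.

(** The type of the empty tuple represents the class of realised types and serves as the empty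
    product. *)
Definition unit_type : gtype U :=
  @GType L U 0 [set phi | forall x : 'I_0 -> U, sat (either x id) phi].

Lemma no_var_eq (V : Type) (x y : 'I_0 -> V) : x = y.
Proof. by apply/funext => -[]. Qed.

Lemma unit_real S x : real_on (gset unit_type) S x.
Proof. by move=> phi _; exact. Qed.

Lemma realised_type p a : complete_type (@id U) (gset p) -> small K (range a) ->
  realises (@id U) (gset p) a -> invariant_base K p (range a).
Proof.
move=> pc sa pa; have pP phi : gset p phi <-> sat (either a id) phi by exact: (@type_sat _ _ pc U id a phi pa).
split=> // m phi b b' eq.
have [|s fs sb] := homogeneity (x := b) (y := b') sa.
  by move=> _ [psi ->]; rewrite !sat_over.
have sa' : s \o a = a by apply/funext => i /=; case: fs => _; apply; exists i.
rewrite !pP !sat_rename -sb -{2}sa'.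
have -> : either (s \o a) id \o sum_map id (s \o b) = s \o (either a id \o sum_map id b).
  by apply/funext => -[].
by rewrite sat_aut //; exact: fs.1.
Qed.

Lemma unit_Sinv : Sinv K unit_type.
Proof.
have x0 : 'I_0 -> U by case.
have E phi : gset unit_type phi <-> sat (either x0 id) phi.
  by split=> [/(_ x0)//|h x]; rewrite (no_var_eq x x0).
have c : complete_type (@id U) (gset unit_type).
  split=> [F _ HF|phi]; first by exists x0 => phi /HF/E.
  rewrite !E; exact: lem.
split=> //; exists (range x0); apply: realised_type => //; first exact: small_ord.
Qed.

Lemma realised_interdef p : Sinv K p -> realised p -> interdef p unit_type.
Proof.
move=> ip [a pa]; have sa : small K (range a) by exact: small_ord.
have bp := realised_type ip.1 sa pa.
have [_ [B bB]] := unit_Sinv; have sAB := smallU nat_small K_limit sa bB.1.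
have x0 : 'I_0 -> U by case.
have Sa S : real_on (gset p) S a by move=> phi _ /pa.
have {}bp := base_sub (@subsetUl _ _ B) sAB bp.
have {}bB := base_sub (@subsetUr _ (range a) B) sAB bB.
exists (range a `|` B), a, x0; split.
- by split; split=> // *; exact: unit_real.
- by apply: subset_trans (@sub_dcl _ _ _) => z; left; left.
- by move=> z [[]].
Qed.

(** The empty tuple realises its type over every [S], so the single tuple [y] realises all of
    [p]. *)
Lemma dominated_unit p : Sinv K p -> dominates K unit_type p -> realised p.
Proof.
move=> ip /(dominatesP unit_Sinv ip)[A [x [y [bu bp _ H]]]].
exists y => phi pphi; have [S sS u] := uses_small phi.
have := H _ (smallU nat_small K_limit bp.1 sS) (@subsetUl _ A S) (unit_real _).
by apply=> //; apply: uses_sub u; exact: subsetUr.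
Qed.

Lemma interdef_unit_l p : Sinv K p -> interdef (tensor K unit_type p) p.
Proof.
move=> ip; have iu := unit_Sinv; have [A [sA bu bp]] := joint_base iu ip.
have [c b E] := tensor_type iu ip bu bp; have [x Ax] := real_ex c sA.
apply: (@interdef_range (tensor K unit_type p) p A x (rpart x)) => // [|S sS AS].
  rewrite -{1}[x]join_parts range_join; apply/seteqP; split=> z; last by right.
  by case=> // -[[]].
by rewrite (E _ _ sS AS); split=> [[]|] //; split=> //; exact: unit_real.
Qed.

Lemma interdef_unit_r p : Sinv K p -> interdef (tensor K p unit_type) p.
Proof.
move=> ip; have iu := unit_Sinv; have [A [sA bu bp]] := joint_base iu ip.
have [c b E] := tensor_type ip iu bp bu; have [x Ax] := real_ex c sA.
apply: (@interdef_range (tensor K p unit_type) p A x (lpart x)) => // [|S sS AS].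
  rewrite -{1}[x]join_parts range_join; apply/seteqP; split=> z; last by left.
  by case=> // -[[]].
have R : S :++ rpart x = S.
  by apply/seteqP; split=> z; [case=> // -[[]]|left].
by rewrite (E _ _ sS AS) /generic R; split=> [[]|] //; split=> //; exact: unit_real.
Qed.

(** * Invariant 1-types *)

Section OneTypes.
Variable ltf : formula L 'I_2.
Local Notation lt := (@rel_of L U ltf).
Hypothesis omin : o_minimal_structure lt.
Let lt_order : strict_linear_order lt. Proof. by case: omin. Qed.

Lemma cut_conj S x y : small K S -> lt x y ->
  (forall z, dcl S z -> ~ between lt x y z) -> exists2 s, fixes S s & s x = y.
Proof.
move=> sS xy H.
have key phi : uses S phi -> sat (either (fun=> x) id) phi ->
    sat (either (fun _ : 'I_1 => y) id) phi.
  move=> /def_of_uses[dD Ds] Dx; apply: contrapT => Dy.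
  by have [t [St xt ty]] := bd_between_dcl omin dD Ds xy Dx Dy; apply: (H t).
have [|s fs /(congr1 (fun f => f ord0)) e] :=
    homogeneity (x := fun _ : 'I_1 => x) (y := fun=> y) sS.
  move=> phi uphi; split; first exact: key.
  by move=> Hy; apply: contrapT => /(key _ (uses_not uphi)); exact.
by exists s.
Qed.

(** View [z] as the value at [w] of a function [G] definable over [S]. If [w] is a boundary point of
    the fibre of [z], it is definable from [z]. Otherwise [G] is constant near [w], and then [z] is
    fixed by all automorphisms fixing [S]. *)
Lemma exchange S w z : small K S -> dcl (S :+ w) z -> ~ dcl S z -> dcl (S :+ z) w.
Proof.
move=> sS wz Sz; have [irr tr tot] := lt_order.
have [phi [[chi ->] Hphi]] := dcl_isolated (small_add w sS) wz.
(* [F x y] is the formula isolating [z], with [x] substituted for the parameter [w]; it need not be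
   functional away from [w]. *)
pose F (x y : U) := sat (either (fun=> y) (fun u : (S :+ w) =>
  if pselect (set_val u = w) then x else set_val u)) chi.
have Fw y : F w y <-> y = z.
  rewrite -(Hphi (fun=> y)) sat_over /F.
  suff -> : (fun u : (S :+ w) => if pselect (set_val u = w) then w else set_val u) = set_val by [].
  by apply/funext => u; case: pselect.
have Faut s x y : fixes S s -> F x y -> F (s x) (s y).
  move=> [As fs]; rewrite /F -(sat_aut _ _ As); congr (sat _ _); apply/funext => -[//|u] /=.
  by case: pselect => // uw; case: (set_mem (valP u)) => [/fs//|].
have dF i j : definable (fun e : nat -> U => F (e i) (e j)).
  have := @definable_sat L U _ (either (fun=> inl j) (fun u : (S :+ w) =>
    if pselect (set_val u = w) then inl i else inr (set_val u))) chi.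
  apply: definable_ext => e; rewrite /F.
  set f := _ \o _; suff -> : f = either (fun=> e j)
    (fun u : (S :+ w) => if pselect (set_val u = w) then e i else set_val u) by [].
  by apply/funext => -[//|u]; rewrite /f /=; case: pselect.
pose G x y := F x y /\ forall y', F x y' -> y' = y.
have Gw y : G w y <-> y = z.
  split=> [[/Fw]//|->]; split; first exact/Fw.
  by move=> y' /Fw.
have Gfun x y y' : G x y -> G x y' -> y = y' by move=> [Fy _] [_]; apply.
have Gaut s x y : fixes S s -> G x y -> G (s x) (s y).
  move=> fs [Fy H]; split=> [|y' Fy']; first exact: Faut.
  have [t [ft sK tK]] := fixes_inv fs.
  by rewrite -[y']tK; congr (s _); apply: H; rewrite -[x]sK; exact: Faut.
have dG i j : definable (fun e : nat -> U => G (e i) (e j)).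
  apply: definable_and => //.
  apply: (definable_all (P := fun e => F (e i.+1) (e 0) -> e 0 = e j.+1)).
  by apply: definable_imp => //; exact: definable_eq.
have dlt i j : definable (fun e : nat -> U => lt (e i) (e j)).
  have := @definable_sat L U _ (fun k : 'I_2 => inl (if k == ord0 then i else j)) ltf.
  apply: definable_ext => e; rewrite /rel_of; set f := _ \o _.
  suff -> : f = pair_val (e i) (e j) by [].
  by apply/funext => k; rewrite /f /pair_val /=; case: ifP.
have dle i j : definable (fun e : nat -> U => le lt (e i) (e j)).
  by apply: definable_or => //; exact: definable_eq.
(* The points around which [G] is constant. Its boundary points lie in [dcl S], which is what
   confines [s w] below. *)
pose E x := exists y u v, [/\ lt u x, lt x v & forall t, le lt u t -> le lt t v -> G t y].
have dE : definable1 E.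
  apply: definable_unary.
  apply: (definable_ex (P := fun e => exists u v, [/\ lt u (e 1), lt (e 1) v &
    forall t, le lt u t -> le lt t v -> G t (e 0)])).
  apply: (definable_ex (P := fun e => exists v, [/\ lt (e 0) (e 2), lt (e 2) v &
    forall t, le lt (e 0) t -> le lt t v -> G t (e 1)])).
  apply: (definable_ex (P := fun e => [/\ lt (e 1) (e 3), lt (e 3) (e 0) &
    forall t, le lt (e 1) t -> le lt t (e 0) -> G t (e 2)])).
  apply: (@definable_ext L U (fun e => lt (e 1) (e 3) /\ lt (e 3) (e 0) /\
    forall t, le lt (e 1) t -> le lt t (e 0) -> G t (e 2))).
    by move=> e; split=> [[? [? ?]]|[]].
  apply: definable_and => //; apply: definable_and => //.
  apply: (definable_all (P := fun e => le lt (e 2) (e 0) -> le lt (e 0) (e 1) -> G (e 0) (e 3))).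
  by apply: definable_imp => //; apply: definable_imp.
have Eaut s x : fixes S s -> E x -> E (s x).
  move=> fs [y [u [v [ux xv H]]]]; have [t [ft sK tK]] := fixes_inv fs.
  exists (s y), (s u), (s v); split; [exact: lt_aut fs.1 _|exact: lt_aut fs.1 _|].
  have mono a b : le lt a b -> le lt (t a) (t b).
    by case=> [->|h]; [left|right; exact: lt_aut ft.1 _].
  move=> r /mono + /mono; rewrite !sK => ur rv; rewrite -[r]tK; apply: Gaut => //; exact: H.
have dZ : definable1 (fun x => G x z).
  apply: definable_unary; have [p Hp] := dG 0 1.
  exists (rename (either (fun n => if n is 0 then inl 0 else inr z) inr) p) => e.
  have := Hp (scons (e 0) (fun=> z)) => /= ->; rewrite sat_rename.
  set f := _ \o _; suff -> : f = either (scons (e 0) (fun=> z)) id by [].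
  by apply/funext => -[[|n]|].
have Zaut s x : fixes (S :+ z) s -> G x z -> G (s x) z.
  by move=> /fixes_of[fs sz] /(Gaut _ _ _ fs); rewrite sz.
case: (pselect (bd lt (fun x => G x z) w)) => [|wbd]; first exact: (bd_dcl omin).
have Ew : E w.
  apply: contrapT => nE; apply: wbd => -[u [v [uw wv H]]]; apply: nE.
  exists z, u, v; split=> // t ut tv; apply/H => //; exact/Gw.
(* [s] cannot move [w] past the points where [G] stops being locally constant. *)
have key s : fixes S s -> lt w (s w) -> s z = z.
  move=> fs ws; apply: contrapT => sz.
  have Zsw : ~ G (s w) z.
    have : G (s w) (s z) by apply: Gaut => //; exact/Gw.
    by move=> h h'; apply: sz; exact: Gfun h h'.
  have [B cB] := definable_const omin dZ.
  have [t [bt wt ts]] := bd_between lt_order cB ws (proj2 (Gw z) erefl) Zsw.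
  have nEt : ~ E t.
    move=> [y [u [v [ut tv H]]]]; apply: bt; exists u, v; split=> // r ur rv.
    have Gt := H t (or_intror ut) (or_intror tv); have Gr := H r ur rv.
    split=> h; [by rewrite -(Gfun _ _ _ Gr h)|by rewrite -(Gfun _ _ _ Gt h)].
  have {}wt : lt w t by case: wt => // e; case: nEt; rewrite -e.
  have [e [Se we et]] := bd_between_dcl omin dE Eaut wt Ew nEt.
  have se : s e = e := Se _ fs.
  case: we => [we|we]; first by apply: (irr w); rewrite {2}we -se -we.
  have := lt_aut fs.1 we; rewrite se => swe.
  exact: (lt_not_le lt_order swe) (le_trans lt_order et ts).
case: Sz => s fs; case: (tot w (s w)) => [|e|sw]; first exact: key.
  by apply: wz; exact: fixes_add.
have [t [ft sK tK]] := fixes_inv fs.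
have := lt_aut ft.1 sw; rewrite sK => /(key _ ft) e; by rewrite -[in LHS]e tK.
Qed.

(** * Nonrealised 1-types as cuts *)

Definition type1 (s : set (formula L ('I_1 + U))) : gtype U := @GType L U 1 s.
Definition tuple1 (x : U) : 'I_1 -> U := fun=> x.

Lemma c1E (x : 'I_1 -> U) : x = tuple1 (x ord0).
Proof. by apply/funext => i; rewrite ord1. Qed.

Lemma range_c1 x : range (tuple1 x) = [set x].
Proof. by apply/seteqP; split=> [_ [_ _ <-]|_ ->] //; exists ord0. Qed.

(** The properties shared by [lt] and its reverse, so that types just above an initial segment are
    covered by the results on final segments. *)
Definition good_order (lt' : U -> U -> Prop) := [/\ strict_linear_order lt',
  (forall s x y, automorphism s -> lt' x y -> lt' (s x) (s y)) &
  (forall S x y, small K S -> lt' x y -> (forall z, dcl S z -> ~ between lt' x y z) ->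
     exists2 s, fixes S s & s x = y)].

Lemma good_lt : good_order lt.
Proof.
split=> // [s x y|S x y sS xy H]; first exact: lt_aut.
exact: (cut_conj sS xy H).
Qed.

Lemma good_gt : good_order (fun x y => lt y x).
Proof.
split=> [|s x y|S x y sS yx H]; [exact: flip_order|exact: lt_aut|].
have [|s fs sy] := cut_conj sS yx.
  move=> z Sz [yz zx]; apply: (H z Sz); split; first by case: zx => ?; [left|right].
  by case: yz => ?; [left|right].
by have [t [ft sK tK]] := fixes_inv fs; exists t => //; rewrite -sy.
Qed.

Definition cut_type s A lt' R := [/\ invariant_base K (type1 s) A,
  (forall x y, R x -> lt' x y -> R y),
  (forall t x, fixes A t -> R x -> R (t x)) &
  forall S x, small K S -> A `<=` S -> real_on s S (tuple1 x) <-> low lt' R S x].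

Section Half.
Variables (s : set (formula L ('I_1 + U))) (A : set U).
Hypotheses (is_ : Sinv K (type1 s)) (ns : ~ realised (type1 s)) (bA : invariant_base K (type1 s) A).

(** Realisations over [S] are conjugate over [S], so one in [dcl S] is the only one and realises the
    whole type. *)
Lemma nonrealised_notin S x : small K S -> real_on s S (tuple1 x) -> ~ dcl S x.
Proof.
move=> sS Sx xS; apply: ns; exists (tuple1 x) => phi sphi.
have [S' sS' u] := uses_small phi.
have [y Sy] := real_ex is_.1 (smallU nat_small K_limit sS sS').
have [t ft ty] := real_conj is_.1 sS Sx (real_sub (@subsetUl _ _ _) Sy).
have -> : tuple1 x = y by rewrite -ty; apply/funext => i; rewrite /= xS.
by apply: Sy => //; apply: uses_sub u; exact: subsetUr.
Qed.

Section Order.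
Variables (lt' : U -> U -> Prop) (F : U -> formula L ('I_1 + U)).
Hypothesis good : good_order lt'.
Hypothesis satF : forall x u, sat (either (tuple1 x) id) (F u) <-> lt' x u.
Hypothesis usesF : forall S u, S u -> uses S (F u).

(** Realisations over [S] lie in the cut by comparison with the points of [dcl S]. Conversely the
    cut is a single orbit over [S], and this orbit contains a realisation. *)
Lemma half_cut x0 : real_on s A (tuple1 x0) -> s (F x0) -> cut_type s A lt' [set u | s (F u)].
Proof.
have [lo la cc] := good; move=> Ax0 Rx0; have sA := bA.1.
have key S x r : small K S -> real_on s S (tuple1 x) -> dcl S r -> s (F r) <-> lt' x r.
  move=> sS Sx Sr; rewrite -satF; apply: (real_onE (S := S :+ r) is_.1); last first.
    by apply: usesF; right.
  apply: (real_dcl is_.1 sS _ _ Sx); last by move=> _ ->.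
  by apply: small_finite => //; exact: finite_set1.
have R_up x y : s (F x) -> lt' x y -> s (F y).
  move=> sx xy; have sS : small K (A :+ x :+ y) by do 2!apply: small_add.
  have [z Sz] := real_ex is_.1 sS; rewrite (c1E z) in Sz.
  have h : lt' (z ord0) x by apply/(key _ _ x sS Sz) => //; apply: sub_dcl; left; right.
  apply/(key _ _ y sS Sz); first by apply: sub_dcl; right.
  by case: lo => _ tr _; exact: tr h xy.
have R_aut t x : fixes A t -> s (F x) -> s (F (t x)).
  move=> ft sx; have sS : small K (A :+ x) by exact: small_add.
  have [z Sz] := real_ex is_.1 sS; rewrite (c1E z) in Sz.
  have h : lt' (z ord0) x by apply/(key _ _ x sS Sz) => //; apply: sub_dcl; right.
  have tz := real_aut bA.2 (S := A :+ x) (@subsetUl _ _ _) ft Sz.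
  apply/(key _ (t (z ord0)) (t x) (small_image t sS) tz); first by apply: sub_dcl; exists x => //; right.
  by apply: la => //; case: ft.
have RL S x : small K S -> A `<=` S -> real_on s S (tuple1 x) -> low lt' [set u | s (F u)] S x.
  move=> sS AS Sx; split=> [|r Sr Rr]; last by apply/(key S).
  have [t ft /(congr1 (fun f => f ord0)) tx] := real_conj is_.1 sA Ax0 (real_sub AS Sx).
  have <- : t x0 = x := tx; exact: R_aut.
split=> // S x sS AS; split; first exact: RL.
have [z Sz] := real_ex is_.1 sS; rewrite (c1E z) in Sz.
have Lz := RL _ _ sS AS Sz => Lx.
have [t ft <-] := @low_conj L U (@small K U) lt' lo cc [set u | s (F u)] R_up S (z ord0) x sS Lz Lx.
exact: (real_fix ft Sz).
Qed.

End Order.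

(** Compare a realisation over [A] and [x] with [x], itself a realisation over [A]: they differ, and
    the side decides in which order the type lies below its final segment. *)
Lemma nonrealised_cut : exists lt' R, (lt' = lt \/ lt' = (fun x y => lt y x)) /\ cut_type s A lt' R.
Proof.
pose F1 (u : U) : formula L ('I_1 + U) := rename (fun k => if k == ord0 then inl ord0 else inr u) ltf.
pose F2 (u : U) : formula L ('I_1 + U) := rename (fun k => if k == ord0 then inr u else inl ord0) ltf.
have s1 x u : sat (either (tuple1 x) id) (F1 u) <-> lt x u.
  rewrite sat_rename /rel_of; set f := _ \o _; suff -> : f = pair_val x u by [].
  by apply/funext => k; rewrite /f /pair_val /=; case: ifP.
have s2 x u : sat (either (tuple1 x) id) (F2 u) <-> lt u x.
  rewrite sat_rename /rel_of; set f := _ \o _; suff -> : f = pair_val u x by [].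
  by apply/funext => k; rewrite /f /pair_val /=; case: ifP.
have u1 S u : S u -> uses S (F1 u).
  move=> Su; exists (rename (fun k => if k == ord0 then inl ord0 else inr (SigSub (mem_set Su))) ltf).
  by rewrite /Defs.over rename_comp; congr rename; apply/funext => k /=; case: ifP.
have u2 S u : S u -> uses S (F2 u).
  move=> Su; exists (rename (fun k => if k == ord0 then inr (SigSub (mem_set Su)) else inl ord0) ltf).
  by rewrite /Defs.over rename_comp; congr rename; apply/funext => k /=; case: ifP.
have sA := bA.1; have [x0 Ax0] := real_ex is_.1 sA; rewrite (c1E x0) in Ax0.
set x := x0 ord0 in Ax0; have sS := small_add x sA.
have [z Sz] := real_ex is_.1 sS; rewrite (c1E z) in Sz.
have Sx : (A :+ x) x by right.
have [_ _ tot] := lt_order; case: (tot (z ord0) x) => h.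
- exists lt, [set u | s (F1 u)]; split; first by left.
  apply: (half_cut good_lt s1 u1 Ax0).
  by apply/(real_onE is_.1 Sz (u1 _ _ Sx)); apply/s1.
- by case: (nonrealised_notin sS Sz); rewrite h; exact: sub_dcl.
- exists (fun x y => lt y x), [set u | s (F2 u)]; split; first by right.
  apply: (half_cut good_gt s2 u2 Ax0).
  by apply/(real_onE is_.1 Sz (u2 _ _ Sx)); apply/s2.
Qed.

End Half.
Lemma real_convex s A S y1 y2 t : Sinv K (type1 s) -> ~ realised (type1 s) ->
  invariant_base K (type1 s) A -> small K S -> A `<=` S ->
  real_on s S (tuple1 y1) -> real_on s S (tuple1 y2) -> le lt y1 t -> le lt t y2 -> real_on s S (tuple1 t).
Proof.
move=> is_ ns bA sS AS S1 S2 y1t ty2.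
have [lt' [R [lt'E [_ R_up _ E]]]] := nonrealised_cut is_ ns bA.
have [_ tr _] := lt_order.
move: S1 S2; rewrite !E // => -[Ry1 H1] [Ry2 H2].
case: lt'E R_up H1 H2 => -> R_up H1 H2; split.
- by case: y1t => [<-|]; [|exact: (R_up _ _ Ry1)].
- by move=> u Su Ru; exact: (le_lt_trans lt_order ty2 (H2 _ Su Ru)).
- by case: ty2 => [->|]; [|exact: (R_up _ _ Ry2)].
- by move=> u Su Ru; exact: (lt_le_trans lt_order (H1 _ Su Ru) y1t).
Qed.

(** * Nonorthogonality and definable functions *)

Lemma dcl_agree_tuple A n (b : 'I_n -> U) t s1 s2 : fixes A s1 -> fixes A s2 ->
  s1 \o b = s2 \o b -> dcl (A :++ b) t -> s1 t = s2 t.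
Proof.
move=> f1 f2 e tb; have [s2' [f2' sK s'K]] := fixes_inv f2.
rewrite -[s1 t]s'K; congr (s2 _); apply: (tb (s2' \o s1)).
have [Af ff] := fixes_comp f2' f1; split=> // x [/ff//|[i _ <-]] /=.
by have /(congr1 (fun f => f i)) /= -> := e; rewrite sK.
Qed.

Definition arrow p s := exists A b t, dom_at p (type1 s) A b (tuple1 t) /\ dcl (A :++ b) t.

Lemma arrow_dominates p s : Sinv K p -> Sinv K (type1 s) -> arrow p s -> dominates K p (type1 s).
Proof.
by move=> ip is_ [A [b [t [d _]]]]; apply/(dominatesP ip is_); exists A, b, (tuple1 t).
Qed.

Lemma definable_fiber n (phi : formula L ('I_(n + 1) + U)) (b : 'I_n -> U) :
  definable1 (fun t => sat (either (join b (tuple1 t)) id) phi).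
Proof.
exists (rename (either (fun i => either (inr \o b) inl (fintype.split i)) inr) phi).
apply/predeqP => t /=; rewrite sat_rename; set f := _ \o _.
suff -> : f = either (join b (tuple1 t)) id by [].
by apply/funext => -[i|//]; rewrite /f /join /=; case: (fintype.split i).
Qed.

Lemma bd_not (D : U -> Prop) t : bd lt (fun x => ~ D x) t -> bd lt D t.
Proof.
move=> H [u [v [ut tv E]]]; apply: H; exists u, v; split=> // x ux xv.
by rewrite (E x ux xv).
Qed.

(** If every boundary point failed over some set, one [S] would refute the finitely many of them.
    Over [S] there are realisations of [s] on both sides of one fibre, and by convexity a boundary
    point between them realises [s] over [S]; moved back to [b], it contradicts the choice of
    [S]. *)
Lemma nonorth_arrow p s : Sinv K p -> Sinv K (type1 s) -> ~ realised (type1 s) ->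
  ~ weakly_orthogonal p (type1 s) -> arrow p s.
Proof.
move=> ip is_ ns; rewrite (orthP ip is_) => /existsNP[phi /not_implyP[tphi /forallNP HS]].
have [A0 [sA0 bp0 bs0]] := joint_base ip is_.
have [S0 sS0 u0] := uses_small phi.
have sA := smallU nat_small K_limit sA0 sS0; pose A := A0 `|` S0.
have bp := base_sub (@subsetUl _ A0 S0) sA bp0; have bs := base_sub (@subsetUl _ A0 S0) sA bs0.
have {u0} uphi : uses A phi by apply: uses_sub u0; exact: subsetUr.
have [b Ab] := real_ex ip.1 sA.
pose D (x : 'I_(gdim p) -> U) t := sat (either (join x (tuple1 t)) id) phi.
have Daut x t sg : fixes A sg -> D x t -> D (sg \o x) (sg t).
  move=> fs; rewrite /D; have -> : join (sg \o x) (tuple1 (sg t)) = sg \o join x (tuple1 t).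
    by rewrite comp_join.
  by have [_] := sat_either_aut (join x (tuple1 t)) fs uphi.
have bdaut x t sg : fixes A sg -> bd lt (D x) t -> bd lt (D (sg \o x)) (sg t).
  move=> fs; have [sg' [fs' sK s'K]] := fixes_inv fs.
  move=> bt [u [v [ut tv E]]]; apply: bt; exists (sg' u), (sg' v); split.
  - by rewrite -[t]sK; apply: lt_aut ut; case: fs'.
  - by rewrite -[t]sK; apply: lt_aut tv; case: fs'.
  have Deq w : D x w <-> D (sg \o x) (sg w).
    split; first exact: Daut.
    move=> /(Daut _ _ _ fs'); rewrite sK.
    by have -> : sg' \o (sg \o x) = x by apply/funext => i /=; rewrite sK.
  have mono w w' : le lt w w' -> le lt (sg w) (sg w').
    by case=> [->|h]; [left|right; apply: lt_aut h; case: fs].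
  by move=> w /mono + /mono; rewrite !s'K !Deq; exact: E.
have bdcl t : bd lt (D b) t -> dcl (A :++ b) t.
  apply: bd_dcl => //; first exact: definable_fiber.
  move=> sg x fs; have := Daut b x sg (fixes_sub (@subsetUl _ _ _) fs).
  have -> // : sg \o b = b by apply/funext => i /=; case: fs => _; apply; right; exists i.
have [B HB] := bd_definable omin (definable_fiber phi b).
apply: contrapT => nar.
have bad t : bd lt (D b) t -> exists S, [/\ small K S, A `<=` S, real_on (gset p) S b & ~ real_on s S (tuple1 t)].
  move=> bt; apply: contrapT => H; apply: nar; exists A, b, t; split; last exact: bdcl.
  split=> // S sS AS Sb; apply: contrapT => nt; apply: H; by exists S.
have [S [sS AS HS']] : exists S, [/\ small K S, A `<=` S & forall t, List.In t B -> bd lt (D b) t ->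
    exists S', [/\ small K S', A `<=` S', S' `<=` S, real_on (gset p) S' b & ~ real_on s S' (tuple1 t)]].
  elim: (B) => [|t B' [S [sS AS IH]]]; first by exists A; split=> // t [].
  case: (pselect (bd lt (D b) t)) => bt; last first.
    by exists S; split=> // t' [<-//|]; exact: IH.
  have [S' [sS' AS' Sb nt]] := bad t bt.
  exists (S `|` S'); split=> [||t' [<- _|t'B bt']]; first exact: smallU.
  - by move=> x /AS; left.
  - by exists S'; split=> //; exact: subsetUr.
  - have [S'' [? ? SS ? ?]] := IH t' t'B bt'; exists S''; split=> //.
    by move=> x /SS; left.
have /not_andP[//|/existsNP[z /not_implyP[zp /not_implyP[zs nz]]]] := HS S.
(* [z] violates [phi] while the generic [z'] satisfies it; [sg] gives the two pairs the same first
   part. *)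
have [z' Gz'] := gen_ex ip.1 is_.1 sS.
have pz' : D (lpart z') (rpart z' ord0).
  rewrite /D -c1E join_parts; exact/(tensor_sat ip is_.1 bp sS AS (uses_sub AS uphi) Gz').
have [Gr Gl] := Gz'.
have [sg fsg sz] := real_conj ip.1 sS (real_sub (@subsetUl _ _ _) Gl) zp.
have {}pz' : D (lpart z) (sg (rpart z' ord0)).
  by rewrite -sz; apply: Daut => //; exact: fixes_sub fsg.
have {nz} nz : ~ D (lpart z) (rpart z ord0) by rewrite /D -c1E join_parts.
have S1 : real_on s S (tuple1 (sg (rpart z' ord0))).
  by have := real_fix fsg Gr; rewrite {1}(c1E (rpart z')).
have S2 : real_on s S (tuple1 (rpart z ord0)) by rewrite -c1E.
have [E cE] := definable_const omin (definable_fiber phi (lpart z)).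
have cE' : const_on lt E (fun t => ~ D (lpart z) t).
  by move=> x y xy H; rewrite /D (cE x y xy H).
have [t [bt St]] : exists t, bd lt (D (lpart z)) t /\ real_on s S (tuple1 t).
  have [_ _ tot] := lt_order; case: (tot (rpart z ord0) (sg (rpart z' ord0))) => h.
  - have [|t [bt t1 t2]] := bd_between lt_order cE' h nz; first by move=> h'; exact: h'.
    by exists t; split; [exact: bd_not|exact: real_convex bs sS AS S2 S1 t1 t2].
  - by case: nz; rewrite h.
  - have [t [bt t1 t2]] := bd_between lt_order cE h pz' nz.
    by exists t; split; [|exact: real_convex bs sS AS S1 S2 t1 t2].
have [tau ftau tb] := real_conj ip.1 sA Ab (real_sub AS zp).
have [tau' [ftau' tK t'K]] := fixes_inv ftau.
have bt0 : bd lt (D b) (tau' t).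
  have := bdaut _ _ _ ftau' bt; rewrite -tb.
  by have -> : tau' \o (tau \o b) = b by apply/funext => i /=; rewrite tK.
have [S' [sS' AS' SS' Sb nt]] := HS' _ (HB _ bt0) bt0.
(* Boundary points are definable from [b] over [A], so [rho] and [tau], which agree on [b], send
   [tau' t] to the same point [t]. *)
have [rho frho rb] := real_conj ip.1 sS' Sb (real_sub SS' zp).
have rt : rho (tau' t) = t.
  rewrite -[RHS]t'K; apply: (dcl_agree_tuple (fixes_sub AS' frho) ftau _ (bdcl _ bt0)).
  by rewrite rb tb.
have [rho' [frho' rK r'K]] := fixes_inv frho.
apply: nt; have := real_fix frho' (real_sub SS' St).
by rewrite (_ : rho' \o tuple1 t = tuple1 (tau' t)) //; apply/funext => i /=; rewrite -[in LHS]rt /tuple1 rK.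
Qed.

Lemma self_nonorth s : Sinv K (type1 s) -> ~ realised (type1 s) -> ~ weakly_orthogonal (type1 s) (type1 s).
Proof.
move=> is_ ns; rewrite (orthP is_ is_) => /(_ (Not (Eq (Var (inl (lshift 1 ord0)))
  (Var (inl (rshift 1 ord0))))))[|S [sS H]].
  have [_ [A bA]] := is_; have [z Gz] := gen_ex is_.1 is_.1 bA.1.
  apply/(tensor_sat is_ is_.1 bA bA.1 (@subset_refl _ _) _ Gz).
    by exists (Not (Eq (Var (inl (lshift 1 ord0))) (Var (inl (rshift 1 ord0))))).
  apply/sat_not => /= e; have [_ Gl] := Gz; rewrite (c1E (lpart z)) in Gl.
  apply: (nonrealised_notin is_ ns _ Gl); first exact: (small_tuple _ bA.1).
  by apply: sub_dcl; right; exists ord0.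
have [x Sx] := real_ex is_.1 sS.
have := H (join x x); rewrite lpart_join rpart_join => /(_ Sx Sx)/sat_not; apply => /=.
by rewrite /join (unsplitK (inl _)) (unsplitK (inr _)).
Qed.

Lemma dominates_nonorth p s : Sinv K p -> Sinv K (type1 s) -> ~ realised (type1 s) ->
  dominates K p (type1 s) -> ~ weakly_orthogonal p (type1 s).
Proof.
by move=> ip is_ ns d o; apply: (self_nonorth is_ ns); exact: (orth_dominates ip is_ is_ d o).
Qed.

(** [t] is not in [dcl A], so by exchange [b] is definable from [t]. A realisation of [s'] over [S]
    that is conjugate to [b] and has the image [t] must then be [b]. *)
Lemma arrow_interdef s' s : Sinv K (type1 s') -> Sinv K (type1 s) -> ~ realised (type1 s) ->
  arrow (type1 s') s -> interdef (type1 s') (type1 s).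
Proof.
move=> is' is_ ns [A [b [t [d tb]]]]; have [bs' bs Ab H] := d; have sA := bs.1.
have At := dom_real d; rewrite (c1E b) range_c1 in tb; set x := b ord0 in tb.
have tA := nonrealised_notin is_ ns sA At.
have xt := exchange sA tb tA.
have bx : b = tuple1 x := c1E b.
exists A, b, (tuple1 t); split; last 1 first.
- by rewrite range_c1 bx range_c1 => _ ->.
- split=> //; split=> // S sS AS St.
  have [b' Sb'] := real_ex is'.1 sS.
  have [sg fsg sb] := real_conj is'.1 sA Ab (real_sub AS Sb').
  have [_ _ _ Hs] := dom_move d fsg; rewrite sb in Hs.
  have [rho frho rt] := real_conj is_.1 sS (Hs S sS AS Sb') St.
  have -> : b = rho \o b'.
    rewrite -sb bx; apply/funext => i /=; rewrite -[LHS](_ : rho (sg x) = _) //.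
    apply: (xt (rho \o sg)); apply: fixes_add; first exact: fixes_comp (fixes_sub AS frho) fsg.
    by have /(congr1 (fun f => f ord0)) := rt.
  exact: real_fix.
- by rewrite range_c1 bx range_c1 => _ ->.
Qed.

Lemma arrow_enlarge p s B : Sinv K p -> Sinv K (type1 s) -> arrow p s -> small K B ->
  exists A b t, [/\ B `<=` A, dom_at p (type1 s) A b (tuple1 t) & dcl (A :++ b) t].
Proof.
move=> ip is_ [A [b [t [d tb]]]] sB; have [[sA _] _ _ _] := d.
have sAB := smallU nat_small K_limit sA sB; have [b' Ab'] := real_ex ip.1 sAB.
have [sg [fs sb d']] := dom_enlarge ip.1 (@subsetUl _ A B) sAB Ab' d.
exists (A `|` B), b', (sg t); split; [exact: subsetUr|exact: d'|].
have := range_dcl_move fs (x := tuple1 t) (y := b) _; rewrite range_c1 => /(_ (fun _ e => eq_ind_r _ tb e)).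
rewrite sb => h; have : dcl (A :++ b') (sg t) by apply: h; exists ord0.
by apply: dcl_mono => y [|]; [left; left|right].
Qed.

Lemma arrow_tensor s0 r s : Sinv K (type1 s0) -> Sinv K r -> Sinv K (type1 s) -> ~ realised (type1 s) ->
  arrow (tensor K (type1 s0) r) s -> arrow (type1 s0) s \/ arrow r s.
Proof.
move=> is0 ir is_ ns ar; apply: contrapT => /not_orP[nar0 narr].
have [B [sB b0 br0]] := joint_base is0 ir.
have [A [z [t [BA d tz]]]] := arrow_enlarge (Sinv_tensor is0 ir) is_ ar sB.
have [btt bs Az _] := d; have sA := bs.1.
have {b0} bs0 := base_sub BA sA b0; have {br0} br := base_sub BA sA br0.
have [_ _ E] := tensor_type is0 ir bs0 br.
set b := rpart z; set c := lpart z ord0.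
have zE : z = join (tuple1 c) b by rewrite -c1E join_parts.
have [Ab Ac] := proj1 (E _ _ sA (@subset_refl _ _)) Az; rewrite -/b (c1E (lpart z)) -/c in Ab Ac.
pose C := A :++ b; have sC : small K C by exact: small_tuple.
have AC : A `<=` C by exact: subsetUl.
have tC : dcl (C :+ c) t.
  by move: tz; rewrite zE range_join range_c1 /C -setUA [range b `|` _]setUC.
have fixC sg : fixes C sg -> fixes A sg /\ sg \o b = b.
  move=> [As fs]; split; first by split=> // x /AC/fs.
  by apply/funext => i /=; apply: fs; right; exists i.
have H S sg : small K S -> A `<=` S -> fixes C sg -> real_on (gset r) S b ->
    real_on s0 (S :++ b) (tuple1 (sg c)) -> real_on s S (tuple1 (sg t)).
  move=> sS AS /fixC[fs sb] Sb Sc; have [_ _ _] := dom_move d fs; apply=> //.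
  apply/E => //; have -> : sg \o z = join (tuple1 (sg c)) b by rewrite zE comp_join sb.
  by split; rewrite rpart_join ?lpart_join.
have [lt' [R [lt'E [_ R_up _ RE]]]] := nonrealised_cut is_ ns bs.
have [lo la _] : good_order lt' by case: lt'E => ->; [exact: good_lt|exact: good_gt].
have lt'inv sg x y : automorphism sg -> lt' (sg x) (sg y) -> lt' x y.
  move=> As h; have [sg' [As' sK _]] := aut_inv As.
  by rewrite -[x]sK -[y]sK; exact: la.
have notlt x y : ~ lt' x y -> x = y \/ lt' y x by case: lo => _ _ /(_ x y)[]; tauto.
have Rt : R t by have [] := proj1 (RE _ _ sA (@subset_refl _ _)) (dom_real d).
(* A point [u] of [R] definable from [b] and at or below [t] would give an arrow from [r]: with [c]
   chosen generic last, [u] stays at or below a realisation of [s]. *)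
have st : real_on s C (tuple1 t).
  apply/RE => //; split=> // u Cu Ru; apply: contrapT => tu; apply: narr.
  exists A, b, u; split=> //; split=> // S sS AS Sb.
  have [c' Sc'] := real_ex is0.1 (small_tuple b sS).
  have CS : C `<=` S :++ b by move=> x [/AS|]; [left|right].
  have [sg fs scc] := real_conj is0.1 sC Ac (real_sub CS Sc').
  rewrite -scc in Sc'; have /(RE _ _ sS AS) lst := H S sg sS AS fs Sb Sc'.
  apply/RE => //; have su : sg u = u by exact: Cu.
  have : ~ lt' (sg t) (sg u) by move=> /lt'inv; case: fs => As _ /(_ As).
  rewrite su => /notlt[<-//|h]; exact: (low_lt lo Ru h lst).
(* Over the base [C] the point [t] is a function of [c] alone; as [s0] has no arrow, this function
   fails to preserve genericity at some [S1]. *)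
have [S1 [sS1 CS1 Sc1 nt1]] : exists S1, [/\ small K S1, C `<=` S1, real_on s0 S1 (tuple1 c) & ~ real_on s S1 (tuple1 t)].
  apply: contrapT => h; apply: nar0; exists C, (tuple1 c), t; split; last by rewrite range_c1.
  split=> // [||S sS CS Sc]; [exact: base_sub bs0|exact: base_sub bs|].
  by apply: contrapT => nt; apply: h; exists S.
have [u [Su Ru tu]] : exists u, [/\ dcl S1 u, R u & ~ lt' t u].
  apply: contrapT => h; apply: nt1; apply/RE => //; first by exact: subset_trans CS1.
  split=> // u Su Ru; apply: contrapT => tu; apply: h; by exists u.
have ut : real_on s C (tuple1 u).
  apply/RE => //; move: st; rewrite RE // => lt_.
  by case: (notlt _ _ tu) => [<-//|h]; exact: (low_lt lo Ru h lt_).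
have orth_rs : weakly_orthogonal r (type1 s).
  by apply: contrapT => no; apply: narr; exact: nonorth_arrow.
(* As [r] and [s] commute, [t1] can be taken in the cut over [b] and [b] generic over [t1].  The
   point attached to a generic [c] would then have to lie both below and not below [t1]. *)
have [t1 [Ct1 bt1]] : exists t1, real_on s C (tuple1 t1) /\ real_on (gset r) (A :+ t1) b.
  have [ctr btr Etr] := tensor_type is_ ir bs br.
  have [_ _ Ert] := tensor_type ir is_ br bs.
  have [w Aw] := real_ex ctr sA.
  have [wb wt] := proj1 (Etr _ _ sA (@subset_refl _ _)) Aw.
  have := proj1 (orth_real_swap A w ir is_ orth_rs) Aw.
  move=> /(Ert _ _ sA (@subset_refl _ _))[]; rewrite rpart_join lpart_join => _ wb'.
  have [sg fs sb] := real_conj ir.1 sA wb Ab.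
  exists (sg (lpart w ord0)); split.
    by have := real_move_tuple bs (@subset_refl _ _) fs wt; rewrite sb {1}(c1E (lpart w)).
  have := real_move_tuple br (@subset_refl _ _) fs wb'; rewrite sb.
  by rewrite (c1E (lpart w)) (_ : sg \o _ = tuple1 (sg (lpart w ord0))) // range_c1.
have [sg fsg /(congr1 (fun f => f ord0)) su] := real_conj is_.1 sC ut Ct1.
have {}su : sg u = t1 := su.
have CdS : C `<=` dcl S1 by move=> x /CS1/sub_dcl.
have Cu : real_on s0 (C :+ u) (tuple1 c).
  have sSu : small K [set u] by apply: small_finite => //; exact: finite_set1.
  have := real_dcl is0.1 sS1 sSu (S' := [set u]) _ Sc1.
  move=> /(_ (fun x (e : x = u) => eq_ind_r (dcl S1) Su e)).
  by apply: real_sub => x [/CS1|]; [left|right].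
have Csc : real_on s0 (C :+ t1) (tuple1 (sg c)).
  have := real_move (p := type1 s0) (x := tuple1 c) bs0 AC fsg Cu.
  by rewrite image_set1 su.
have sCt := small_add t1 sC; have sAt := small_add t1 sA.
have := H (A :+ t1) sg sAt (@subsetUl _ _ _) fsg bt1.
have -> : A :+ t1 :++ b = C :+ t1 by rewrite /C -!setUA [_ `|` range b]setUC.
move=> /(_ Csc) /(RE _ _ sAt (@subsetUl _ _ _))[_ /(_ t1)].
have [Rt1 _] := proj1 (RE _ _ sC AC) Ct1.
move=> /(_ (@dcl_add _ _ _ _) Rt1); rewrite -su => /lt'inv; case: fsg => As _ /(_ As); exact: tu.
Qed.

(** * Idempotence of 1-types *)

Lemma dcl_finite S a z : small K S -> dcl (S :+ a) z -> exists l : seq U,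
  (forall u, List.In u l -> S u) /\ dcl ([set u | List.In u l] :+ a) z.
Proof.
move=> sS /(dcl_isolated (small_add a sS))[phi [[psi ->] Hphi]].
have [k [chi [t e]]] := instP (SigSub (mem_set (or_intror erefl : (S :+ a) a))) psi; subst psi.
exists [seq u <- [seq set_val (t i) | i <- enum 'I_k] | `[< S u >]]; split.
  by move=> u /List.filter_In[_ /asboolP].
have tl i : ([set u | List.In u [seq u <- [seq set_val (t i) | i <- enum 'I_k] | `[< S u >]]] :+ a) (set_val (t i)).
  have [Sti|ta] := set_mem (valP (t i)); last by right.
  left; apply/List.filter_In; split; last exact/asboolP.
  have : i \in enum 'I_k by rewrite mem_enum.
  elim: (enum _) => //= j e IH; rewrite in_cons => /orP[/eqP<-|/IH]; by [left|right].
move=> sg fs; have E : Defs.over (inst chi t) = inst chi (fun i => set_val (t i)).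
  by rewrite /Defs.over /inst rename_comp; congr rename; apply/funext => -[].
rewrite E in Hphi; apply/(Hphi (tuple1 (sg z))).
by apply/(sat_either_aut (tuple1 z) fs (usesP _ tl))/Hphi.
Qed.

Lemma idempotent s : Sinv K (type1 s) -> ~ realised (type1 s) ->
  equidominant K (type1 s) (tensor K (type1 s) (type1 s)).
Proof.
move=> is_ ns; have [_ [A bA]] := is_; have sA := bA.1.
have [lt' [R [lt'E [_ R_up R_aut RE]]]] := nonrealised_cut is_ ns bA.
have [lo la cc] : good_order lt' by case: lt'E => ->; [exact: good_lt|exact: good_gt].
have [|||||S f sS|N [AN sN HN]] := @coinitial_small L U (@small K U) lt' lo la _ _ _ cc _ A R sA R_up R_aut.
- by move=> S S' SS'; exact: small_sub.
- by move=> S x sS; exact: (small_add x sS).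
- by move=> S l sS; exact: (smallU_list l sS).
- by move=> S x y sS; exact: (exchange sS).
- move=> S sS AS; have [x Sx] := real_ex is_.1 sS.
  by exists (x ord0); apply/RE => //; rewrite -c1E.
- apply: (smallU nat_small K_limit sS); apply: small_countable => //.
  have -> : [set x | exists n, List.In x (f n)] = \bigcup_n [set x | List.In x (f n)].
    by apply/seteqP; split=> [x [n xn]|x [n _ xn]]; exists n.
  by apply: bigcup_countable => // n _; exact/finite_set_countable/list_finite.
have bN := base_sub AN sN bA.
have [a Na] := real_ex is_.1 sN; rewrite (c1E a) in Na.
have [x Nx] := real_ex is_.1 (small_tuple a sN); rewrite (c1E x) in Nx.
have it := Sinv_tensor is_ is_; have [_ btt E] := tensor_type is_ is_ bN bN.
apply/(equidominantP is_ it).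
(* The genericity of [a] over [S] forces that of the whole pair: a point of [R] definable from [a]
   over [S] uses finitely many parameters, so it has one definable over [N] and [a] at or below it,
   and [x] is below the latter. *)
have G S : small K S -> N `<=` S -> real_on s S a -> @generic (type1 s) (type1 s) S (join x a).
  move=> sS NS Sa; split; rewrite rpart_join // lpart_join.
  have sSa := small_tuple a sS; have AS := subset_trans AN NS.
  have ASa : A `<=` S :++ a by move=> y /AS; left.
  rewrite (c1E x); apply/RE => //.
  have [Rx Hx] : low lt' R (N :++ a) (x ord0) by apply/RE => //; [exact: small_tuple|move=> y /AN; left].
  split=> // z za Rz; move: za; rewrite {1}(c1E a) range_c1 => /(dcl_finite sS)[l [lS lz]].
  have La : low lt' R (N `|` [set u | List.In u l]) (a ord0).
    apply/RE; [exact: (smallU_list l sN)|by move=> y /AN; left|].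
    by rewrite -c1E; apply: real_sub Sa => y [/NS|/lS].
  have [|z' [Nz' Rz' zz']] := HN l _ La z _ Rz.
    by apply: dcl_mono lz => y [|]; [left; right|right].
  have xz' : lt' (x ord0) z' by apply: Hx => //; rewrite {1}(c1E a) range_c1.
  have [_ tr tot] := lo; case: (tot z z') => [//|->//|]; exact: tr.
exists N, a, (join x a); split; split=> //.
- by rewrite [a]c1E.
- move=> S sS NS Sa; apply/E => //; exact: G.
- by apply/E => //; apply: G => //; rewrite [a]c1E.
- by move=> S sS NS /E[//|//|]; rewrite rpart_join.
Qed.

(** * Products of orthogonal 1-types *)

Implicit Types (x y : gtype U) (l : seq (gtype U)).

Lemma dim1E p : gdim p = 1 -> exists s, p = type1 s.
Proof. by case: p => n s /= n1; subst n; exists s. Qed.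

Lemma nonorthP p x : Sinv K p -> Sinv1 K x -> ~ realised x ->
  ~ weakly_orthogonal p x <-> dominates K p x.
Proof.
move=> ip [ix /dim1E[s xs]]; subst x => nx; split; last by move=> d; exact: (dominates_nonorth ip ix nx d).
by move=> no; apply: (arrow_dominates ip ix); exact: (nonorth_arrow ip ix nx no).
Qed.

Lemma dominates_interdef y x : Sinv1 K y -> Sinv1 K x -> ~ realised x ->
  dominates K y x -> interdef y x.
Proof.
move=> [iy /dim1E[s' ys]] [ix /dim1E[s xs]]; subst x y => nx d.
apply: (arrow_interdef iy ix nx); apply: (nonorth_arrow iy ix nx).
exact: (dominates_nonorth iy ix nx d).
Qed.

Lemma dominates_split y r x : Sinv1 K y -> Sinv K r -> Sinv1 K x -> ~ realised x ->
  dominates K (tensor K y r) x -> dominates K y x \/ dominates K r x.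
Proof.
move=> [iy /dim1E[s' ys]] ir [ix /dim1E[s xs]]; subst x y => nx d.
have iyr := Sinv_tensor iy ir.
have no := dominates_nonorth iyr ix nx d.
have ar := nonorth_arrow iyr ix nx no.
by have [h|h] := arrow_tensor iy ir ix nx ar; [left|right]; exact: arrow_dominates.
Qed.

Lemma tensor_idempotent x : Sinv1 K x -> ~ realised x -> equidominant K x (tensor K x x).
Proof. by move=> [ix /dim1E[s xs]]; subst x; exact: idempotent. Qed.

Lemma nonorth_self x : Sinv1 K x -> ~ realised x -> ~ weakly_orthogonal x x.
Proof. by move=> [ix /dim1E[s xs]]; subst x; exact: self_nonorth. Qed.

Lemma interdef_dominates p q : Sinv K p -> Sinv K q -> interdef p q -> dominates K p q.
Proof. by move=> ip iq /(interdef_equidominant ip iq)/equidominant_dominates. Qed.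

Lemma dominates_proj_r p q : Sinv K p -> Sinv K q -> dominates K (tensor K p q) q.
Proof.
move=> ip iq; have ipq := Sinv_tensor ip iq.
have [A [sA bp bq]] := joint_base ip iq; have [c b E] := tensor_type ip iq bp bq.
have [z Az] := real_ex c sA; apply/(dominatesP ipq iq).
by exists A, z, (rpart z); split=> // S sS AS /(E _ _ sS AS)[].
Qed.

Lemma dominates_proj_l p q : Sinv K p -> Sinv K q -> dominates K (tensor K p q) p.
Proof.
move=> ip iq; have ipq := Sinv_tensor ip iq.
have [A [sA bp bq]] := joint_base ip iq; have [c b E] := tensor_type ip iq bp bq.
have [z Az] := real_ex c sA; apply/(dominatesP ipq ip).
exists A, z, (lpart z); split=> // S sS AS /(E _ _ sS AS)[_].
by apply: real_sub; exact: subsetUl.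
Qed.

Lemma orth_unit p : Sinv K p -> weakly_orthogonal p unit_type.
Proof.
move=> ip; have iu : Sinv K unit_type := unit_Sinv.
apply/(orthP ip iu) => phi tphi; have [_ [A bA]] := ip.
have [S sS u] := uses_small phi.
have sAS := smallU nat_small K_limit bA.1 sS; exists (A `|` S); split=> // z zp zu.
have {}u : uses (A `|` S) phi by apply: uses_sub u; exact: subsetUr.
apply/(tensor_sat ip iu.1 bA sAS (@subsetUl _ _ _) u) => //; split=> //.
by apply: real_sub zp => v [//|[[]]].
Qed.

(** Bracketed to the right and ended by the empty type, which suits induction on lists and lets the
    empty list stand for realised types. *)
Fixpoint tensor_prod l : gtype U := if l is x :: l' then tensor K x (tensor_prod l') else unit_type.

Definition all_Sinv l := forall x, List.In x l -> Sinv K x.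

Lemma Sinv_prod l : all_Sinv l -> Sinv K (tensor_prod l).
Proof.
elim: l => [|x l IH] H /=; first exact: unit_Sinv.
by apply: Sinv_tensor; [apply: H; left|apply: IH => y yl; apply: H; right].
Qed.

Lemma all_cons x l : all_Sinv (x :: l) -> Sinv K x /\ all_Sinv l.
Proof. by move=> H; split=> [|y yl]; apply: H; [left|right]. Qed.

Lemma prod_cat l l' : all_Sinv l -> all_Sinv l' ->
  interdef (tensor K (tensor_prod l) (tensor_prod l')) (tensor_prod (l ++ l')).
Proof.
move=> + il'; have ip' := Sinv_prod il'; elim: l => [|x l IH]; first by move=> _; exact: interdef_unit_l.
move=> /all_cons[ix il] /=; have ip := Sinv_prod il.
have ill : all_Sinv (l ++ l') by move=> y /in_cat_iff[/il|/il'].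
have ipp := Sinv_prod ill.
apply: (interdef_trans (q := tensor K x (tensor K (tensor_prod l) (tensor_prod l')))).
- by apply: Sinv_tensor => //; exact: Sinv_tensor.
- by apply: Sinv_tensor => //; exact: Sinv_tensor.
- exact/interdef_sym/interdef_assoc.
- by apply: interdef_tensor_r => //; [exact: Sinv_tensor|exact: IH].
Qed.

(** * Products over an orthogonal family *)

Section Family.
Variable X : set (gtype U).
Hypothesis orthX : orthogonal_family K X.

Let X1 x : X x -> Sinv1 K x. Proof. by move=> /(orthX.1 _)[]. Qed.
Let Xi x : X x -> Sinv K x. Proof. by move=> /X1[]. Qed.
Let Xn x : X x -> ~ realised x. Proof. by move=> /(orthX.1 _)[]. Qed.

Definition inX l := forall x, List.In x l -> X x.

Lemma inX_Sinv l : inX l -> all_Sinv l. Proof. by move=> h x /h/Xi. Qed.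

Lemma inX_cons x l : inX (x :: l) -> X x /\ inX l.
Proof. by move=> H; split=> [|y yl]; apply: H; [left|right]. Qed.

Lemma dominates_X x y : X x -> X y -> dominates K x y -> x = y.
Proof.
move=> Xx Xy /(nonorthP (Xi Xx) (X1 Xy) (Xn Xy)) no; apply: contrapT => xy.
by apply: no; exact: (orthX.2 _ _ Xx Xy xy).
Qed.

(** The trailing factor [q] is arbitrary, because later only the left factor of a product can be
    replaced by a list. *)
Lemma prod_tensor_dominates l q x : inX l -> Sinv K q -> X x ->
  dominates K (tensor K (tensor_prod l) q) x -> List.In x l \/ dominates K q x.
Proof.
move=> + iq Xx; have dtr (a b c : gtype U) : Sinv K a -> Sinv K b -> Sinv K c -> dominates K a b -> dominates K b c -> dominates K a c.
  by move=> ia ib ic; exact: (dominates_trans ia ib ic).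
elim: l => [_|y l IH /inX_cons[Xy Xl]] d.
  right; apply: dtr d; [by []|apply: Sinv_tensor => //; exact: unit_Sinv|exact: Xi|].
  apply: interdef_dominates => //; first by apply: Sinv_tensor => //; exact: unit_Sinv.
  exact/interdef_sym/interdef_unit_l.
have ip := Sinv_prod (inX_Sinv Xl); have iy := Xi Xy; have ipq := Sinv_tensor ip iq.
have {}d : dominates K (tensor K y (tensor K (tensor_prod l) q)) x.
  apply: dtr d; [exact: Sinv_tensor|by apply: Sinv_tensor => //; exact: Sinv_tensor|exact: Xi|].
  apply: interdef_dominates; [exact: Sinv_tensor|by apply: Sinv_tensor => //; exact: Sinv_tensor|].
  exact: interdef_assoc.
have [h|h] := dominates_split (X1 Xy) ipq (X1 Xx) (Xn Xx) d.
  by left; left; exact: dominates_X.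
by have [?|?] := IH Xl h; [left; right|right].
Qed.

Lemma prod_dominatesP l x : inX l -> X x -> dominates K (tensor_prod l) x <-> List.In x l.
Proof.
move=> Xl Xx; have iu := unit_Sinv; have ip := Sinv_prod (inX_Sinv Xl).
split=> [d|].
  have [|//|] := @prod_tensor_dominates l unit_type x Xl iu Xx.
    have ipu := Sinv_tensor ip iu.
    by apply: (dominates_trans ipu ip (Xi Xx) _ d); exact: dominates_proj_l.
  by move=> /(dominated_unit (Xi Xx)) /(Xn Xx).
elim: l Xl ip => [//|y l IH] /inX_cons[Xy Xl] _ /=; have ip := Sinv_prod (inX_Sinv Xl).
have iyp := Sinv_tensor (Xi Xy) ip.
case=> [<-|xl]; first exact: (dominates_proj_l (Xi Xy) ip).
apply: (dominates_trans iyp ip (Xi Xx)); first exact: (dominates_proj_r (Xi Xy) ip).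
exact: IH.
Qed.

(** Distinct members of [X] are orthogonal and hence commute; equal neighbours need no exchange. *)
Lemma prod_perm l l' : Permutation.Permutation l l' -> inX l -> interdef (tensor_prod l) (tensor_prod l').
Proof.
elim=> {l l'} [|x l l' ll' IH|x y l|l l' l'' ll' IH l'l'' IH'] Xl.
- by apply: interdef_refl; exact: unit_Sinv.
- have [Xx {}Xl] := inX_cons Xl; apply: interdef_tensor_r; last exact: IH.
  + exact/Sinv_prod/inX_Sinv.
  + apply/Sinv_prod/inX_Sinv => z zl'; apply: Xl.
    exact: Permutation.Permutation_in (Permutation.Permutation_sym ll') zl'.
  + exact: Xi.
- have [Xy /inX_cons[Xx {}Xl]] := inX_cons Xl; have ip := Sinv_prod (inX_Sinv Xl).
  case: (pselect (x = y)) => [->|xy] /=.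
    exact: (interdef_refl (Sinv_tensor (Xi Xy) (Sinv_tensor (Xi Xy) ip))).
  have ix := Xi Xx; have iy := Xi Xy; have ixy := Sinv_tensor ix iy; have iyx := Sinv_tensor iy ix.
  have ixp := Sinv_tensor ix ip; have iyp := Sinv_tensor iy ip.
  apply: (interdef_trans (Sinv_tensor iy ixp) (Sinv_tensor iyx ip)).
    exact: interdef_assoc.
  apply: (interdef_trans (Sinv_tensor iyx ip) (Sinv_tensor ixy ip)); last first.
    exact/interdef_sym/interdef_assoc.
  apply: interdef_tensor_l => //; apply: interdef_swap => //.
  exact: (orthX.2 _ _ Xx Xy xy).
- have Xl' : inX l'.
    move=> z zl'; apply: Xl; exact: Permutation.Permutation_in (Permutation.Permutation_sym ll') zl'.
  have Xl'' : inX l''.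
    move=> z zl'; apply: Xl'; exact: Permutation.Permutation_in (Permutation.Permutation_sym l'l'') zl'.
  apply: (interdef_trans _ _ (IH Xl) (IH' Xl')); exact/Sinv_prod/inX_Sinv.
Qed.

Lemma dup_perm l : ~ List.NoDup l -> exists x l', Permutation.Permutation l (x :: x :: l').
Proof.
elim: l => [|a l IH] nd; first by case: nd; constructor.
case: (pselect (List.In a l)) => al.
  have [l1 [l2 ->]] := List.in_split _ _ al; exists a, (l1 ++ l2).
  apply: Permutation.perm_skip; exact: Permutation.Permutation_sym (Permutation.Permutation_middle _ _ _).
have [|x [l' ll']] := IH; first by move=> h; apply: nd; constructor.
exists x, (a :: l'); apply: Permutation.perm_trans (Permutation.perm_skip a ll') _.
apply: Permutation.perm_trans (Permutation.perm_swap _ _ _) _.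
by apply: Permutation.perm_skip; exact: Permutation.perm_swap.
Qed.

(** A repeated factor is brought to the front and absorbed there: at the left end equidominance is
    preserved by products. *)
Lemma prod_nodup l : inX l -> exists l', [/\ List.NoDup l', forall x, List.In x l' <-> List.In x l &
  equidominant K (tensor_prod l) (tensor_prod l')].
Proof.
have [n] := ubnP (size l); elim: n l => // n IH l ln Xl.
have ip := Sinv_prod (inX_Sinv Xl).
case: (pselect (List.NoDup l)) => [nd|/dup_perm[x [l1 ll1]]].
  by exists l; split=> //; exact: equidominant_refl.
have in1 y : List.In y (x :: l1) <-> List.In y l.
  split=> [yl|/(Permutation.Permutation_in _ ll1)[->|//]]; last by left.
  by apply: (Permutation.Permutation_in _ (Permutation.Permutation_sym ll1)); right.
have Xl1 : inX (x :: l1) by move=> y /in1/Xl.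
have sl : size l = (size l1).+2 := Permutation.Permutation_length ll1.
have [|l' [nd' in' e']] := IH (x :: l1) _ Xl1; first by move: ln; rewrite sl ltnS.
exists l'; split=> // [y|]; first by rewrite in'.
have [Xx Xl0] := inX_cons Xl1; have ix := Xi Xx; have ip0 := Sinv_prod (inX_Sinv Xl0).
have ip1 := Sinv_prod (inX_Sinv Xl1).
have ip' : Sinv K (tensor_prod l') by apply/Sinv_prod/inX_Sinv => y /in'/in1/Xl.
apply: (equidominant_trans ip ip1 ip' _ e').
have i2 := Sinv_tensor ix ip1; have i3 := Sinv_tensor (Sinv_tensor ix ix) ip0.
apply: (equidominant_trans ip i2 ip1).
  apply: (interdef_equidominant ip i2); exact: prod_perm ll1 Xl.
apply: (equidominant_trans i2 i3 ip1).
  apply: (interdef_equidominant i2 i3); exact: interdef_assoc.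
apply: (equidominant_sym ip1 i3); apply: equidominant_tensor_l => //.
  exact: Sinv_tensor.
exact: tensor_idempotent (X1 Xx) (Xn Xx).
Qed.

Lemma prod_same l l' : inX l -> inX l' -> (forall x, List.In x l <-> List.In x l') ->
  equidominant K (tensor_prod l) (tensor_prod l').
Proof.
move=> Xl Xl' E; have ip := Sinv_prod (inX_Sinv Xl); have ip' := Sinv_prod (inX_Sinv Xl').
have [l1 [nd1 E1 e1]] := prod_nodup Xl; have [l2 [nd2 E2 e2]] := prod_nodup Xl'.
have X1' : inX l1 by move=> x /E1/Xl.
have X2' : inX l2 by move=> x /E2/Xl'.
have i1 := Sinv_prod (inX_Sinv X1'); have i2 := Sinv_prod (inX_Sinv X2').
apply: (equidominant_trans ip i1 ip' e1).
apply: (equidominant_trans i1 i2 ip'); last exact: (equidominant_sym ip' i2 e2).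
apply: (interdef_equidominant i1 i2); apply: prod_perm => //.
by apply: Permutation.NoDup_Permutation => // x; rewrite E1 E2.
Qed.

(** Factors of [l'] cross over to [l] one at a time by [orth_tensor]. A factor that has crossed must
    not occur again in [l'], whence [List.NoDup]. *)
Lemma prod_orth l l' : inX l -> inX l' -> List.NoDup l' ->
  (forall x, List.In x l -> ~ List.In x l') -> weakly_orthogonal (tensor_prod l) (tensor_prod l').
Proof.
elim: l' l => [|y l' IH] l Xl Xl' nd disj.
  by apply: orth_unit; exact/Sinv_prod/inX_Sinv.
have [Xy {}Xl'] := inX_cons Xl'; have ip := Sinv_prod (inX_Sinv Xl).
have ip' := Sinv_prod (inX_Sinv Xl'); have iy := Xi Xy.
have [nyl' nd'] : ~ List.In y l' /\ List.NoDup l' by inversion nd.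
have o : weakly_orthogonal (tensor_prod l) y.
  apply: contrapT => /(nonorthP ip (X1 Xy) (Xn Xy))/(prod_dominatesP Xl Xy) yl.
  by apply: (disj y yl); left.
apply: (orth_tensor ip iy ip' o).
have Xy1 : inX [:: y] by move=> _ [<-|[]].
have Xly : inX (l ++ [:: y]) by move=> x /in_cat_iff[/Xl|/Xy1].
have ily := Sinv_prod (inX_Sinv Xly); have iy1 := Sinv_prod (inX_Sinv Xy1).
have i2 := Sinv_tensor ip iy1; have i3 := Sinv_tensor ip iy.
apply: (orth_dominates ily i3 ip').
  apply: (dominates_trans ily i2 i3).
    by apply: interdef_dominates => //; apply/interdef_sym/prod_cat; exact: inX_Sinv.
  apply: interdef_dominates => //; apply: interdef_tensor_r => //.
  exact: interdef_unit_r.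
apply: IH => // x /in_cat_iff[xl xl'|[<-//|[]]]; by apply: (disj x xl); right.
Qed.

End Family.
(** Conclusions of the theorem that mention no family are nevertheless proved through one. *)
Lemma maximal_orthogonal_family_ex : exists X : set (gtype U), maximal_orthogonal_family K X.
Proof.
have [F FP Ftot|X [oX maxX]] := @Zorn_bigcup (gtype U) (@orthogonal_family K L U).
  split=> [p [Y FY Yp]|p q [Y FY Yp] [Z FZ Zq] pq]; first exact: (FP _ FY).1.
  have [YZ|ZY] := Ftot _ _ FY FZ; first exact: (FP _ FZ).2 (YZ _ Yp) Zq pq.
  exact: (FP _ FY).2 Yp (ZY _ Zq) pq.
exists X; split=> // Y oY XY; apply/seteqP; split=> //.
by apply: contrapT => YX; apply: (maxX Y) => //; split.
Qed.

(** * Classification by a maximal orthogonal family *)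

Section Family.
Variable X : set (gtype U).
Hypothesis maxX : maximal_orthogonal_family K X.

Let oX : orthogonal_family K X. Proof. by case: maxX. Qed.
Let X1 x : X x -> Sinv1 K x. Proof. by move=> /(oX.1 _)[]. Qed.
Let Xi x : X x -> Sinv K x. Proof. by move=> /X1[]. Qed.
Let Xn x : X x -> ~ realised x. Proof. by move=> /(oX.1 _)[]. Qed.
Let SinvX l : inX X l -> Sinv K (tensor_prod l).
Proof. by move=> Xl; exact/Sinv_prod/(inX_Sinv oX). Qed.

Lemma product_Sinv p : product_of_1types K p -> Sinv K p.
Proof. by elim=> [q []//|q r _ iq [ir _]]; exact: Sinv_tensor. Qed.

(** A nonrealised 1-type orthogonal to all of [X] could be added to [X]; otherwise it is
    interdefinable with the member to which it is not orthogonal. *)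
Lemma one_type_prod q : Sinv1 K q -> exists l, inX X l /\ interdef q (tensor_prod l).
Proof.
move=> q1; have [iq _] := q1.
case: (pselect (realised q)) => rq.
  by exists [::]; split=> //; exact: realised_interdef.
suff [x [Xx qx]] : exists x, X x /\ interdef q x.
  have Xl : inX X [:: x] by move=> _ [<-|[]].
  exists [:: x]; split=> //; apply: (interdef_trans iq (Xi Xx) qx).
  exact/interdef_sym/(interdef_unit_r (Xi Xx)).
apply: contrapT => H; have qX x : X x -> weakly_orthogonal q x.
  move=> Xx; apply: contrapT => no; apply: H; exists x; split=> //.
  apply: (dominates_interdef q1 (X1 Xx) (Xn Xx)).
  by apply/(nonorthP iq (X1 Xx) (Xn Xx)).
have Xq : X q.
  have <- : X `|` [set q] = X; last by right.
  apply: maxX.2; last by move=> x; left.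
  split=> [x [/(oX.1 _)//|->//]|x y [Xx|->] [Xy|->] xy //].
  - exact: oX.2.
  - exact: (orth_sym iq (Xi Xx)) (qX _ Xx).
  - exact: qX.
by apply: H; exists q; split=> //; exact: interdef_refl.
Qed.

Lemma product_prod p : product_of_1types K p -> exists l, inX X l /\ interdef p (tensor_prod l).
Proof.
elim=> [q|q r qprod [l [Xl ql]] r1]; first exact: one_type_prod.
have [l' [Xl' rl']] := one_type_prod r1; have ir := r1.1; have iq := product_Sinv qprod.
have il := SinvX Xl; have il' := SinvX Xl'.
have Xll : inX X (l ++ l') by move=> x /in_cat_iff[/Xl|/Xl'].
exists (l ++ l'); split=> //.
apply: (interdef_trans (Sinv_tensor iq ir) (Sinv_tensor il ir)).
  exact: interdef_tensor_l.
apply: (interdef_trans (Sinv_tensor il ir) (Sinv_tensor il il')).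
  exact: interdef_tensor_r.
by apply: prod_cat; exact: (inX_Sinv oX).
Qed.

Section Equiv.
Hypothesis generated : forall p : gtype U, Sinv K p ->
  exists2 p', product_of_1types K p' & dom_equiv K p p'.

Lemma dom_equiv_trans p q r : Sinv K p -> Sinv K q -> Sinv K r ->
  dom_equiv K p q -> dom_equiv K q r -> dom_equiv K p r.
Proof.
move=> ip iq ir [pq qp] [qr rq].
by split; [exact: (dominates_trans ip iq ir)|exact: (dominates_trans ir iq ip)].
Qed.

Lemma generated_prod p : Sinv K p -> exists l, [/\ inX X l, List.NoDup l & dom_equiv K p (tensor_prod l)].
Proof.
move=> ip; have [p' p'tensor_prod e] := generated ip; have ip' := product_Sinv p'tensor_prod.
have [l [Xl e']] := product_prod p'tensor_prod; have il := SinvX Xl.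
have [l' [nd E e'']] := prod_nodup oX Xl.
have Xl' : inX X l' by move=> x /E/Xl.
exists l'; split=> //; apply: (dom_equiv_trans ip ip' (SinvX Xl') e).
apply: (dom_equiv_trans ip' il (SinvX Xl')); apply: equidominant_dom_equiv => //.
  exact: interdef_equidominant.
exact: SinvX.
Qed.

Lemma dominates_prod p l x : Sinv K p -> inX X l -> dom_equiv K p (tensor_prod l) -> X x ->
  dominates K p x <-> List.In x l.
Proof.
move=> ip Xl [pl lp] Xx; have il := SinvX Xl.
rewrite -(prod_dominatesP oX Xl Xx); split=> d.
  exact: (dominates_trans il ip (Xi Xx)).
exact: (dominates_trans ip il (Xi Xx)).
Qed.

(** If [q] dominates no new member of [X], its list can be joined to that of [p] without changing
    the product up to equidominance; the joined product has the list of [q] as a factor. *)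
Lemma dominatesX p q : Sinv K p -> Sinv K q ->
  dominates K p q <-> forall x, X x -> dominates K q x -> dominates K p x.
Proof.
move=> ip iq; split=> [d x Xx|H]; first exact: (dominates_trans ip iq (Xi Xx)).
have [l [Xl _ pl]] := generated_prod ip; have [l' [Xl' _ ql']] := generated_prod iq.
have il := SinvX Xl; have il' := SinvX Xl'.
have Xll : inX X (l' ++ l) by move=> x /in_cat_iff[/Xl'|/Xl].
have ill := SinvX Xll; have ipp := Sinv_tensor il' il.
apply: (dominates_trans ip il iq pl.1).
apply: (dominates_trans il ill iq).
  apply/equidominant_dominates/(prod_same oX) => // x; rewrite in_cat_iff.
  split=> [|[xl'|//]]; first by right.
  have Xx := Xl' _ xl'; apply/(dominates_prod ip Xl pl Xx)/H => //.
  exact/(dominates_prod iq Xl' ql' Xx).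
apply: (dominates_trans ill ipp iq).
  apply: interdef_dominates => //; apply/interdef_sym/prod_cat; exact: (inX_Sinv oX).
exact: (dominates_trans ipp il' iq (dominates_proj_l il' il) ql'.2).
Qed.

Lemma dom_equivX p q : Sinv K p -> Sinv K q ->
  dom_equiv K p q <-> forall x, X x -> dominates K p x <-> dominates K q x.
Proof.
move=> ip iq; rewrite /dom_equiv !dominatesX //; split=> [[H H'] x Xx|H].
  by split; [exact: H'|exact: H].
by split=> x Xx; have [] := H x Xx.
Qed.

Lemma tensorX p q x : Sinv K p -> Sinv K q -> X x ->
  dominates K (tensor K p q) x <-> dominates K p x \/ dominates K q x.
Proof.
move=> ip iq Xx; have ix := Xi Xx; have ipq := Sinv_tensor ip iq.
split=> [d|[]]; last 2 first.
- exact: (dominates_trans ipq ip ix (dominates_proj_l ip iq)).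
- exact: (dominates_trans ipq iq ix (dominates_proj_r ip iq)).
(* Only [p] is replaced by its list, since so far domination is known to be preserved in the left
   factor only. *)
have [l [Xl _ pl]] := generated_prod ip; have il := SinvX Xl.
have ilq := Sinv_tensor il iq.
have {}d : dominates K (tensor K (tensor_prod l) q) x.
  apply: (dominates_trans ilq ipq ix _ d).
  exact: (dominates_tensor_l il ip iq pl.2).
have [xl|] := prod_tensor_dominates oX Xl iq Xx d; last by right.
by left; apply/(dominates_prod ip Xl pl Xx).
Qed.

Lemma orthX p q : Sinv K p -> Sinv K q ->
  weakly_orthogonal p q <-> forall x, X x -> dominates K p x -> ~ dominates K q x.
Proof.
move=> ip iq; split=> [o x Xx px qx|H].
  have ix := Xi Xx; apply: (nonorth_self (X1 Xx) (Xn Xx)).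
  apply: (orth_dominates iq ix ix qx); apply: (orth_sym ix iq).
  exact: (orth_dominates ip ix iq px o).
have [l [Xl _ pl]] := generated_prod ip; have [l' [Xl' nd ql']] := generated_prod iq.
have il := SinvX Xl; have il' := SinvX Xl'.
apply: (orth_dominates il ip iq pl.2); apply: (orth_sym iq il).
apply: (orth_dominates il' iq il ql'.2); apply: (orth_sym il il').
apply: (prod_orth oX Xl Xl' nd) => x xl xl'; have Xx := Xl _ xl.
by apply: (H x Xx); [exact/(dominates_prod ip Xl pl Xx)|exact/(dominates_prod iq Xl' ql' Xx)].
Qed.

(** In the right factor the claim reduces, by [dominatesX] and [tensorX], to the monotonicity of
    union. *)
Lemma respects : tensor_respects_domination K U.
Proof.
move=> p0 p1 q i0 i1 iq d; split; first exact: dominates_tensor_l.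
apply/(dominatesX (Sinv_tensor iq i0) (Sinv_tensor iq i1)) => x Xx.
rewrite !tensorX // => -[|d1]; [by left|right].
exact: (dominates_trans i0 i1 (Xi Xx) d d1).
Qed.

Lemma class_eq p q : Sinv K p -> Sinv K q -> dom_equiv K p q -> dom_class K p = dom_class K q.
Proof.
move=> ip iq e; apply/seteqP; split=> r [ir er]; split=> //.
  by apply: (dom_equiv_trans iq ip ir _ er); case: e.
exact: (dom_equiv_trans ip iq ir e er).
Qed.

Lemma dom_equiv_refl p : Sinv K p -> dom_equiv K p p.
Proof. by move=> ip; split; exact/equidominant_dominates/equidominant_refl. Qed.

Lemma class_self p : Sinv K p -> dom_class K p p.
Proof. by move=> ip; split=> //; exact: dom_equiv_refl. Qed.

Lemma mul_class p q : Sinv K p -> Sinv K q ->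
  Inv_mul K (dom_class K p) (dom_class K q) = dom_class K (tensor K p q).
Proof.
move=> ip iq; apply/seteqP; split=> r [ir].
  move=> [p' [q' [[ip' ep] [iq' eq] er]]]; split=> //.
  apply: (dom_equiv_trans (Sinv_tensor ip iq) (Sinv_tensor ip' iq') ir _ er).
  apply/(dom_equivX (Sinv_tensor ip iq) (Sinv_tensor ip' iq')) => x Xx.
  rewrite !tensorX //; move/(dom_equivX ip ip')/(_ x Xx): ep => ->.
  by move/(dom_equivX iq iq')/(_ x Xx): eq => ->.
by move=> er; split=> //; exists p, q; split=> //; exact: class_self.
Qed.

Lemma ge_class p q : Sinv K p -> Sinv K q ->
  Inv_ge K (dom_class K p) (dom_class K q) <-> dominates K p q.
Proof.
move=> ip iq; split=> [[p' [q' [[ip' ep] [iq' eq] d]]]|d].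
  apply: (dominates_trans ip ip' iq ep.1).
  exact: (dominates_trans ip' iq' iq d eq.2).
by exists p, q; split=> //; exact: class_self.
Qed.

Lemma perp_class p q : Sinv K p -> Sinv K q ->
  Inv_perp (dom_class K p) (dom_class K q) <-> weakly_orthogonal p q.
Proof.
move=> ip iq; split=> [[p' [q' [[ip' ep] [iq' eq] o]]]|o].
  apply: (orth_dominates ip' ip iq ep.2); apply: (orth_sym iq ip').
  apply: (orth_dominates iq' iq ip' eq.2); exact: (orth_sym ip' iq').
by exists p, q; split=> //; exact: class_self.
Qed.

Lemma well_defined : Inv_well_defined K U.
Proof.
split; [exact: Sinv_tensor| |exact: mul_class|exact: ge_class|exact: perp_class].
by move=> p q r e e' ip iq ir; exact: (dom_equiv_trans ip iq ir).
Qed.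

Lemma one_class : Inv_one K U = dom_class K unit_type.
Proof.
have iu := unit_Sinv; apply/seteqP; split=> p [ip].
  move=> rp; split=> //; have e := realised_interdef ip rp.
  by split; apply: interdef_dominates => //; exact: interdef_sym.
by move=> [up _]; split=> //; exact: dominated_unit.
Qed.

Lemma tilde_class c : Inv_tilde K U c -> exists2 p, Sinv K p & c = dom_class K p.
Proof. by move=> [p ip <-]; exists p. Qed.

Lemma class_tilde p : Sinv K p -> Inv_tilde K U (dom_class K p).
Proof. by exists p. Qed.

Lemma tilde_monoid : ordered_monoid (Inv_tilde K U) (@Inv_mul K L U) (Inv_one K U) (@Inv_ge K L U).
Proof.
have iu := unit_Sinv; have eqX p q : Sinv K p -> Sinv K q -> (forall x, X x -> dominates K p x <-> dominates K q x) ->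
    dom_class K p = dom_class K q.
  by move=> ip iq h; apply: class_eq => //; apply/dom_equivX.
have uX x : X x -> ~ dominates K unit_type x.
  by move=> Xx /(dominated_unit (Xi Xx)); exact: Xn.
split.
- by rewrite one_class; exact: class_tilde.
- move=> _ _ /tilde_class[p ip ->] /tilde_class[q iq ->]; rewrite mul_class //.
  exact/class_tilde/Sinv_tensor.
- split=> [_ _ _ /tilde_class[p ip ->] /tilde_class[q iq ->] /tilde_class[r ir ->]
    |_ /tilde_class[p ip ->]|_ /tilde_class[p ip ->]].
  + rewrite !mul_class //; do ?exact: Sinv_tensor.
    apply: eqX; do ?[exact: Sinv_tensor|by apply: Sinv_tensor => //; exact: Sinv_tensor] => x Xx.
    by rewrite !tensorX //; do ?exact: Sinv_tensor; tauto.
  + rewrite one_class mul_class //; apply: eqX => //; first exact: Sinv_tensor.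
    by move=> x Xx; rewrite tensorX //; have := uX x Xx; tauto.
  + rewrite one_class mul_class //; apply: eqX => //; first exact: Sinv_tensor.
    by move=> x Xx; rewrite tensorX //; have := uX x Xx; tauto.
- split=> [_ /tilde_class[p ip ->]|_ _ /tilde_class[p ip ->] /tilde_class[q iq ->]
    |_ _ _ /tilde_class[p ip ->] /tilde_class[q iq ->] /tilde_class[r ir ->]].
  + by rewrite ge_class //; case: (dom_equiv_refl ip).
  + by rewrite !ge_class // => d d'; apply: class_eq.
  + by rewrite !ge_class //; exact: dominates_trans.
- move=> _ _ _ /tilde_class[p ip ->] /tilde_class[q iq ->] /tilde_class[r ir ->].
  rewrite ge_class // !mul_class // => d.
  by rewrite !ge_class; do ?exact: Sinv_tensor; have [] := respects ip iq ir d.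
Qed.

Lemma family_iso : exists f : set (gtype U) -> set (gtype U), domination_iso K X f.
Proof.
pose f (c : set (gtype U)) : set (gtype U) := [set x | X x /\ exists p, c p /\ dominates K p x].
have fE p : Sinv K p -> f (dom_class K p) = [set x | X x /\ dominates K p x].
  move=> ip; apply/seteqP; split=> x [Xx].
    move=> [q [[iq [pq _]] qx]]; split=> //; exact: (dominates_trans ip iq (Xi Xx) pq qx).
  by move=> px; split=> //; exists p; split=> //; exact: class_self.
exists f; split.
- split=> [_ /tilde_class[p ip ->]|c d /set_mem/tilde_class[p ip ->] /set_mem/tilde_class[q iq ->]|Y [YX finY]].
  + rewrite fE //; split=> [x []//|]; have [l [Xl _ pl]] := generated_prod ip.
    apply: (@sub_finite_set _ _ [set x | List.In x l]).
      by move=> x [Xx /(dominates_prod ip Xl pl Xx)].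
    exact: list_finite.
  + rewrite !fE // => /predeqP E; apply: class_eq => //; apply/dom_equivX => // x Xx.
    by have [h h'] := E x; split=> ?; [have [] := h|have [] := h'].
  + have [l lY] := finite_list finY.
    have Xl : inX X l by move=> x /lY/YX.
    exists (dom_class K (tensor_prod l)); first exact/class_tilde/SinvX.
    rewrite fE; last exact: SinvX.
    apply/seteqP; split=> x; first by move=> [Xx /(prod_dominatesP oX Xl Xx)/lY].
    by move=> Yx; split; [exact: YX|apply/(prod_dominatesP oX Xl (YX _ Yx))/lY].
- rewrite one_class fE; last exact: unit_Sinv.
  apply/seteqP; split=> x // [Xx] /(dominated_unit (Xi Xx)); exact: Xn.
- move=> _ _ /tilde_class[p ip ->] /tilde_class[q iq ->].
  rewrite mul_class // !fE //; last exact: Sinv_tensor.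
  apply/seteqP; split=> x; first by move=> [Xx /(tensorX ip iq Xx)[]]; [left|right].
  by move=> [] [Xx h]; split=> //; apply/(tensorX ip iq Xx); [left|right].
- move=> _ _ /tilde_class[p ip ->] /tilde_class[q iq ->].
  rewrite ge_class // !fE // dominatesX //; split=> [H x [Xx /(H _ Xx)]//|H x Xx qx].
  by have [] := H x (conj Xx qx).
- move=> _ _ /tilde_class[p ip ->] /tilde_class[q iq ->].
  rewrite perp_class // !fE // orthX //; split=> [H|/predeqP H x Xx px qx].
    by apply/seteqP; split=> x // [[Xx px] [_ qx]]; exact: (H x Xx px qx).
  by have [h _] := H x; apply: h.
Qed.

End Equiv.

(** Domination equivalence determines only the set of factors from [X], but by [prod_same] this set
    fixes the product up to equidominance. *)
Lemma equidominant_iff :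
  (forall p : gtype U, Sinv K p -> exists2 p', product_of_1types K p' & equidominant K p p') ->
  forall p q, Sinv K p -> Sinv K q -> equidominant K p q <-> dom_equiv K p q.
Proof.
move=> gen_ p q ip iq; split; first exact: equidominant_dom_equiv.
have gen_prod r : Sinv K r -> exists l, inX X l /\ equidominant K r (tensor_prod l).
  move=> ir; have [r' r'tensor_prod e] := gen_ _ ir; have ir' := product_Sinv r'tensor_prod.
  have [l [Xl e']] := product_prod r'tensor_prod; exists l; split=> //.
  apply: (equidominant_trans ir ir' (SinvX Xl) e).
  exact: (interdef_equidominant ir' (SinvX Xl)).
move=> [pq qp]; have [l [Xl e]] := gen_prod _ ip; have [l' [Xl' e']] := gen_prod _ iq.
have il := SinvX Xl; have il' := SinvX Xl'.
apply: (equidominant_trans ip il iq e).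
apply: (equidominant_trans il il' iq); last exact: (equidominant_sym iq il').
apply: (prod_same oX) => // x.
have pl := equidominant_dom_equiv ip il e.
have ql := equidominant_dom_equiv iq il' e'.
split=> xl.
  have Xx := Xl _ xl; apply/(dominates_prod iq Xl' ql Xx).
  by apply: (dominates_trans iq ip (Xi Xx) qp); exact/(dominates_prod ip Xl pl Xx).
have Xx := Xl' _ xl; apply/(dominates_prod ip Xl pl Xx).
by apply: (dominates_trans ip iq (Xi Xx) pq); exact/(dominates_prod iq Xl' ql Xx).
Qed.

End Family.
End OneTypes.
End Monster.

Theorem theorem2p13 (L : language) (T : theory L) (K : Type) (U : structure L)
    (T_complete : complete_theory T) (T_infinite : has_infinite_model T)
    (T_omin : o_minimal T) (U_monster : monster K T U)
    (generated : forall p : gtype U, Sinv K p ->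
       exists2 p', product_of_1types K p' & dom_equiv K p p') :
  [/\ tensor_respects_domination K U,
      Inv_well_defined K U,
      ordered_monoid (Inv_tilde K U) (@Inv_mul K L U) (Inv_one K U) (@Inv_ge K L U),
      (forall X : set (gtype U), maximal_orthogonal_family K X ->
         exists f : set (gtype U) -> set (gtype U), domination_iso K X f) &
      ((forall p : gtype U, Sinv K p ->
          exists2 p', product_of_1types K p' & equidominant K p p') ->
       (forall p q : gtype U, Sinv K p -> Sinv K q ->
          (equidominant K p q <-> dom_equiv K p q)) /\
       Inv_bar K U = Inv_tilde K U)].
Proof.
have [ltf Hlt] := T_omin; have omin : o_minimal_structure (@rel_of L U ltf).
  by apply: Hlt; case: U_monster.
have [X maxX] := maximal_orthogonal_family_ex K U.
split.
- exact: (respects U_monster omin maxX generated).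
- exact: (well_defined U_monster omin maxX generated).
- exact: (tilde_monoid U_monster omin maxX generated).
- by move=> Y maxY; exact: (family_iso U_monster omin maxY generated).
- move=> gen_; have E := equidominant_iff U_monster omin maxX gen_; split=> //.
  have cl (p : gtype U) : Sinv K p -> [set q | Sinv K q /\ equidominant K p q] = [set q | Sinv K q /\ dom_equiv K p q].
    by move=> ip; apply/seteqP; split=> q [iq] /(E _ _ ip iq).
  apply/seteqP; split=> _ [p ip <-]; exists p => //=; first exact/esym/cl.
  exact: cl.
Qed.
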